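(* Let $\ell\in\mathbb{Z}_{\ge 0}$, and let $f:\mathbb{C}_+\to\mathbb{C}$ and $g:\mathbb{C}_+\to\mathbb{C}_+$ be analytic functions. Then the operator $W_{f,g,\max}$ is $\mathcal{C}_\star$-selfadjoint on $\mathbb{B}_\ell(\mathbb{C}_+)$ if and only if one of the following three cases holds (for all $w\in\mathbb{C}_+$): (1) $g(w)=\alpha$ and $f(w)=\dfrac{\beta}{(1+\alpha w)^{\ell+2}}$, where $\alpha\in\mathbb{C}_+$ and $\beta\in\mathbb{C}$; (2) $g(w)=\lambda w$ and $f(w)=\theta$, where $\lambda\in\mathbb{R}_{>0}$ and $\theta\in\mathbb{C}$; (3) $g(w)=\delta+\dfrac{1-\delta\kappa}{w+\kappa}$ and $f(w)=\dfrac{r}{(w+\kappa)^{\ell+2}}$, where $\delta,\kappa,r\in\mathbb{C}$ and either $\delta\in i\mathbb{R}$, $\delta\kappa\in\mathbb{R}$, $\delta\kappa<1$ and $\operatorname{Re}\kappa\ge 0$, or $-\operatorname{Re}\delta<0\le\operatorname{Re}\kappa-\dfrac{\operatorname{Re}(\delta\kappa-1)+|\delta\kappa-1|}{2\operatorname{Re}\delta}$. In this case, the operator $W_{f,g,\max}$ is bounded.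
   Context: $\mathbb{C}_+=\{z\in\mathbb{C}:\operatorname{Re}z>0\}$. For $\ell\in\mathbb{Z}_{\ge0}$, the weighted Bergman space $\mathbb{B}_\ell(\mathbb{C}_+)$ is the Hilbert space of analytic functions $h:\mathbb{C}_+\to\mathbb{C}$ with $\|h\|^2=\frac1\pi\int_{-\infty}^{\infty}\int_0^\infty x^\ell|h(x+iy)|^2\,dx\,dy<\infty$. For analytic $f:\mathbb{C}_+\to\mathbb{C}$ and $g:\mathbb{C}_+\to\mathbb{C}_+$, the maximal weighted composition operator $W_{f,g,\max}$ has domain $\{h\in\mathbb{B}_\ell(\mathbb{C}_+): f\cdot(h\circ g)\in\mathbb{B}_\ell(\mathbb{C}_+)\}$ and acts by $W_{f,g,\max}h=f\cdot(h\circ g)$. It is called bounded if its domain is all of $\mathbb{B}_\ell(\mathbb{C}_+)$ and there is $L>0$ with $\|W_{f,g,\max}h\|\le L\|h\|$ for every $h$. A conjugation is an anti-linear isometric involution. For a conjugation $\mathcal{C}$, a (densely defined, not necessarily bounded) linear operator $B$ is called $\mathcal{C}$-selfadjoint if $B=\mathcal{C}B^*\mathcal{C}$ (equality including domains). $\mathcal{C}_\star$ is the conjugation on $\mathbb{B}_\ell(\mathbb{C}_+)$ given by $\mathcal{C}_\star h(z)=\dfrac{1}{z^{\ell+2}}\overline{h\left(\dfrac{1}{\overline z}\right)}$.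
   Formalization: The ''only if'' direction assumes f is not identically zero; for f ≡ 0 the operator is zero and is C⋆-selfadjoint for every analytic g, e.g. g(w) = w + e^{-w} + 1, so that direction fails as stated. The ''if'' direction and boundedness are proved for all f. *)

(* Defs.v *)
From HB Require Import structures.
From mathcomp Require Import all_boot all_order all_algebra.
From mathcomp Require Import all_classical all_reals all_analysis.
From mathcomp Require Import complex.
Set Implicit Arguments.
Unset Strict Implicit.
Unset Printing Implicit Defensive.
Import Order.TTheory GRing.Theory Num.Theory.
Import numFieldNormedType.Exports.
Local Open Scope classical_set_scope.
Local Open Scope ring_scope.
Local Open Scope complex_scope.

Section Bergman.
Variable R : realType.

Definition Cplus : Type := {z : R[i] | 0 < complex.Re z}.

(* [ext h] makes a function on the half-plane total, with junk value 0, because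
   derivatives and integrals are taken of total functions; only its values on
   the open half-plane are ever used. *)
Definition ext (h : Cplus -> R[i]) (z : R[i]) : R[i] :=
  if insub z is Some w then h w else 0.

(* Complex differentiability at every point of the (open) half-plane. The
   topology of [R[i]] is carried by the regular module [R[i]^o]. *)
Definition analytic (h : Cplus -> R[i]) : Prop :=
  forall z : Cplus, derivable (ext h : R[i]^o -> R[i]^o) (val z) 1.

(* Planar Lebesgue measure; the point [p] stands for [p.1 + i p.2]. *)
Local Notation area :=
  ((@lebesgue_measure R) \x (@lebesgue_measure R))%E.

Definition half_plane : set (R * R) := [set p | 0 < p.1].

Definition bergman_sqnorm (l : nat) (h : Cplus -> R[i]) : \bar R :=
  ((pi^-1)%:E * \int[area]_(p in half_plane)
     (p.1 ^+ l * Normc.normc (ext h (p.1 +i* p.2)) ^+ 2)%:E)%E.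

Definition bergman (l : nat) : set (Cplus -> R[i]) :=
  [set h | analytic h /\ (bergman_sqnorm l h < +oo)%E].

Definition bergman_norm (l : nat) (h : Cplus -> R[i]) : R :=
  Num.sqrt (fine (bergman_sqnorm l h)).

Definition bergman_dot (l : nat) (h k : Cplus -> R[i]) : R[i] :=
  let F (p : R * R) : R[i] := (p.1 ^+ l)%:C *
    (ext h (p.1 +i* p.2) * (ext k (p.1 +i* p.2))^*) in
  (pi^-1)%:C * ((\int[area]_(p in half_plane) complex.Re (F p)) +i*
                (\int[area]_(p in half_plane) complex.Im (F p))).

(* A possibly unbounded operator is given by its graph, so that equality of
   operators includes equality of domains. *)
Definition operator := set ((Cplus -> R[i]) * (Cplus -> R[i])).

Definition dom (T : operator) : set (Cplus -> R[i]) :=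
  [set h | exists u, T (h, u)].

Definition densely_defined (l : nat) (T : operator) : Prop :=
  forall h, bergman l h -> forall e : R, 0 < e ->
    exists2 k, dom T k & bergman_norm l (h \- k) < e.

Definition adjoint (l : nat) (T : operator) : operator :=
  [set q | [/\ bergman l q.1, bergman l q.2 &
     forall h u, T (h, u) -> bergman_dot l u q.1 = bergman_dot l h q.2]].

(* The composite [C T C], where [C] is defined on the Bergman space. *)
Definition conj_by (l : nat) (C : (Cplus -> R[i]) -> (Cplus -> R[i]))
    (T : operator) : operator :=
  [set q | bergman l q.1 /\ exists2 u, T (C q.1, u) & q.2 = C u].

Definition C_selfadjoint (l : nat) (C : (Cplus -> R[i]) -> (Cplus -> R[i]))
    (T : operator) : Prop :=
  densely_defined l T /\ T = conj_by l C (adjoint l T).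

Lemma Re_inv_conj_gt0 (z : Cplus) : 0 < complex.Re ((val z)^*^-1).
Proof.
case: z => -[a b] /= a0.
apply: divr_gt0 => //.
by rewrite sqrrN ltr_wpDr ?sqr_ge0// exprn_gt0.
Qed.

Definition inv_conj (z : Cplus) : Cplus :=
  exist _ ((val z)^*^-1) (Re_inv_conj_gt0 z).

Definition C_star (l : nat) (h : Cplus -> R[i]) : Cplus -> R[i] :=
  fun z => (val z ^+ (l + 2))^-1 * (h (inv_conj z))^*.

Definition W_max (l : nat) (f : Cplus -> R[i]) (g : Cplus -> Cplus) :
    operator :=
  [set q | [/\ bergman l q.1, bergman l (fun z => f z * q.1 (g z)) &
     q.2 = (fun z => f z * q.1 (g z))]].

Definition bounded_op (l : nat) (T : operator) : Prop :=
  dom T = bergman l /\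
  exists2 L : R, 0 < L &
    forall h u, T (h, u) -> bergman_norm l u <= L * bergman_norm l h.

Definition constant_case (l : nat) (f : Cplus -> R[i]) (g : Cplus -> Cplus) : Prop :=
  exists (alpha : Cplus) (beta : R[i]), forall w : Cplus,
    g w = alpha /\ f w = beta / (1 + val alpha * val w) ^+ (l + 2).

Definition dilation_case (f : Cplus -> R[i]) (g : Cplus -> Cplus) : Prop :=
  exists (lambda : R) (theta : R[i]), 0 < lambda /\ forall w : Cplus,
    val (g w) = lambda%:C * val w /\ f w = theta.

Definition moebius_case (l : nat) (f : Cplus -> R[i]) (g : Cplus -> Cplus) : Prop :=
  exists delta kappa r : R[i],
    ([/\ complex.Re delta = 0, complex.Im (delta * kappa) = 0,
         complex.Re (delta * kappa) < 1 & 0 <= complex.Re kappa] \/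
     (- complex.Re delta < 0 /\
      0 <= complex.Re kappa -
           (complex.Re (delta * kappa - 1) +
            Normc.normc (delta * kappa - 1)) /
           (2 * complex.Re delta))) /\
    forall w : Cplus,
      val (g w) = delta + (1 - delta * kappa) / (val w + kappa) /\
      f w = r / (val w + kappa) ^+ (l + 2).

End Bergman.

(* Main.v *)
From HB Require Import structures.
Require Import Defs.
From mathcomp Require Import all_boot all_order all_algebra.
From mathcomp Require Import all_classical all_reals all_analysis.
From mathcomp Require Import measurable_realfun.
From mathcomp Require Import complex.
From mathcomp Require Import ring lra.
Set Implicit Arguments.
Unset Strict Implicit.
Unset Printing Implicit Defensive.
Import Order.TTheory GRing.Theory Num.Theory.
Import numFieldNormedType.Exports.
Local Open Scope classical_set_scope.
Local Open Scope ring_scope.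
Local Open Scope complex_scope.

(* Point evaluations on the Bergman space are given by the kernels
   K_z(w) = (l+1) 2^l / (w + conj z)^(l+2). Testing C-selfadjointness on kernels
   gives the symmetry f(w) / (1 + z g(w))^(l+2) = f(z) / (1 + g(z) w)^(l+2).
   Conversely this symmetry gives <W K_v, C k> = <K_v, C W k> for every kernel,
   and hence <W h, C k> = <h, C W k> for all h by expanding h in kernels, once
   Fubini is justified by Schur's test with weight sqrt (Re w).

   The symmetry says that a product of linear factors in g(z), g(w) has the same
   (l+2)-nd power as the one with z and w exchanged; the quotient is continuous
   with values in roots of unity and equals 1 on the diagonal, so the products
   agree. The resulting equation makes g a dilation or g(w)(w + kappa) =
   1 + delta w, and g mapping the half-plane into itself amounts to the positivity
   of a quadratic form, which yields the conditions on delta and kappa.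

   Boundedness is a change of variables under the map g together with
   |1 - delta kappa| Re w <= |w + kappa|^2 Re g(w). The reproducing formula comes
   from Cauchy's formula on vertical lines: for fixed s the integral of
   h(x + iy) / (z + s - x - iy)^(l+2) over y does not depend on x, which allows
   one to replace h(x + iy) by h(x0 + iy) and to integrate in x first. *)

(** The adjoint is explicit on kernels: [<W h, K_z> = f(z) h(g(z))] on the whole domain of [W], so
    [K_z] lies in the domain of the adjoint and is sent to [conj (f z) K_(g z)], bounded or not.
    Necessity is therefore pure algebra and function theory. The converse is the costly direction,
    since an identity on kernels reaches all [h] only through an absolutely convergent double
    integral. The test function [(Re w)^(-1/2)] serves there because integrating it against [|K_z|]
    returns a multiple of its value at [z], for every [l]. One estimate, [bounded_change], yields
    both the boundedness and the Schur bound. For a Moebius map it rests on the Schwarz-Pick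
    inequality [|g'(z)| Re z <= Re (g z)]. A constant [g] is out of its reach, as it concentrates
    area in a point; there [W] has rank one and is treated by hand, and the Moebius maps with
    [delta kappa = 1] reduce to this case. The function [f = 0] is set apart in the necessity: the
    zero operator is selfadjoint for this conjugation whatever [g] is. *)

Local Notation N := Normc.normc.
Local Notation Re := complex.Re.
Local Notation Im := complex.Im.

(** * Complex differentiability *)

Section ComplexNorm.
Context {R : realType}.
Implicit Types (z w : R[i]) (x y : R).

Lemma normcC z : `|z| = (N z)%:C. Proof. by []. Qed.

Lemma normc_ge0 z : 0 <= N z. Proof. by case: z => a b; exact: sqrtr_ge0. Qed.

Lemma sqr_normcE z : N z ^+ 2 = Re z ^+ 2 + Im z ^+ 2.
Proof. by case: z => a b /=; rewrite sqr_sqrtr// addr_ge0// sqr_ge0. Qed.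

Lemma normc_eq0 z : (N z == 0) = (z == 0).
Proof.
by apply/eqP/eqP => [/Normc.eq0_normc//|->]; rewrite Normc.normc0.
Qed.

Lemma normc_gt0 z : (0 < N z) = (z != 0).
Proof. by rewrite lt_neqAle normc_ge0 andbT eq_sym normc_eq0. Qed.

Lemma normc_Re z : `|Re z| <= N z.
Proof.
rewrite -(@ler_pXn2r _ 2)// ?nnegrE ?normc_ge0// sqr_normcE real_normK ?num_real//.
by rewrite lerDl sqr_ge0.
Qed.

Lemma normc_Im z : `|Im z| <= N z.
Proof.
rewrite -(@ler_pXn2r _ 2)// ?nnegrE ?normc_ge0// sqr_normcE real_normK ?num_real//.
by rewrite lerDr sqr_ge0.
Qed.

Lemma normc_le_ReIm z : N z <= `|Re z| + `|Im z|.
Proof.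
rewrite -(@ler_pXn2r _ 2)// ?nnegrE ?normc_ge0 ?addr_ge0// sqr_normcE.
rewrite sqrrD !real_normK ?num_real// addrAC lerDl.
by rewrite mulrn_wge0// mulr_ge0.
Qed.

Lemma normcX z n : N (z ^+ n) = N z ^+ n.
Proof.
by elim: n => [|n IH]; rewrite ?expr0 ?Normc.normc1// !exprS Normc.normcM IH.
Qed.

Lemma normc_conj z : N z^* = N z.
Proof. by case: z => a b /=; rewrite sqrrN. Qed.

Lemma normc_real x : N x%:C = `|x|.
Proof. by rewrite /= expr0n addr0 sqrtr_sqr. Qed.

Lemma normc_gt_Re z : 0 < Re z -> 0 < N z.
Proof. by move=> z0; rewrite (lt_le_trans _ (normc_Re z))// normr_gt0 gt_eqF. Qed.

Lemma Re_neq0 z : 0 < Re z -> z != 0.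
Proof. by move=> z0; rewrite -normc_gt0 normc_gt_Re. Qed.

Lemma normcB_sym z w : N (z - w) = N (w - z).
Proof. by rewrite -[LHS]normcN opprB. Qed.

Lemma ReDc z w : Re (z + w) = Re z + Re w. Proof. by case: z w => ? ? []. Qed.
Lemma ImDc z w : Im (z + w) = Im z + Im w. Proof. by case: z w => ? ? []. Qed.
Lemma ReNc z : Re (- z) = - Re z. Proof. by case: z. Qed.
Lemma ImNc z : Im (- z) = - Im z. Proof. by case: z. Qed.
Lemma ReMc z w : Re (z * w) = Re z * Re w - Im z * Im w.
Proof. by case: z w => ? ? []. Qed.
Lemma ImMc z w : Im (z * w) = Re z * Im w + Im z * Re w.
Proof. by case: z w => ? ? []. Qed.
Lemma Re_conjc z : Re z^* = Re z. Proof. by case: z. Qed.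
Lemma Im_conjc z : Im z^* = - Im z. Proof. by case: z. Qed.
Lemma ReVc z : Re z^-1 = Re z / N z ^+ 2.
Proof. by rewrite sqr_normcE; case: z. Qed.
Lemma ImVc z : Im z^-1 = - Im z / N z ^+ 2.
Proof. by rewrite sqr_normcE mulNr; case: z. Qed.

End ComplexNorm.

Section ComplexDifferentiability.
Context {R : realType}.
Implicit Types (z w : R[i]) (F G : R[i] -> R[i]).

(** Real tolerances and radii replace the topology of [R[i]^o], whose balls have complex radii.
    Multiplying out the difference quotient includes the point [w = z] and gives the error estimate
    in the form that Goursat's argument uses. *)
Definition cderiv F z (d : R[i]) := forall e : R, 0 < e ->
  exists2 r : R, 0 < r & forall w, N (w - z) < r ->
    N (F w - F z - d * (w - z)) <= e * N (w - z).

Definition cdiff F z := exists d, cderiv F z d.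

Lemma gt0_complex (e : R[i]) : 0 < e -> exists2 r : R, 0 < r & e = r%:C.
Proof.
case: e => a b; rewrite ltcE/= => /andP[/eqP b0 a0].
by exists a => //; rewrite b0.
Qed.

Lemma derivable_cderiv F z : derivable (F : R[i]^o -> R[i]^o) z 1 ->
  cderiv F z ('D_1 (F : R[i]^o -> R[i]^o) z).
Proof.
move=> dF e e0; have ec0 : 0 < e%:C by rewrite ltcR.
have /cvgrPdist_lt/(_ _ ec0) : _ --> 'D_1 (F : R[i]^o -> R[i]^o) z := dF.
move=> /nbhs_ballP[_ /= /gt0_complex[r r0 ->] Hr].
exists r => // w wz.
have [->|wz0] := eqVneq w z.
  by rewrite !subrr mulr0 subrr Normc.normc0 mulr0.
have wz1 : w - z != 0 by rewrite subr_eq0.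
have := Hr (w - z); rewrite -ball_normE/= sub0r normrN normcC ltcR => /(_ wz wz1).
rewrite normcC ltcR /GRing.scale/= mulr1 subrK => /ltW He.
rewrite -normcN opprB.
set D := derive _ _ _ in He *.
suff -> : D * (w - z) - (F w - F z) = (D - (w - z)^-1 * (F w - F z)) * (w - z).
  by rewrite Normc.normcM ler_wpM2r// normc_ge0.
by rewrite mulrBl mulrAC mulVf// mul1r.
Qed.

Lemma derivable_cdiff F z :
  derivable (F : R[i]^o -> R[i]^o) z 1 <-> cdiff F z.
Proof.
split=> [/derivable_cderiv dF|[d Hd]]; first by exists ('D_1 (F : R[i]^o -> R[i]^o) z).
- apply/cvg_ex; exists d; apply/cvgrPdist_le => _ /gt0_complex[e e0 ->].
  have [r r0 Hr] := Hd _ e0.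
  apply/nbhs_ballP; exists r%:C; first by rewrite /= ltcR.
  move=> t; rewrite -ball_normE/= sub0r normrN normcC ltcR => tr t0.
  have := Hr (t + z); rewrite addrK => /(_ tr) H.
  rewrite /GRing.scale/= mulr1 normcC lecR.
  have -> : d - t^-1 * (F (t + z) - F z) = - ((F (t + z) - F z - d * t) / t).
    by rewrite mulrBl mulfK// opprB [in RHS]mulrC.
  by rewrite normcN Normc.normcM Normc.normcV ler_pdivrMr ?normc_gt0.
Qed.

Lemma cdiff_continuous F z : cdiff F z -> forall e : R, 0 < e ->
  exists2 r : R, 0 < r & forall w, N (w - z) < r -> N (F w - F z) < e.
Proof.
move=> [d Hd] e e0; have [r r0 Hr] := Hd 1 ltr01.
have K0 : 0 < N d + 2 by rewrite ltr_wpDl// normc_ge0.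
exists (Num.min r (e / (N d + 2))).
  by rewrite lt_min r0/= divr_gt0.
move=> w; rewrite lt_min => /andP[wr]; rewrite ltr_pdivlMr// => we.
have := Hr _ wr; rewrite mul1r => H.
have := le_normcD (F w - F z - d * (w - z)) (d * (w - z)).
rewrite subrK Normc.normcM => H2.
have ? := normc_ge0 (w - z).
have ? := normc_ge0 d.
nra.
Qed.

Lemma eq_cdiff F G z (r : R) : 0 < r -> (forall w, N (w - z) < r -> F w = G w) ->
  cdiff F z -> cdiff G z.
Proof.
move=> r0 FG [d Hd]; exists d => e e0; have [s s0 Hs] := Hd e e0.
exists (Num.min r s); first by rewrite lt_min r0.
move=> w; rewrite lt_min => /andP[wr ws]; rewrite -!FG ?Hs//.
by rewrite subrr Normc.normc0.
Qed.

Lemma cdiff_cst (c : R[i]) z : cdiff (fun=> c) z.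
Proof. by apply/derivable_cdiff; exact: derivable_cst. Qed.

Lemma cdiff_id z : cdiff id z.
Proof. by apply/derivable_cdiff; exact: derivable_id. Qed.

Lemma cdiffD F G z : cdiff F z -> cdiff G z -> cdiff (fun w => F w + G w) z.
Proof.
move=> /derivable_cdiff dF /derivable_cdiff dG.
exact/derivable_cdiff/(derivableD dF dG).
Qed.

Lemma cdiffM F G z : cdiff F z -> cdiff G z -> cdiff (fun w => F w * G w) z.
Proof.
move=> /derivable_cdiff dF /derivable_cdiff dG.
exact/derivable_cdiff/(derivableM dF dG).
Qed.

Lemma cdiffV F z : F z != 0 -> cdiff F z -> cdiff (fun w => (F w)^-1) z.
Proof.
move=> F0 /derivable_cdiff dF.
exact/derivable_cdiff/(derivableV F0 dF).
Qed.

Lemma cdiffX F n z : cdiff F z -> cdiff (fun w => F w ^+ n) z.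
Proof.
move=> dF; elim: n => [|n IH].
  by under eq_fun do rewrite expr0; exact: cdiff_cst.
by under eq_fun do rewrite exprS; exact: cdiffM.
Qed.

Lemma cdiff_comp F G z : cdiff G z -> cdiff F (G z) -> cdiff (F \o G) z.
Proof.
move=> dG [d Hd]; have cG := cdiff_continuous dG.
case: dG => c Hc; exists (d * c) => e e0.
have K0 : 0 < N c + 1 by rewrite ltr_wpDl// normc_ge0.
have L0 : 0 < N d + 1 by rewrite ltr_wpDl// normc_ge0.
have [|r r0 Hr] := Hd (e / 2 / (N c + 1)); first by rewrite !divr_gt0.
have [|s s0 Hs] := Hc (Num.min 1 (e / 2 / (N d + 1))).
  by rewrite lt_min ltr01 !divr_gt0.
have [t t0 Ht] := cG _ r0.
exists (Num.min s t); first by rewrite lt_min s0.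
move=> w; rewrite lt_min => /andP[/Hs{}Hs /Ht/Hr{}Hr] /=.
set u := w - z in Hs *; set v := G w - G z in Hs Hr *.
set f := F (G w) - F (G z) in Hr *.
(* The outer error at [v] plus [d] times the inner error; each of them is allowed half of [e]. *)
have -> : f - d * c * u = (f - d * v) + d * (v - c * u) by ring.
apply: (le_trans (le_normcD _ _)); rewrite Normc.normcM.
have v1 : N v <= (N c + 1) * N u.
  have := le_normcD (v - c * u) (c * u); rewrite subrK Normc.normcM => H.
  have : N (v - c * u) <= 1 * N u.
    by apply: (le_trans Hs); rewrite ler_wpM2r ?normc_ge0// ge_min lexx.
  by move: H; lra.
have v2 : N (v - c * u) <= e / 2 / (N d + 1) * N u.
  by apply: (le_trans Hs); rewrite ler_wpM2r ?normc_ge0// ge_min lexx orbT.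
have -> : e * N u = e / 2 / (N c + 1) * ((N c + 1) * N u) +
    (N d + 1) * (e / 2 / (N d + 1) * N u) by field; rewrite !gt_eqF.
apply: lerD.
  by apply: (le_trans Hr); rewrite ler_wpM2l// !divr_ge0// ?ltW.
by apply: ler_pM; rewrite ?normc_ge0// lerDl.
Qed.

(** Schwarz reflection: the two conjugations cancel in the linear term. This is what makes [C_star]
    preserve analyticity. *)
Lemma cdiff_reflect F z : cdiff F z^* -> cdiff (fun w => (F w^*)^*) z.
Proof.
move=> [d Hd]; exists d^* => e e0; have [r r0 Hr] := Hd e e0.
exists r => // w wz.
have E : w^* - z^* = (w - z)^* by rewrite rmorphB.
have := Hr w^*; rewrite E normc_conj => /(_ wz).
by rewrite -normc_conj rmorphB rmorphB/= rmorphM/= conjcK.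
Qed.

End ComplexDifferentiability.

(** * Goursat's theorem *)

Section IntervalIntegral.
Context {R : realType}.
Local Notation mu := (@lebesgue_measure R).
Implicit Types (f g : R -> R) (a b m x : R).

Definition rint f a b : R := \int[mu]_(x in `[a, b]) f x.

(** Continuity is two-sided even at the end points, so that restriction to a subinterval needs no
    care. *)
Definition cont_on f a b := forall x, a <= x <= b -> {for x, continuous f}.

Lemma cont_on_integrable f a b : cont_on f a b ->
  mu.-integrable `[a, b] (EFin \o f).
Proof.
move=> cf; apply: continuous_compact_integrable; first exact: segment_compact.
apply: continuous_in_subspaceT => x; rewrite inE/= in_itv/=; exact: cf.
Qed.

Lemma cont_onB f g a b : cont_on f a b -> cont_on g a b ->
  cont_on (fun x => f x - g x) a b.
Proof. by move=> cf cg x xab; apply: continuousB; [exact: cf|exact: cg]. Qed.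

Lemma cont_on_sub f a b c d : a <= c -> d <= b -> cont_on f a b -> cont_on f c d.
Proof.
move=> ac db cf x /andP[cx xd]; apply: cf.
by rewrite (le_trans ac)// (le_trans xd).
Qed.

Lemma rint_cat f a m b : a <= m <= b -> cont_on f a b ->
  rint f a b = rint f a m + rint f m b.
Proof.
move=> /andP[am mb] cf.
have fi := cont_on_integrable cf.
have := @Rintegral_itvB R f (BLeft a) (BRight b) m fi.
rewrite bnd_simp am bnd_simp mb => /(_ isT isT) /eqP.
rewrite subr_eq addrC => /eqP; rewrite /rint => ->; congr (_ + _).
rewrite Rintegral_itv_obnd_cbnd//.
apply: integrableS fi => //; apply: subset_itvr; rewrite bnd_simp//.
Qed.

Lemma rintB f g a b : cont_on f a b -> cont_on g a b ->
  rint (fun x => f x - g x) a b = rint f a b - rint g a b.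
Proof.
by move=> /cont_on_integrable fi /cont_on_integrable gi; rewrite /rint RintegralB.
Qed.

Lemma rint_near_cst f a b k M : a <= b -> cont_on f a b ->
  (forall x, a <= x <= b -> `|f x - k| <= M) ->
  `|rint f a b - k * (b - a)| <= M * (b - a).
Proof.
move=> ab cf H.
have ci c : mu.-integrable `[a, b] (EFin \o (fun=> c : R)).
  by apply: cont_on_integrable => x _; exact: cst_continuous.
have E c : rint (fun=> c) a b = c * (b - a).
  rewrite /rint Rintegral_cst//= lebesgue_measure_itv/= lte_fin.
  by case: ltP => // ba; rewrite (le_anti (introT andP (conj ab ba))) subrr.
have fi := cont_on_integrable cf.
rewrite ler_distl -mulrBl -mulrDl -!E; apply/andP; split.
  apply: le_Rintegral => // x; rewrite /= in_itv/= => /H.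
  by rewrite ler_distl => /andP[].
apply: le_Rintegral => // x; rewrite /= in_itv/= => /H.
by rewrite ler_distl => /andP[].
Qed.

End IntervalIntegral.

Section Goursat.
Context {R : realType}.
Variables P Q : R -> R -> R.
Implicit Types (a b c d x y : R).

(* [P dx + Q dy] is differentiable at the point, with equal cross derivatives. *)
Definition closed_form_at x y := exists al be ga : R, forall e, 0 < e ->
  exists2 r, 0 < r & forall u v, `|u - x| < r -> `|v - y| < r ->
    `|P u v - P x y - (al * (u - x) + be * (v - y))| <= e * (`|u - x| + `|v - y|) /\
    `|Q u v - Q x y - (be * (u - x) + ga * (v - y))| <= e * (`|u - x| + `|v - y|).

Definition closed_form_on a b c d := forall x y, a <= x <= b -> c <= y <= d ->
  closed_form_at x y.

(** The integral of [P dx + Q dy] counterclockwise along the boundary, with opposite sides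
    paired. *)
Definition circulation a b c d : R :=
  rint (fun x => P x c - P x d) a b + rint (fun y => Q b y - Q a y) c d.

Lemma closed_form_cont x y : closed_form_at x y ->
  [/\ {for x, continuous (P^~ y)}, {for y, continuous (P x)},
      {for x, continuous (Q^~ y)} & {for y, continuous (Q x)}].
Proof.
move=> [al [be [ga H]]].
have [r r0 Hr] := H 1 ltr01.
have K0 : 0 < `|al| + `|be| + `|ga| + 2 by rewrite ltr_wpDl// !addr_ge0.
have key (f : R -> R) t : (forall u, `|u - t| < r ->
    `|f u - f t| <= (`|al| + `|be| + `|ga| + 1) * `|u - t|) ->
    {for t, continuous f}.
  move=> Hf; apply/cvgrPdist_lt => e e0; apply/nbhs_ballP.
  exists (Num.min r (e / (`|al| + `|be| + `|ga| + 2))) => /=.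
    by rewrite lt_min r0/= divr_gt0.
  move=> u; rewrite /ball/= distrC lt_min => /andP[ur].
  rewrite ltr_pdivlMr// => ue; rewrite distrC.
  apply: le_lt_trans (Hf _ ur) _; apply: le_lt_trans ue.
  by rewrite mulrC ler_wpM2l// lerD2l ler1n.
have ab (k s t : R) : `|s| <= 1 * `|t| + `|k * t| -> `|s| <= (1 + `|k|) * `|t|.
  by rewrite normrM mulrDl.
have tr (s t u : R) : `|s - t| <= u -> `|s| <= u + `|t|.
  by move=> H1; rewrite -(subrK t s) (le_trans (ler_normD _ _))// lerD2r.
have L k t : `|k| <= `|al| + `|be| + `|ga| -> (1 + `|k|) * `|t| <= (`|al| + `|be| + `|ga| + 1) * `|t|.
  by move=> kk; rewrite ler_wpM2r// addrC lerD2r.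
have ?: `|al| <= `|al| + `|be| + `|ga| by rewrite -addrA lerDl addr_ge0.
have ?: `|be| <= `|al| + `|be| + `|ga| by rewrite addrAC lerDr addr_ge0.
have ?: `|ga| <= `|al| + `|be| + `|ga| by rewrite lerDr addr_ge0.
split; apply: key => u ur.
- have := Hr u y ur; rewrite subrr normr0 !mulr0 !addr0 => /(_ r0)[/tr + _].
  by move/ab/le_trans; apply; exact: L.
- have := Hr x u; rewrite subrr normr0 !mulr0 !add0r => /(_ r0 ur)[/tr + _].
  by move/ab/le_trans; apply; exact: L.
- have := Hr u y ur; rewrite subrr normr0 !mulr0 !addr0 => /(_ r0)[_ /tr].
  by move/ab/le_trans; apply; exact: L.
- have := Hr x u; rewrite subrr normr0 !mulr0 !add0r => /(_ r0 ur)[_ /tr].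
  by move/ab/le_trans; apply; exact: L.
Qed.

Lemma closed_form_sub a b c d a' b' c' d' : a <= a' -> b' <= b -> c <= c' -> d' <= d ->
  closed_form_on a b c d -> closed_form_on a' b' c' d'.
Proof.
move=> aa bb cc dd H x y /andP[xa xb] /andP[yc yd]; apply: H.
  by rewrite (le_trans aa)//= (le_trans xb).
by rewrite (le_trans cc)//= (le_trans yd).
Qed.

Lemma closed_form_contP a b c d y : closed_form_on a b c d -> c <= y <= d ->
  cont_on (P^~ y) a b.
Proof. by move=> H ycd x xab; have [] := closed_form_cont (H _ _ xab ycd). Qed.

Lemma closed_form_contQ a b c d x : closed_form_on a b c d -> a <= x <= b ->
  cont_on (Q x) c d.
Proof. by move=> H xab y ycd; have [] := closed_form_cont (H _ _ xab ycd). Qed.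

Lemma circulation_catx a m b c d : a <= m <= b ->
  cont_on (P^~ c) a b -> cont_on (P^~ d) a b ->
  cont_on (Q a) c d -> cont_on (Q m) c d -> cont_on (Q b) c d ->
  circulation a b c d = circulation a m c d + circulation m b c d.
Proof.
move=> amb cPc cPd cQa cQm cQb.
rewrite /circulation (rint_cat amb); last exact: cont_onB.
by rewrite (rintB cQb cQa) (rintB cQm cQa) (rintB cQb cQm); ring.
Qed.

Lemma circulation_caty a b c m d : c <= m <= d ->
  cont_on (P^~ c) a b -> cont_on (P^~ m) a b -> cont_on (P^~ d) a b ->
  cont_on (Q a) c d -> cont_on (Q b) c d ->
  circulation a b c d = circulation a b c m + circulation a b m d.
Proof.
move=> cmd cPc cPm cPd cQa cQb.
rewrite /circulation (rint_cat cmd); last exact: cont_onB.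
by rewrite (rintB cPc cPd) (rintB cPc cPm) (rintB cPm cPd); ring.
Qed.

(** The affine part of the form contributes [be * (c - d) * (b - a)] and [be * (b - a) * (d - c)],
    which cancel because the cross derivatives agree. Only the error term, of order [e] times the
    size, is integrated over the sides. *)
Lemma circulation_small x y e : closed_form_at x y -> 0 < e ->
  exists2 r, 0 < r & forall a b c d, a <= x <= b -> c <= y <= d ->
    b - a + (d - c) < r -> closed_form_on a b c d ->
    `|circulation a b c d| <= e * (b - a + (d - c)) ^+ 2.
Proof.
move=> [al [be [ga H]]] e0; have [r r0 Hr] := H _ (divr_gt0 e0 (ltr0Sn R 1)).
exists r => // a b c d axb cyd sr Hc.
have /andP[ax xb] := axb; have /andP[cy yd] := cyd.
have ab := le_trans ax xb; have cd := le_trans cy yd.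
have aab : a <= a <= b by rewrite lexx.
have abb : a <= b <= b by rewrite lexx ab.
have ccd : c <= c <= d by rewrite lexx.
have cdd : c <= d <= d by rewrite lexx cd.
set s := b - a + (d - c) in sr *.
have s0 : 0 <= s by rewrite addr_ge0// subr_ge0.
have near u v : a <= u <= b -> c <= v <= d ->
    `|P u v - P x y - (al * (u - x) + be * (v - y))| <= e / 2 * s /\
    `|Q u v - Q x y - (be * (u - x) + ga * (v - y))| <= e / 2 * s.
  move=> /andP[au ub] /andP[cv vd].
  have ux : `|u - x| <= b - a by rewrite ler_norml; apply/andP; split; lra.
  have vy : `|v - y| <= d - c by rewrite ler_norml; apply/andP; split; lra.
  have [||h1 h2] := Hr u v.
  - by apply: le_lt_trans ux _; apply: le_lt_trans sr; rewrite lerDl subr_ge0.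
  - by apply: le_lt_trans vy _; apply: le_lt_trans sr; rewrite lerDr subr_ge0.
  have ee : e / 2 * (`|u - x| + `|v - y|) <= e / 2 * s.
    by rewrite ler_wpM2l ?lerD// divr_ge0// ltW.
  by split; [apply: le_trans h1 _|apply: le_trans h2 _].
have c1 : cont_on (fun x => P x c - P x d) a b.
  by apply: cont_onB; apply: closed_form_contP Hc _.
have c2 : cont_on (fun y => Q b y - Q a y) c d.
  by apply: cont_onB; apply: closed_form_contQ Hc _.
have b1 := @rint_near_cst R _ a b (be * (c - d)) (e * s) ab c1.
have b2 := @rint_near_cst R _ c d (be * (b - a)) (e * s) cd c2.
have {}b1 := b1 _; have {}b2 := b2 _.
have B1 : `|rint (fun x => P x c - P x d) a b - be * (c - d) * (b - a)| <= e * s * (b - a).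
  apply: b1 => u uab.
  have [+ _] := near u c uab ccd; have [+ _] := near u d uab cdd.
  by rewrite !ler_norml => /andP[? ?] /andP[? ?]; apply/andP; split; lra.
have B2 : `|rint (fun y => Q b y - Q a y) c d - be * (b - a) * (d - c)| <= e * s * (d - c).
  apply: b2 => v vcd.
  have [_ +] := near b v abb vcd; have [_ +] := near a v aab vcd.
  by rewrite !ler_norml => /andP[? ?] /andP[? ?]; apply/andP; split; lra.
have -> : circulation a b c d = (rint (fun x => P x c - P x d) a b - be * (c - d) * (b - a))
   + (rint (fun y => Q b y - Q a y) c d - be * (b - a) * (d - c)).
  by rewrite /circulation; ring.
apply: le_trans (ler_normD _ _) _; apply: le_trans (lerD B1 B2) _.
by rewrite -mulrDr -/s expr2 mulrA.
Qed.

Let rect : Type := ((R * R) * (R * R))%type.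
Let circ (q : rect) := circulation q.1.1 q.1.2 q.2.1 q.2.2.
Let ok (q : rect) :=
  [/\ q.1.1 <= q.1.2, q.2.1 <= q.2.2 & closed_form_on q.1.1 q.1.2 q.2.1 q.2.2].

Let quarter (q : rect) (i j : bool) : rect :=
  let m := (q.1.1 + q.1.2) / 2 in let n := (q.2.1 + q.2.2) / 2 in
  ((if i then (q.1.1, m) else (m, q.1.2)), (if j then (q.2.1, n) else (n, q.2.2))).

Let quarterP q : ok q -> exists i j, `|circ q| <= 4 * `|circ (quarter q i j)|.
Proof.
case: q => [[a b] [c d]] [/= ab cd H]; rewrite /circ/quarter/=.
set m := (a + b) / 2; set n := (c + d) / 2.
have am : a <= m by rewrite /m; lra.
have mb : m <= b by rewrite /m; lra.
have cn : c <= n by rewrite /n; lra.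
have nd : n <= d by rewrite /n; lra.
have cP y : c <= y <= d -> cont_on (P^~ y) a b by exact: closed_form_contP.
have cQ x : a <= x <= b -> cont_on (Q x) c d by exact: closed_form_contQ.
have [? ? ?] : [/\ c <= c <= d, c <= n <= d & c <= d <= d].
  by rewrite !lexx cd cn nd.
have [? ? ?] : [/\ a <= a <= b, a <= m <= b & a <= b <= b].
  by rewrite !lexx ab am mb.
rewrite (@circulation_catx a m b c d); [|by rewrite am|by apply: cP|by apply: cP|by apply: cQ..].
have sub a' b' y : c <= y <= d -> a <= a' -> b' <= b -> cont_on (P^~ y) a' b'.
  by move=> ycd aa bb; apply: cont_on_sub aa bb (cP _ ycd).
rewrite (@circulation_caty a m c n d); [|by rewrite cn|by apply: sub..|by apply: cQ|by apply: cQ].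
rewrite (@circulation_caty m b c n d); [|by rewrite cn|by apply: sub..|by apply: cQ|by apply: cQ].
set A := circulation a m c n; set B := circulation a m n d.
set C := circulation m b c n; set D := circulation m b n d.
apply: contrapT => /forallNP nH.
have := nH true => /forallNP hT; have := nH false => /forallNP hF.
have /negP := hT true; have /negP := hT false; have /negP := hF true; have /negP := hF false.
rewrite -!ltNge /= -/A -/B -/C -/D => h1 h2 h3 h4.
have := ler_normD (A + B) (C + D); have := ler_normD A B; have := ler_normD C D.
by lra.
Qed.

(** By [quarterP] the default [q] is never taken on an admissible rectangle. *)
Let next (q : rect) : rect := xget q [set q' | exists i j, q' = quarter q i j /\
  `|circ q| <= 4 * `|circ q'|].

Let nextP q : ok q -> exists i j, next q = quarter q i j /\
  `|circ q| <= 4 * `|circ (next q)|.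
Proof.
move=> /quarterP[i [j H]]; rewrite /next; case: xgetP => [q' _ //|nex].
by case: (nex (quarter q i j)); exists i, j.
Qed.

Let next_ok q : ok q -> [/\ ok (next q),
  q.1.1 <= (next q).1.1, (next q).1.2 <= q.1.2, q.2.1 <= (next q).2.1 &
  (next q).2.2 <= q.2.2] /\
  (next q).1.2 - (next q).1.1 = (q.1.2 - q.1.1) / 2 /\
  (next q).2.2 - (next q).2.1 = (q.2.2 - q.2.1) / 2.
Proof.
move=> okq; have [i [j [-> _]]] := nextP okq.
case: q okq => [[a b] [c d]] [/= ab cd H].
have S a' b' c' d' : a <= a' -> b' <= b -> c <= c' -> d' <= d -> a' <= b' -> c' <= d' ->
    ok ((a', b'), (c', d')).
  by move=> *; split => //=; exact: closed_form_sub H.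
by case: i; case: j => /=; (split; last by split; lra);
  (split; first by apply: S => /=; lra) => /=; lra.
Qed.

(** After [n] quarterings the circulation has lost at most a factor [4 ^+ n], and the square of the
    size has lost exactly this factor. At the limit point [circulation_small] gains an arbitrarily
    small constant on top. *)
Lemma goursat a b c d : a <= b -> c <= d -> closed_form_on a b c d ->
  circulation a b c d = 0.
Proof.
move=> ab cd H; pose q n := iter n next ((a, b), (c, d)).
have okq n : ok (q n).
  by elim: n => [|n /next_ok[[]]]//.
have mono (k : nat) n : [/\ (q n).1.1 <= (q (n + k)%N).1.1, (q (n + k)%N).1.2 <= (q n).1.2,
    (q n).2.1 <= (q (n + k)%N).2.1 & (q (n + k)%N).2.2 <= (q n).2.2].
  elim: k => [|k IH]; first by rewrite addn0.
  rewrite addnS; have [[_ h1 h2 h3 h4] _] := next_ok (okq (n + k)%N).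
  have [i1 i2 i3 i4] := IH; rewrite /= -/(q (n + k)%N).
  by split; [exact: le_trans h1|exact: le_trans i2|exact: le_trans h3|exact: le_trans i4].
have cross m n : (q m).1.1 <= (q n).1.2 /\ (q m).2.1 <= (q n).2.2.
  have [h1 _ h3 _] := mono n m; have [_ k2 _ k4] := mono m n.
  have [le1 le2 _] := okq (m + n)%N; rewrite addnC in k2 k4.
  by split; [apply: le_trans (le_trans h1 le1) k2|apply: le_trans (le_trans h3 le2) k4].
(* By [cross] no left end exceeds any right end, so the suprema of the lower corners lie in all the
   rectangles. *)
pose A := [set (q n).1.1 | n in [set: nat]]; pose C := [set (q n).2.1 | n in [set: nat]].
have supA n : (q n).1.1 <= sup A <= (q n).1.2.
  apply/andP; split.
    apply: ub_le_sup; last by exists n.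
    by exists (q 0%N).1.2 => _ [m _ <-]; have [] := cross m 0%N.
  apply: ge_sup; first by exists (q 0%N).1.1; exists 0%N.
  by move=> _ [m _ <-]; have [] := cross m n.
have supC n : (q n).2.1 <= sup C <= (q n).2.2.
  apply/andP; split.
    apply: ub_le_sup; last by exists n.
    by exists (q 0%N).2.2 => _ [m _ <-]; have [] := cross m 0%N.
  apply: ge_sup; first by exists (q 0%N).2.1; exists 0%N.
  by move=> _ [m _ <-]; have [] := cross m n.
have size n : (q n).1.2 - (q n).1.1 + ((q n).2.2 - (q n).2.1) = (b - a + (d - c)) / 2 ^+ n.
  elim: n => [|n IH]; first by rewrite expr0 divr1.
  have [_ [e1 e2]] := next_ok (okq n).
  by rewrite /= -/(q n) e1 e2 exprS -mulrDl IH invfM mulrAC -mulrA.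
have big n : `|circulation a b c d| <= 4 ^+ n * `|circ (q n)|.
  elim: n => [|n IH]; first by rewrite expr0 mul1r.
  apply: le_trans IH _; rewrite exprSr -mulrA ler_wpM2l ?exprn_ge0//.
  by have [i [j [_ +]]] := nextP (okq n).
set s := b - a + (d - c).
have s0 : 0 <= s by rewrite addr_ge0// subr_ge0.
apply/eqP; rewrite -normr_le0; apply/ler_addgt0Pr => e e0; rewrite add0r.
(* The summand 1 allows division also when the rectangle is a point and [s = 0]. *)
have K0 : 0 < s ^+ 2 + 1 by rewrite ltr_wpDl// sqr_ge0.
have [] := @circulation_small (sup A) (sup C) (e / (s ^+ 2 + 1)).
- by apply: H; [exact: (supA 0%N)|exact: (supC 0%N)].
- by rewrite divr_gt0.
move=> r r0 Hr.
have [n sn] : exists n, s / 2 ^+ n < r.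
  have [n hn] : exists n, s / r < n%:R.
    by exists (Num.bound (s / r)); rewrite archi_boundP// divr_ge0// ltW.
  exists n; rewrite ltr_pdivrMr ?exprn_gt0// mulrC -ltr_pdivrMr//.
  by apply: lt_trans hn _; rewrite -natrX ltr_nat ltn_expl.
have [_ _ Hn] := okq n.
have := Hr _ _ _ _ (supA n) (supC n); rewrite size => /(_ sn Hn) Hcirc.
apply: le_trans (big n) _.
apply: le_trans (ler_wpM2l _ Hcirc) _; first exact: exprn_ge0.
rewrite -/s expr_div_n -exprM mulnC exprM (_ : 2 ^+ 2 = 4 :> R); last by rewrite -natrX.
have -> : 4 ^+ n * (e / (s ^+ 2 + 1) * (s ^+ 2 / 4 ^+ n)) = e * (s ^+ 2 / (s ^+ 2 + 1)).
  by field; rewrite gt_eqF//= expf_neq0.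
by rewrite ler_piMr ?ltW// ltr_pdivrMr// mul1r ltrDl.
Qed.

End Goursat.

(** * Cauchy's theorem and integral formula on rectangles *)

Section CauchyRectangle.
Context {R : realType}.
Implicit Types (F h : R[i] -> R[i]) (a b c d x y : R).

(** The contour integral of [F dz] has real part the integral of [Re F dx - Im F dy] and imaginary
    part that of [Im F dx + Re F dy]. *)
Definition re_circ F a b c d :=
  circulation (fun x y => Re (F (x +i* y))) (fun x y => - Im (F (x +i* y))) a b c d.
Definition im_circ F a b c d :=
  circulation (fun x y => Im (F (x +i* y))) (fun x y => Re (F (x +i* y))) a b c d.

(** The Cauchy-Riemann equations say precisely that both forms have a symmetric derivative
    matrix. *)
Lemma cdiff_closed_form F x y : cdiff F (x +i* y) ->
  closed_form_at (fun x y => Re (F (x +i* y))) (fun x y => - Im (F (x +i* y))) x y /\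
  closed_form_at (fun x y => Im (F (x +i* y))) (fun x y => Re (F (x +i* y))) x y.
Proof.
move=> [[al be] H].
have key e : 0 < e -> exists2 r, 0 < r & forall u v, `|u - x| < r -> `|v - y| < r ->
    `|Re (F (u +i* v)) - Re (F (x +i* y)) - (al * (u - x) - be * (v - y))|
      <= e * (`|u - x| + `|v - y|) /\
    `|Im (F (u +i* v)) - Im (F (x +i* y)) - (al * (v - y) + be * (u - x))|
      <= e * (`|u - x| + `|v - y|).
  move=> e0; have [r r0 Hr] := H e e0.
  exists (r / 2); first exact: divr_gt0.
  move=> u v ux vy.
  have D : (u +i* v) - (x +i* y) = (u - x) +i* (v - y) by [].
  have Ns : N ((u +i* v) - (x +i* y)) <= `|u - x| + `|v - y|.
    by rewrite D; exact: (normc_le_ReIm ((u - x) +i* (v - y))).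
  have := Hr (u +i* v); rewrite (le_lt_trans Ns); last by lra.
  move=> /(_ isT) Hw.
  have {}Hw := le_trans Hw (ler_wpM2l (ltW e0) Ns).
  split.
    apply: le_trans Hw; apply: le_trans (normc_Re _).
    by rewrite D !ReDc !ReNc ReMc.
  apply: le_trans Hw; apply: le_trans (normc_Im _).
  by rewrite D !ImDc !ImNc ImMc.
split.
  exists al, (- be), (- al) => e /key[r r0 Hr]; exists r => // u v ux vy.
  have [h1 h2] := Hr u v ux vy; split; first by rewrite mulNr.
  by rewrite -normrN; congr (`|_| <= _) : h2; ring.
exists be, al, (- be) => e /key[r r0 Hr]; exists r => // u v ux vy.
have [h1 h2] := Hr u v ux vy; split; first by congr (`|_| <= _) : h2; ring.
by rewrite mulNr.
Qed.

Lemma circ_eq0 F a b c d : a <= b -> c <= d ->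
  (forall x y, a <= x <= b -> c <= y <= d -> cdiff F (x +i* y)) ->
  re_circ F a b c d = 0 /\ im_circ F a b c d = 0.
Proof.
move=> ab cd H; split; apply: goursat => // x y xab ycd.
  by have [] := cdiff_closed_form (H _ _ xab ycd).
by have [] := cdiff_closed_form (H _ _ xab ycd).
Qed.

Definition ccont_on (f : R -> R[i]) a b :=
  cont_on (fun x => Re (f x)) a b /\ cont_on (fun x => Im (f x)) a b.

Lemma cdiff_ccont_hor F a b y :
  (forall x, a <= x <= b -> cdiff F (x +i* y)) -> ccont_on (fun x => F (x +i* y)) a b.
Proof.
move=> H; split=> x /H/cdiff_closed_form[/closed_form_cont[h1 h2 h3 h4]].
  by [].
by move=> /closed_form_cont[].
Qed.

Lemma cdiff_ccont_ver F a b x :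
  (forall y, a <= y <= b -> cdiff F (x +i* y)) -> ccont_on (fun y => F (x +i* y)) a b.
Proof.
move=> H; split=> y /H/cdiff_closed_form[_ /closed_form_cont[h1 h2 h3 h4]].
  by [].
by [].
Qed.

Lemma cont_onN (f : R -> R) a b : cont_on f a b -> cont_on (fun x => - f x) a b.
Proof. by move=> cf x xab; apply: continuousN; exact: cf. Qed.

(** Four strips are cut off, left, right, below and above; [F] is differentiable on each, so each
    has circulation 0. Singularities inside the small rectangle are allowed. *)
Lemma circ_shrink F a b c d a' b' c' d' : a <= a' -> a' <= b' -> b' <= b ->
  c <= c' -> c' <= d' -> d' <= d ->
  (forall x y, a <= x <= b -> c <= y <= d -> ~~ ((a' < x < b') && (c' < y < d')) ->
     cdiff F (x +i* y)) ->
  re_circ F a b c d = re_circ F a' b' c' d' /\ im_circ F a b c d = im_circ F a' b' c' d'.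
Proof.
move=> aa ab bb cc cd dd H.
have hor y : c <= y <= d -> (y <= c') || (d' <= y) ->
    ccont_on (fun x => F (x +i* y)) a b.
  move=> ycd yo; apply: cdiff_ccont_hor => x xab; apply: H => //.
  by case/orP: yo => yo; rewrite [c' < _]ltNge [_ < d']ltNge yo ?andbF.
have ver x : a <= x <= b -> (x <= a') || (b' <= x) ->
    ccont_on (fun y => F (x +i* y)) c d.
  move=> xab xo; apply: cdiff_ccont_ver => y ycd; apply: H => //.
  by case/orP: xo => xo; rewrite [a' < _]ltNge [_ < b']ltNge xo ?andbF.
have [hc hc' hd' hd] : [/\ ccont_on (fun x => F (x +i* c)) a b,
    ccont_on (fun x => F (x +i* c')) a b, ccont_on (fun x => F (x +i* d')) a b &
    ccont_on (fun x => F (x +i* d)) a b].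
  by split; apply: hor; lra.
have [va va' vb' vb] : [/\ ccont_on (fun y => F (a +i* y)) c d,
    ccont_on (fun y => F (a' +i* y)) c d, ccont_on (fun y => F (b' +i* y)) c d &
    ccont_on (fun y => F (b +i* y)) c d].
  by split; apply: ver; lra.
have [z1 z1'] : re_circ F a a' c d = 0 /\ im_circ F a a' c d = 0.
  by apply: circ_eq0 => [||x y ? ?]; try lra; apply: H; lra.
have [z2 z2'] : re_circ F b' b c d = 0 /\ im_circ F b' b c d = 0.
  by apply: circ_eq0 => [||x y ? ?]; try lra; apply: H; lra.
have [z3 z3'] : re_circ F a' b' c c' = 0 /\ im_circ F a' b' c c' = 0.
  by apply: circ_eq0 => [||x y ? ?]; try lra; apply: H; lra.
have [z4 z4'] : re_circ F a' b' d' d = 0 /\ im_circ F a' b' d' d = 0.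
  by apply: circ_eq0 => [||x y ? ?]; try lra; apply: H; lra.
have S f u v u' v' : u <= u' -> v' <= v -> ccont_on f u v -> ccont_on f u' v'.
  by move=> ? ? [? ?]; split; apply: (@cont_on_sub _ _ u v).
have am : a <= a' <= b by lra.
have am' : a' <= b' <= b by lra.
have cm : c <= c' <= d by lra.
have cm' : c' <= d' <= d by lra.
have hS y : ccont_on (fun x => F (x +i* y)) a b ->
    ccont_on (fun x => F (x +i* y)) a' b /\ ccont_on (fun x => F (x +i* y)) a' b'.
  by move=> h; split; apply: S h; lra.
have vS x : ccont_on (fun y => F (x +i* y)) c d -> ccont_on (fun y => F (x +i* y)) c' d.
  by move=> h; apply: S h; lra.
have [hc1 hc2] := hS c hc; have [hd1 hd2] := hS d hd.
have [_ hc'2] := hS c' hc'; have [_ hd'2] := hS d' hd'.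
have va'1 := vS a' va'; have vb'1 := vS b' vb'.
split.
  rewrite /re_circ (@circulation_catx _ _ _ a a' b c d am); [|apply hc|apply hd|apply: cont_onN..];
    [|apply va|apply va'|apply vb].
  rewrite (@circulation_catx _ _ _ a' b' b c d am'); [|apply hc1|apply hd1|apply: cont_onN..];
    [|apply va'|apply vb'|apply vb].
  rewrite (@circulation_caty _ _ _ a' b' c c' d cm); [|apply hc2|apply hc'2|apply hd2|apply: cont_onN..];
    [|apply va'|apply vb'].
  rewrite (@circulation_caty _ _ _ a' b' c' d' d cm'); [|apply hc'2|apply hd'2|apply hd2|apply: cont_onN..];
    [|apply va'1|apply vb'1].
  by rewrite -!/(re_circ F _ _ _ _) z1 z2 z3 z4 !(addr0, add0r).
rewrite /im_circ (@circulation_catx _ _ _ a a' b c d am); [|apply hc|apply hd|apply va|apply va'|apply vb].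
rewrite (@circulation_catx _ _ _ a' b' b c d am'); [|apply hc1|apply hd1|apply va'|apply vb'|apply vb].
rewrite (@circulation_caty _ _ _ a' b' c c' d cm); [|apply hc2|apply hc'2|apply hd2|apply va'|apply vb'].
rewrite (@circulation_caty _ _ _ a' b' c' d' d cm'); [|apply hc'2|apply hd'2|apply hd2|apply va'1|apply vb'1].
by rewrite -!/(im_circ F _ _ _ _) z1' z2' z3' z4' !(addr0, add0r).
Qed.

Lemma rint_FTC (f F : R -> R) a b : a < b -> cont_on f a b ->
  (forall x, a <= x <= b -> is_derive x 1 F (f x)) -> rint f a b = F b - F a.
Proof.
move=> ab cf dF.
have cF x : a <= x <= b -> {for x, continuous F}.
  by move=> /dF d; apply: differentiable_continuous; apply/derivable1_diffP.
rewrite /rint /Rintegral (@continuous_FTC2 _ _ F)//.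
- by apply: continuous_in_subspaceT => x; rewrite inE/= in_itv/=; exact: cf.
- split.
  + move=> x; rewrite in_itv/= => /andP[ax xb].
    by have [] := dF x (introT andP (conj (ltW ax) (ltW xb))).
  + by apply: cvg_at_right_filter; apply: cF; rewrite lexx ltW.
  + by apply: cvg_at_left_filter; apply: cF; rewrite lexx ltW.
- move=> x; rewrite in_itv/= => /andP[ax xb].
  by have [_ <-] := dF x (introT andP (conj (ltW ax) (ltW xb))); rewrite derive1E.
Qed.

(** Seen from the centre of a square, one side subtends a quarter turn. This is where [pi] enters
    Cauchy's formula. *)
Lemma rint_Poisson x e : 0 < e ->
  rint (fun s => e / ((s - x) ^+ 2 + e ^+ 2)) (x - e) (x + e) = pi / 2.
Proof.
move=> e0; have e1 : e != 0 by rewrite gt_eqF.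
have D0 s : (s - x) ^+ 2 + e ^+ 2 != 0.
  by rewrite gt_eqF// ltr_wpDl ?sqr_ge0// exprn_gt0.
transitivity (atan ((x + e - x) / e) - atan ((x - e - x) / e)); last first.
  have -> : (x + e - x) / e = 1 by field.
  have -> : (x - e - x) / e = - 1 by field.
  by rewrite atanN atan1; field.
apply: (@rint_FTC _ (fun s => atan ((s - x) / e))).
- by lra.
- move=> s _; apply: continuousM; first exact: cst_continuous.
  apply: continuousV; first exact: D0.
  apply: continuousD; last exact: cst_continuous.
  have c1 : {for s, continuous (fun s => s - x)}.
    by apply: continuousB; [exact: cvg_id|exact: cst_continuous].
  exact: (continuousM c1 c1).
- move=> s _.
  have d1 : is_derive s 1 (fun s => (s - x) / e) e^-1.
    apply: is_derive_eq; rewrite /GRing.scale/= !(mulr0, add0r, subr0, mulr1, addr0).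
    by [].
  have -> : e / ((s - x) ^+ 2 + e ^+ 2) = (1 + ((s - x) / e) ^+ 2)^-1 * e^-1.
    by field; rewrite e1/= addrC; exact: D0.
  exact: is_derive1_comp.
Qed.

Lemma rint_near_Poisson (f : R -> R) x e k M : 0 < e -> cont_on f (x - e) (x + e) ->
  (forall s, x - e <= s <= x + e ->
    `|f s - 2 * k * (e / ((s - x) ^+ 2 + e ^+ 2))| <= 2 * M) ->
  `|rint f (x - e) (x + e) - k * pi| <= 4 * M * e.
Proof.
move=> e0 cf Hf; set g := fun s => e / ((s - x) ^+ 2 + e ^+ 2).
have cg : cont_on g (x - e) (x + e).
  move=> s _; apply: continuousM; first exact: cst_continuous.
  apply: continuousV.
    by rewrite gt_eqF// ltr_wpDl ?sqr_ge0// exprn_gt0.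
  apply: continuousD; last exact: cst_continuous.
  have c1 : {for s, continuous (fun s => s - x)}.
    by apply: continuousB; [exact: cvg_id|exact: cst_continuous].
  exact: (continuousM c1 c1).
have ckg : cont_on (fun s => 2 * k * g s) (x - e) (x + e).
  by move=> s /cg cgs; apply: continuousM => //; exact: cst_continuous.
have le_e : x - e <= x + e by lra.
have := @rint_near_cst R (fun s => f s - 2 * k * g s) _ _ 0 (2 * M) le_e (cont_onB cf ckg).
rewrite (rintB cf ckg) mul0r subr0 => H.
have -> : k * pi = rint (fun s => 2 * k * g s) (x - e) (x + e).
  rewrite /rint RintegralZl//; last exact: cont_on_integrable.
  by rewrite [\int[_]_(_ in _) _](rint_Poisson x e0); field.
apply: le_trans (H _) _; last by lra.
by move=> s hs; rewrite subr0; exact: Hf.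
Qed.

(** The contour is shrunk to a square of half side [e] around the pole. There [F] differs from
    [h z / (w - z)] by a bounded amount, whose contribution is of order [e], and the model integrand
    is integrated explicitly over pairs of opposite sides. *)
Lemma cauchy_rectangle h a b c d x0 y0 : a < x0 < b -> c < y0 < d ->
  (forall x y, a <= x <= b -> c <= y <= d -> cdiff h (x +i* y)) ->
  let F w := h w / (w - (x0 +i* y0)) in
  re_circ F a b c d = - (2 * pi * Im (h (x0 +i* y0))) /\
  im_circ F a b c d = 2 * pi * Re (h (x0 +i* y0)).
Proof.
move=> /andP[ax xb] /andP[cy yd] H; set z := x0 +i* y0 => F.
set p := Re (h z); set q := Im (h z).
have [D HD] : cdiff h z by apply: H; lra.
have [r r0 Hr] := HD 1 ltr01.
(* A bound for the difference quotient of [h] at [z] within distance [r]. *)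
pose M := N D + 1.
have dF x y : a <= x <= b -> c <= y <= d -> x +i* y != z -> cdiff F (x +i* y).
  move=> xab ycd nz; apply: cdiffM; first exact: H.
  apply: cdiffV; first by rewrite subr_eq0.
  by apply: cdiffD; [exact: cdiff_id|exact: cdiff_cst].
have neq x y : (x != x0) || (y != y0) -> x +i* y != z.
  by rewrite eq_complex /= negb_and.
have Fnear s t : s ^+ 2 + t ^+ 2 != 0 -> `|s| + `|t| < r ->
    `|Re (F ((x0 + s) +i* (y0 + t))) - (p * s + q * t) / (s ^+ 2 + t ^+ 2)| <= M /\
    `|Im (F ((x0 + s) +i* (y0 + t))) - (q * s - p * t) / (s ^+ 2 + t ^+ 2)| <= M.
  move=> st0 str; set w := (x0 + s) +i* (y0 + t).
  have wz : w - z = s +i* t by apply/eqP; rewrite eq_complex /= !(addrC _ s, addrC _ t) !addrK !eqxx.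
  have Nw : N (w - z) ^+ 2 = s ^+ 2 + t ^+ 2 by rewrite sqr_normcE wz.
  have Nw0 : 0 < N (w - z).
    by rewrite normc_gt0; apply: contra st0 => /eqP w0; rewrite -Nw w0 Normc.normc0 expr0n.
  have Nr : N (w - z) < r by apply: le_lt_trans str; rewrite wz; exact: (normc_le_ReIm (s +i* t)).
  have B : N (F w - h z / (w - z)) <= M.
    rewrite /F -mulrBl Normc.normcM Normc.normcV ler_pdivrMr//.
    have := le_normcD (h w - h z - D * (w - z)) (D * (w - z)).
    rewrite subrK Normc.normcM => /le_trans; apply.
    by rewrite /M mulrDl addrC lerD2l; exact: Hr.
  have Ehz : h z / (w - z) = ((p * s + q * t) / (s ^+ 2 + t ^+ 2)) +i*
      ((q * s - p * t) / (s ^+ 2 + t ^+ 2)).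
    rewrite wz; rewrite /p /q; case: (h z) => u v /=.
    by apply/eqP; rewrite eq_complex/=; apply/andP; split; apply/eqP; field.
  rewrite Ehz in B; split.
    by apply: le_trans B; apply: le_trans (normc_Re _); rewrite ReDc ReNc.
  apply: le_trans B; apply: le_trans (normc_Im _).
  by rewrite ImDc ImNc.
(* Each of the two pairs of sides has error at most [4 * M * e]. *)
suff key e : 0 < e -> e < r / 2 -> a < x0 - e -> x0 + e < b -> c < y0 - e -> y0 + e < d ->
    `|re_circ F a b c d + 2 * pi * q| <= 8 * M * e /\
    `|im_circ F a b c d - 2 * pi * p| <= 8 * M * e.
  have M0 : 0 < M by rewrite ltr_wpDl// normc_ge0.
  have [e0 [[e00 h1] h2 h3 h4 h5]] : exists e0, [/\ 0 < e0 /\ e0 <= r / 4, e0 <= (x0 - a) / 2,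
      e0 <= (b - x0) / 2, e0 <= (y0 - c) / 2 & e0 <= (d - y0) / 2].
    have mn (u v : R) : 0 < u -> 0 < v -> exists2 w, 0 < w & w <= u /\ w <= v.
      by move=> u0 v0; exists (Num.min u v); rewrite ?lt_min ?u0// !ge_min !lexx orbT.
    have [||u1 ? [? ?]] := mn (r / 4) ((x0 - a) / 2); [lra..|].
    have [||u2 ? [? ?]] := mn ((b - x0) / 2) ((y0 - c) / 2); [lra..|].
    have [||u3 ? [? ?]] := mn u1 u2; [lra..|].
    have [||u4 ? [? ?]] := mn u3 ((d - y0) / 2); [lra..|].
    by exists u4; split; [split|..]; lra.
  have lim (t : R) : (forall e, 0 < e -> e <= e0 -> `|t| <= 8 * M * e) -> t = 0.
    move=> Ht; apply/eqP; rewrite -normr_le0; apply/ler_addgt0Pr => e e1; rewrite add0r.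
    have e2 : 0 < e / (8 * M) by rewrite divr_gt0// mulr_gt0.
    have := Ht (Num.min e0 (e / (8 * M))); rewrite lt_min e00 e2 ge_min lexx => /(_ isT isT).
    move=> /le_trans; apply; apply: (@le_trans _ _ (8 * M * (e / (8 * M)))).
      by apply: ler_wpM2l; [lra|rewrite ge_min lexx orbT].
    by rewrite mulrC divfK// gt_eqF// mulr_gt0.
  split; apply/eqP.
    rewrite -subr_eq0 opprK; apply/eqP/lim => e e1 ee.
    by have [] := key e e1; [lra..|].
  rewrite -subr_eq0; apply/eqP/lim => e e1 ee.
  by have [] := key e e1; [lra..|].
move=> e0 er h1 h2 h3 h4.
have [-> ->] : re_circ F a b c d = re_circ F (x0 - e) (x0 + e) (y0 - e) (y0 + e) /\
    im_circ F a b c d = im_circ F (x0 - e) (x0 + e) (y0 - e) (y0 + e).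
  apply: circ_shrink; try lra; move=> x y xab ycd nin; apply: dF => //; apply: neq.
  rewrite -negb_and; apply: contra nin => /andP[/eqP -> /eqP ->]; lra.
have hc y : y != y0 -> c <= y <= d -> ccont_on (fun x => F (x +i* y)) (x0 - e) (x0 + e).
  move=> yy ycd; apply: cdiff_ccont_hor => x xe; apply: dF => //; first by lra.
  by apply: neq; rewrite yy orbT.
have vc x : x != x0 -> a <= x <= b -> ccont_on (fun y => F (x +i* y)) (y0 - e) (y0 + e).
  move=> xx xab; apply: cdiff_ccont_ver => y ye; apply: dF => //; first by lra.
  by apply: neq; rewrite xx.
have [h1c h1c'] : ccont_on (fun x => F (x +i* (y0 - e))) (x0 - e) (x0 + e).
  by apply: hc; [rewrite lt_eqF//|]; lra.
have [h2c h2c'] : ccont_on (fun x => F (x +i* (y0 + e))) (x0 - e) (x0 + e).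
  by apply: hc; [rewrite gt_eqF//|]; lra.
have [v1c v1c'] : ccont_on (fun y => F ((x0 - e) +i* y)) (y0 - e) (y0 + e).
  by apply: vc; [rewrite lt_eqF//|]; lra.
have [v2c v2c'] : ccont_on (fun y => F ((x0 + e) +i* y)) (y0 - e) (y0 + e).
  by apply: vc; [rewrite gt_eqF//|]; lra.
have ee : e ^+ 2 != 0 by rewrite expf_neq0// gt_eqF.
have d0 s : s ^+ 2 + e ^+ 2 != 0 by rewrite gt_eqF// ltr_wpDl ?sqr_ge0// exprn_gt0.
have d0' s : e ^+ 2 + s ^+ 2 != 0 by rewrite addrC.
have small (t : R) s : x0 - e <= s <= x0 + e -> `|s - x0| + `|e| < r.
  by move=> hs; rewrite (gtr0_norm e0) -ltrBrDr ltr_norml; lra.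
have small2 (t : R) s : y0 - e <= s <= y0 + e -> `|e| + `|s - y0| < r.
  by move=> hs; rewrite (gtr0_norm e0) -ltrBrDl ltr_norml; lra.
(* In the difference of opposite sides the terms odd in [s - x0] cancel, and the others add up to
   twice a Poisson kernel. *)
have horz s : x0 - e <= s <= x0 + e ->
   `|Re (F (s +i* (y0 - e))) - Re (F (s +i* (y0 + e))) - 2 * - q * (e / ((s - x0) ^+ 2 + e ^+ 2))| <= 2 * M /\
   `|Im (F (s +i* (y0 - e))) - Im (F (s +i* (y0 + e))) - 2 * p * (e / ((s - x0) ^+ 2 + e ^+ 2))| <= 2 * M.
  move=> hs; have sr := small 0 s hs.
  have [] := Fnear (s - x0) e (d0 _) sr.
  have [] := Fnear (s - x0) (- e); [by rewrite sqrrN|by rewrite normrN|].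
  rewrite sqrrN [x0 + (s - x0)]addrC subrK.
  set u1 := Re _; set u2 := Im _; set u3 := Re _; set u4 := Im _ => k1 k2 k3 k4.
  set X := (s - x0) in k1 k2 k3 k4 *; set K := (X ^+ 2 + e ^+ 2) in k1 k2 k3 k4 *.
  split.
    have -> : u1 - u3 - 2 * - q * (e / K) = (u1 - (p * X + q * - e) / K) - (u3 - (p * X + q * e) / K).
      by field; exact: d0.
    by apply: le_trans (ler_normB _ _) _; lra.
  have -> : u2 - u4 - 2 * p * (e / K) = (u2 - (q * X - p * - e) / K) - (u4 - (q * X - p * e) / K).
    by field; exact: d0.
  by apply: le_trans (ler_normB _ _) _; lra.
have vert s : y0 - e <= s <= y0 + e ->
   `|Re (F ((x0 + e) +i* s)) - Re (F ((x0 - e) +i* s)) - 2 * p * (e / ((s - y0) ^+ 2 + e ^+ 2))| <= 2 * M /\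
   `|- Im (F ((x0 + e) +i* s)) - - Im (F ((x0 - e) +i* s)) - 2 * - q * (e / ((s - y0) ^+ 2 + e ^+ 2))| <= 2 * M.
  move=> hs; have sr := small2 0 s hs.
  have [] := Fnear e (s - y0) (d0' _) sr.
  have [] := Fnear (- e) (s - y0); [by rewrite sqrrN|by rewrite normrN|].
  rewrite sqrrN [y0 + (s - y0)]addrC subrK [e ^+ 2 + _]addrC.
  set u1 := Re _; set u2 := Im _; set u3 := Re _; set u4 := Im _ => k1 k2 k3 k4.
  set X := (s - y0) in k1 k2 k3 k4 *; set K := (X ^+ 2 + e ^+ 2) in k1 k2 k3 k4 *.
  split.
    have -> : u3 - u1 - 2 * p * (e / K) = (u3 - (p * e + q * X) / K) - (u1 - (p * - e + q * X) / K).
      by field; exact: d0.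
    by apply: le_trans (ler_normB _ _) _; lra.
  have -> : - u4 - - u2 - 2 * - q * (e / K) = (u2 - (q * - e - p * X) / K) - (u4 - (q * e - p * X) / K).
    by field; exact: d0.
  by apply: le_trans (ler_normB _ _) _; lra.
have A1 := rint_near_Poisson e0 (cont_onB h1c h2c) (fun s hs => (horz s hs).1).
have B1 := rint_near_Poisson e0 (cont_onB h1c' h2c') (fun s hs => (horz s hs).2).
have A2 := rint_near_Poisson e0 (cont_onB (cont_onN v2c') (cont_onN v1c')) (fun s hs => (vert s hs).2).
have B2 := rint_near_Poisson e0 (cont_onB v2c v1c) (fun s hs => (vert s hs).1).
move: A1 A2 B1 B2; rewrite /re_circ /im_circ /circulation.
set i1 := rint _ _ _; set i2 := rint _ _ _; set i3 := rint _ _ _; set i4 := rint _ _ _.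
rewrite !ler_norml => /andP[? ?] /andP[? ?] /andP[? ?] /andP[? ?].
by split; apply/andP; split; lra.
Qed.

End CauchyRectangle.

(** * Complex-valued Lebesgue integrals *)

Section ComplexMeasurable.
Context {R : realType} d (T : measurableType d).
Implicit Types F G : T -> R[i].

Definition cmeas F := measurable_fun [set: T] (fun t => Re (F t)) /\
  measurable_fun [set: T] (fun t => Im (F t)).

Lemma cmeas_cst (c : R[i]) : cmeas (fun=> c).
Proof. by split; exact: measurable_cst. Qed.

Lemma cmeas_real (f : T -> R) : measurable_fun setT f -> cmeas (fun t => (f t)%:C).
Proof. by move=> mf; split => //=; exact: measurable_cst. Qed.

Lemma cmeasD F G : cmeas F -> cmeas G -> cmeas (fun t => F t + G t).
Proof.
move=> [F1 F2] [G1 G2]; split.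
  by under eq_fun do rewrite ReDc; exact: measurable_funD.
by under eq_fun do rewrite ImDc; exact: measurable_funD.
Qed.

Lemma cmeasN F : cmeas F -> cmeas (fun t => - F t).
Proof.
move=> [F1 F2]; split.
  by under eq_fun do rewrite ReNc; exact: measurable_funN.
by under eq_fun do rewrite ImNc; exact: measurable_funN.
Qed.

Lemma cmeasM F G : cmeas F -> cmeas G -> cmeas (fun t => F t * G t).
Proof.
move=> [F1 F2] [G1 G2]; split.
  by under eq_fun do rewrite ReMc; apply: measurable_funB; exact: measurable_funM.
by under eq_fun do rewrite ImMc; apply: measurable_funD; exact: measurable_funM.
Qed.

Lemma cmeas_conj F : cmeas F -> cmeas (fun t => (F t)^*).
Proof.
move=> [F1 F2]; split.
  by under eq_fun do rewrite Re_conjc.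
by under eq_fun do rewrite Im_conjc; exact: measurable_funN.
Qed.

Lemma cmeas_normc F : cmeas F -> measurable_fun setT (fun t => N (F t)).
Proof.
move=> [F1 F2].
rewrite (_ : (fun _ => _) = Num.sqrt \o (fun t => Re (F t) ^+ 2 + Im (F t) ^+ 2)).
  apply: measurableT_comp.
    by apply: continuous_measurable_fun; exact: sqrt_continuous.
  by apply: measurable_funD; exact: measurable_funX.
by apply/funext => t /=; case: (F t).
Qed.

Lemma measurable_invr : measurable_fun setT (@GRing.inv R).
Proof.
rewrite -(setUv [set 0 : R]); apply/measurable_funU => //; first exact: measurableC.
split; first exact: measurable_fun_set1.
apply: open_continuous_measurable_fun; first exact/closed_openC/closed_eq.
by move=> x; rewrite inE/= => /eqP x0; exact: inv_continuous.
Qed.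

Lemma measurable_funVr (f : T -> R) : measurable_fun setT f ->
  measurable_fun setT (fun t => (f t)^-1).
Proof. by move=> mf; exact: (measurableT_comp measurable_invr mf). Qed.

Lemma cmeasV F : cmeas F -> cmeas (fun t => (F t)^-1).
Proof.
move=> mF; have mN := cmeas_normc mF; case: mF => F1 F2; split.
  under eq_fun do rewrite ReVc; apply: measurable_funM => //.
  by apply: measurable_funVr; exact: measurable_funX.
under eq_fun do rewrite ImVc; apply: measurable_funM; first exact: measurable_funN.
by apply: measurable_funVr; exact: measurable_funX.
Qed.

Lemma cmeasX F n : cmeas F -> cmeas (fun t => F t ^+ n).
Proof.
move=> mF; elim: n => [|n IH].
  by under eq_fun do rewrite expr0; exact: cmeas_cst.
by under eq_fun do rewrite exprS; exact: cmeasM.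
Qed.

Lemma cmeas_comp d' (T' : measurableType d') (F : T' -> R[i]) (p : T -> T') :
  measurable_fun setT p -> measurable_fun setT (fun t => Re (F t)) ->
  measurable_fun setT (fun t => Im (F t)) -> cmeas (F \o p).
Proof.
by move=> mp F1 F2; split;
  [exact: (measurableT_comp F1 mp)|exact: (measurableT_comp F2 mp)].
Qed.

End ComplexMeasurable.

Section RealFubini.
Context {R : realType} d1 d2 (T1 : measurableType d1) (T2 : measurableType d2).
Variables (m1 : {sigma_finite_measure set T1 -> \bar R})
          (m2 : {sigma_finite_measure set T2 -> \bar R}).
Variable f : T1 * T2 -> R.
Hypothesis fi : (m1 \x m2)%E.-integrable setT (EFin \o f).

(** The inner real integral is [fine] of an extended one, which may be infinite on a null set of
    parameters; so the two iterated integrals are compared almost everywhere. *)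
Lemma Rintegral_prod1 : \int[(m1 \x m2)%E]_p f p = \int[m1]_x \int[m2]_y f (x, y).
Proof.
rewrite /Rintegral -(integral12_prod_meas1 fi); congr fine.
apply: ae_eq_integral => //.
- exact: measurable_int (integrable_fubini_F fi).
- apply/measurable_EFinP; apply: measurableT_comp (measurable_fubini_F fi) => //.
- have := integrable_ae measurableT (integrable_fubini_F fi).
  by apply: filterS => x /(_ I) xf _; rewrite fineK.
Qed.

Lemma Rintegral_prod2 : \int[(m1 \x m2)%E]_p f p = \int[m2]_y \int[m1]_x f (x, y).
Proof.
rewrite /Rintegral -(integral21_prod_meas1 fi); congr fine.
apply: ae_eq_integral => //.
- exact: measurable_fubini_G fi.
- apply/measurable_EFinP; apply: measurableT_comp (measurable_fubini_G fi) => //.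
- apply: filterS (ae_integrable2 fi) => y yi _ /=.
  by rewrite fineK//; exact: integrable_fin_num.
Qed.

End RealFubini.

Section ComplexIntegral.
Context {R : realType} d (T : measurableType d).
Variable mu : {measure set T -> \bar R}.
Implicit Types F G : T -> R[i].

Definition cintegrable F :=
  mu.-integrable setT (fun t => (Re (F t))%:E) /\
  mu.-integrable setT (fun t => (Im (F t))%:E).

Definition cint F : R[i] := (\int[mu]_t Re (F t)) +i* (\int[mu]_t Im (F t)).

Lemma cintegrable_meas F : cintegrable F -> cmeas F.
Proof. by move=> [/measurable_int/measurable_EFinP ? /measurable_int/measurable_EFinP ?]. Qed.

Lemma cintegrable_le F (g : T -> \bar R) : cmeas F -> measurable_fun setT g ->
  (forall t, ((N (F t))%:E <= g t)%E) -> (\int[mu]_t g t < +oo)%E -> cintegrable F.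
Proof.
move=> [F1 F2] mg Fg gi.
have g0 t : (0 <= g t)%E by apply: le_trans (Fg t); rewrite lee_fin normc_ge0.
have ig : mu.-integrable setT g.
  apply/integrableP; split => //; apply: le_lt_trans gi.
  by under eq_integral => t _ do rewrite gee0_abs//.
split; apply: (le_integrable _ _ _ ig) => //; try exact/measurable_EFinP.
  move=> t _; rewrite (gee0_abs (g0 t)); apply: le_trans (Fg t).
  by rewrite abse_EFin lee_fin; exact: normc_Re.
move=> t _; rewrite (gee0_abs (g0 t)); apply: le_trans (Fg t).
by rewrite abse_EFin lee_fin; exact: normc_Im.
Qed.

Lemma cintegrableP F : cmeas F -> (\int[mu]_t (N (F t))%:E < +oo)%E -> cintegrable F.
Proof.
move=> mF; apply: cintegrable_le => //.
by apply/measurable_EFinP; exact: cmeas_normc.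
Qed.

Lemma integral_normc_lty F : cintegrable F -> (\int[mu]_t (N (F t))%:E < +oo)%E.
Proof.
move=> iF; have mF := cintegrable_meas iF; case: iF => i1 i2.
have /integrableP[_] := integrableD measurableT (integrable_abse i1) (integrable_abse i2).
apply: le_lt_trans; apply: ge0_le_integral => //.
- by move=> t _; rewrite lee_fin normc_ge0.
- by apply/measurable_EFinP; exact: cmeas_normc.
- apply: measurableT_comp => //; apply: emeasurable_funD; apply: measurableT_comp => //;
  by case: mF => ? ?; exact/measurable_EFinP.
- move=> t _ /=; rewrite lee_fin ger0_norm ?addr_ge0//; exact: normc_le_ReIm.
Qed.

(** The factor 2 comes from bounding the real and the imaginary part separately. Later uses only
    need some constant. *)
Lemma normc_cint_le F : cintegrable F ->
  ((N (cint F))%:E <= 2%:E * \int[mu]_t (N (F t))%:E)%E.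
Proof.
move=> iF; have mF := cintegrable_meas iF; case: (iF) => i1 i2.
have B (f : T -> R) : mu.-integrable setT (EFin \o f) -> (forall t, `|f t| <= N (F t)) ->
    (`|\int[mu]_t f t|%:E <= \int[mu]_t (N (F t))%:E)%E.
  move=> fi fF; rewrite EFin_normr_Rintegral//.
  apply: le_trans (le_abse_integral _ _ _) _ => //; first exact: measurable_int fi.
  apply: ge0_le_integral => //.
  - by apply: measurableT_comp => //; exact: measurable_int fi.
  - by apply/measurable_EFinP; exact: cmeas_normc.
  - by move=> t _; rewrite abse_EFin lee_fin.
have -> : (2%:E = 1 + 1 :> \bar R)%E by rewrite -EFinD.
rewrite ge0_muleDl ?mul1e//; apply: le_trans (leeD (B _ i1 _) (B _ i2 _)).
- by rewrite -EFinD lee_fin; exact: (normc_le_ReIm (cint F)).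
- by move=> t; exact: normc_Re.
- by move=> t; exact: normc_Im.
Qed.

Lemma cintegrableZ c F : cintegrable F -> cintegrable (fun t => c * F t).
Proof.
move=> iF; apply: cintegrableP.
  by apply: cmeasM; [exact: cmeas_cst|exact: cintegrable_meas].
under eq_integral do rewrite Normc.normcM EFinM.
rewrite ge0_integralZl//.
- by apply: lte_mul_pinfty; rewrite ?lee_fin ?normc_ge0//; exact: integral_normc_lty.
- by apply/measurable_EFinP/cmeas_normc; exact: cintegrable_meas.
- by move=> t _; rewrite lee_fin normc_ge0.
- by rewrite lee_fin normc_ge0.
Qed.

Lemma cintZ c F : cintegrable F -> cint (fun t => c * F t) = c * cint F.
Proof.
move=> [i1 i2].
have S (k : R) (f : T -> R) : mu.-integrable setT (EFin \o f) ->
    mu.-integrable setT (EFin \o (fun t => k * f t)) by move=> fi; exact: (integrableZl measurableT k fi).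
apply/eqP; rewrite eq_complex ReMc ImMc /cint/=; apply/andP; split; apply/eqP.
  under eq_Rintegral do rewrite ReMc.
  by rewrite RintegralB//; [rewrite !RintegralZl|exact: S..].
under eq_Rintegral do rewrite ImMc.
by rewrite RintegralD//; [rewrite !RintegralZl|exact: S..].
Qed.

Lemma cintD F G : cintegrable F -> cintegrable G ->
  cint (fun t => F t + G t) = cint F + cint G.
Proof.
move=> [F1 F2] [G1 G2].
apply/eqP; rewrite eq_complex ReDc ImDc /cint/=; apply/andP; split; apply/eqP.
  by under eq_Rintegral do rewrite ReDc; rewrite RintegralD.
by under eq_Rintegral do rewrite ImDc; rewrite RintegralD.
Qed.

Lemma cintB F G : cintegrable F -> cintegrable G ->
  cint (fun t => F t - G t) = cint F - cint G.
Proof.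
move=> iF iG; rewrite -[- cint G]mulN1r -cintZ// -cintD//; last exact: cintegrableZ.
by congr cint; apply/funext => t; rewrite mulN1r.
Qed.

Lemma cint_conj F : cintegrable F -> cint (fun t => (F t)^*) = (cint F)^*.
Proof.
move=> [F1 F2].
apply/eqP; rewrite eq_complex Re_conjc Im_conjc /cint/=; apply/andP; split; apply/eqP.
  by under eq_Rintegral do rewrite Re_conjc.
under eq_Rintegral do rewrite Im_conjc -mulN1r.
by rewrite RintegralZl// mulN1r.
Qed.

Lemma ae_eq_cint F G : cmeas F -> cmeas G -> {ae mu, forall t, F t = G t} ->
  cint F = cint G.
Proof.
move=> [F1 F2] [G1 G2] FG.
by congr (_ +i* _); congr fine; apply: ae_eq_integral => //; try exact/measurable_EFinP;
  apply: filterS FG => t -> _.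
Qed.

End ComplexIntegral.

Section ComplexFubini.
Context {R : realType} d1 d2 (T1 : measurableType d1) (T2 : measurableType d2).
Variables (m1 : {sigma_finite_measure set T1 -> \bar R})
          (m2 : {sigma_finite_measure set T2 -> \bar R}).
Variable F : T1 * T2 -> R[i].
Hypothesis iF : cintegrable (m1 \x m2)%E F.

Lemma cint_prod1 : cint (m1 \x m2)%E F = cint m1 (fun x => cint m2 (fun y => F (x, y))).
Proof.
by case: iF => i1 i2; congr (_ +i* _); [exact: (Rintegral_prod1 i1)|exact: (Rintegral_prod1 i2)].
Qed.

Lemma cint_prod2 : cint (m1 \x m2)%E F = cint m2 (fun y => cint m1 (fun x => F (x, y))).
Proof.
by case: iF => i1 i2; congr (_ +i* _); [exact: (Rintegral_prod2 i1)|exact: (Rintegral_prod2 i2)].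
Qed.

End ComplexFubini.

(** * Changes of variables *)

Section AffineSubstitution.
Context {R : realType}.
Local Notation mu := (@lebesgue_measure R).

Let aff (a b : R) : measurableTypeR R -> measurableTypeR R := fun x => a * x + b.

Let measurable_aff a b : measurable_fun setT (aff a b).
Proof. by apply: measurable_funD => //; exact: measurable_funM. Qed.

(** The right side is a measure with the value of Lebesgue measure on the intervals []u, v]], and
    these determine it. For negative [a] the preimage is open at the other end, which does not
    change its length. *)
Lemma lebesgue_measure_affine (a b : R) (A : set R) : a != 0 -> measurable A ->
  mu A = (`|a|%:E * mu (aff a b @^-1` A))%E.
Proof.
move=> a0 mA.
have mf := measurable_aff a b.
pose m0 := [the measure _ _ of pushforward mu (aff a b)].
pose m := m0 mf.
pose k := NngNum (normr_ge0 a).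
change (mu A = mscale k m A).
apply: (@lebesgue_measure_unique R (mscale k m)) => // _ [[u v] /= uv] <-.
change (mu `]u, v]%classic = (`|a|%:E * mu (aff a b @^-1` `]u, v]))%E).
have cancel t : a * ((t - b) / a) + b = t by rewrite mulrC divfK// subrK.
have [ap|an] : (0 < a) \/ (a < 0).
  by have [?|?|/eqP] := ltgtP a 0; [right|left|rewrite (negbTE a0)].
- have -> : aff a b @^-1` `]u, v] = `](u - b) / a, (v - b) / a]%classic.
    apply/seteqP; split => x /=; rewrite !in_itv/= /aff ltr_pdivrMr// ler_pdivlMr//;
      by rewrite ltrBlDr lerBrDr mulrC.
  rewrite !lebesgue_measure_itv/= !lte_fin ltr_pM2r ?invr_gt0// ltrD2r.
  case: ifPn => _; last by rewrite mule0.
  by rewrite -!EFinD -EFinM gtr0_norm//; congr EFin; field.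
- have -> : aff a b @^-1` `]u, v] = `[(v - b) / a, (u - b) / a[%classic.
    apply/seteqP; split => x /=; rewrite !in_itv/= /aff ltr_ndivlMr// ler_ndivrMr//;
      by rewrite ltrBlDr lerBrDr mulrC andbC.
  rewrite !lebesgue_measure_itv/= !lte_fin ltr_nM2r ?invr_lt0// ltrD2r.
  case: ifPn => _; last by rewrite mule0.
  by rewrite -!EFinD -EFinM ltr0_norm//; congr EFin; field.
Qed.

Lemma integral_affine (a b : R) (F : R -> \bar R) : a != 0 ->
  measurable_fun setT F -> (forall x, (0 <= F x)%E) ->
  (`|a|%:E * \int[mu]_x F (a * x + b)%R = \int[mu]_x F x)%E.
Proof.
move=> a0 mF F0.
have mf := measurable_aff a b.
pose m0 := [the measure _ _ of pushforward mu (aff a b)].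
pose m := m0 mf.
pose k := NngNum (normr_ge0 a).
rewrite [RHS](@eq_measure_integral _ _ _ setT (mscale k m)); last first.
  by move=> A mA _; exact: lebesgue_measure_affine.
rewrite ge0_integral_mscale//; congr (_ * _)%E.
by rewrite ge0_integral_pushforward.
Qed.

End AffineSubstitution.

Section Swap.
Context {R : realType} d1 d2 (T1 : measurableType d1) (T2 : measurableType d2).
Variables (m1 : {sigma_finite_measure set T1 -> \bar R})
          (m2 : {sigma_finite_measure set T2 -> \bar R}).

Lemma integral_swap (G : T1 -> T2 -> \bar R) : (forall x y, (0 <= G x y)%E) ->
  measurable_fun setT (fun p : T1 * T2 => G p.1 p.2) ->
  (\int[m1]_x \int[m2]_y G x y = \int[m2]_y \int[m1]_x G x y)%E.
Proof.
by move=> G0 mG; apply: (sfinite_Fubini m1 m2 (fun p => G p.1 p.2)) => // -[].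
Qed.

Lemma measurable_integral1 (G : T1 -> T2 -> \bar R) : (forall x y, (0 <= G x y)%E) ->
  measurable_fun setT (fun p : T1 * T2 => G p.1 p.2) ->
  measurable_fun setT (fun y => \int[m1]_x G x y)%E.
Proof.
move=> G0 mG; apply: (@measurable_fun_fubini_tonelli_G _ _ _ _ _ m1 (fun p => G p.1 p.2)) => //.
Qed.

Lemma measurable_integral2 (G : T1 -> T2 -> \bar R) : (forall x y, (0 <= G x y)%E) ->
  measurable_fun setT (fun p : T1 * T2 => G p.1 p.2) ->
  measurable_fun setT (fun x => \int[m2]_y G x y)%E.
Proof.
move=> G0 mG; apply: (@measurable_fun_fubini_tonelli_F _ _ _ _ _ m2 (fun p => G p.1 p.2)) => //.
Qed.

Lemma integral_prod1 (G : T1 * T2 -> \bar R) : (forall p, (0 <= G p)%E) ->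
  measurable_fun setT G ->
  (\int[m1 \x m2]_p G p = \int[m1]_x \int[m2]_y G (x, y))%E.
Proof. by move=> G0 mG; exact: fubini_tonelli1. Qed.

Lemma integral_prod2 (G : T1 * T2 -> \bar R) : (forall p, (0 <= G p)%E) ->
  measurable_fun setT G ->
  (\int[m1 \x m2]_p G p = \int[m2]_y \int[m1]_x G (x, y))%E.
Proof. by move=> G0 mG; exact: fubini_tonelli2. Qed.

End Swap.

(** * Invariance of Haar measure on the half-line under inversion *)

Section Inversion.
Context {R : realType}.
Local Notation mu := (@lebesgue_measure R).
Implicit Types F : R -> \bar R.

(* Density of the multiplicative Haar measure of [(0, +oo)]. *)
Definition haar (x : R) : R := if 0 < x then x^-1 else 0.

Lemma haar_ge0 x : 0 <= haar x.
Proof. by rewrite /haar; case: ifPn => // /ltW; rewrite invr_ge0. Qed.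

Lemma measurable_haar : measurable_fun setT haar.
Proof.
apply: measurable_fun_ifT => //; last exact: measurable_invr.
exact: measurable_fun_ltr.
Qed.

Lemma integral_haar_scale a F : 0 < a -> measurable_fun setT F ->
  (forall x, (0 <= F x)%E) ->
  (\int[mu]_x (F (a * x)%R * (haar x)%:E) = \int[mu]_x (F x * (haar x)%:E))%E.
Proof.
move=> a0 mF F0.
have mG : measurable_fun setT (fun x => F x * (haar x)%:E)%E.
  by apply: emeasurable_funM => //; apply/measurable_EFinP; exact: measurable_haar.
have G0 x : (0 <= F x * (haar x)%:E)%E by rewrite mule_ge0// lee_fin haar_ge0.
rewrite -[RHS](@integral_affine _ a 0)// ?gt_eqF//.
rewrite gtr0_norm// -ge0_integralZl//; last by rewrite lee_fin ltW.
  apply: eq_integral => x _; rewrite addr0 muleCA -EFinM; congr (_ * _%:E)%E.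
  rewrite /haar pmulr_rgt0//; case: ifP => _; last by rewrite mulr0.
  by rewrite invfM mulrA divff ?mul1r// gt_eqF.
by apply: (measurableT_comp mG); apply: measurable_funD => //; exact: measurable_funM.
Qed.

(** A test function of total mass 1: multiplied by [haar] it is the indicator of []0, 1]]. *)
Let bump (x : R) : R := if 0 < x <= 1 then x else 0.

Let measurable_bump : measurable_fun setT bump.
Proof.
apply: measurable_fun_ifT => //.
by apply: measurable_and; [exact: measurable_fun_ltr|exact: measurable_fun_ler].
Qed.

Let bump_ge0 x : 0 <= bump x.
Proof. by rewrite /bump; case: ifPn => // /andP[/ltW]. Qed.

Let integral_bump : (\int[mu]_x ((bump x)%:E * (haar x)%:E) = 1)%E.
Proof.
pose A : set R := `]0, 1]%classic.
transitivity (\int[mu]_x (\1_A x)%:E)%E.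
  apply: eq_integral => x _; rewrite -EFinM; congr EFin; rewrite /bump /haar indicE.
  rewrite mem_setE in_itv/=; case: ifPn => [/andP[x0 _]|] /=; last by rewrite mul0r.
  by rewrite x0 divff// gt_eqF.
rewrite integral_indic//; last by rewrite /A; exact: measurable_itv.
by rewrite setIT /A [LHS]lebesgue_measure_itv/= lte_fin ltr01 oppr0 addr0.
Qed.

(* Uniqueness of Haar measure: average the left side over all dilations. *)
Lemma integral_haar_inv c F : 0 < c -> measurable_fun setT F ->
  (forall x, (0 <= F x)%E) ->
  (\int[mu]_x (F (c / x)%R * (haar x)%:E) = \int[mu]_x (F x * (haar x)%:E))%E.
Proof.
move=> c0 mF F0.
have mEhaar : measurable_fun setT (EFin \o haar).
  by apply/measurable_EFinP; exact: measurable_haar.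
have mEbump : measurable_fun setT (EFin \o bump) by exact/measurable_EFinP.
have haar0 x : (0 <= (haar x)%:E)%E by rewrite lee_fin haar_ge0.
have bump0 x : (0 <= (bump x)%:E)%E by rewrite lee_fin bump_ge0.
have mdiv (a : R) : measurable_fun setT (fun x : R => a / x).
  by apply: measurable_funM => //; exact: measurable_invr.
(* Inserts the factor 1, written as the [haar] integral over [t] of [bump (x * t)]. *)
transitivity (\int[mu]_x \int[mu]_t
    (F (c / x)%R * (haar x)%:E * ((bump (x * t)%R)%:E * (haar t)%:E)))%E.
  apply: eq_integral => x _; rewrite ge0_integralZl//; last 3 first.
  - apply: emeasurable_funM => //; apply: (measurableT_comp mEbump).
    exact: measurable_funM.
  - by move=> t _; rewrite mule_ge0.
  - by rewrite mule_ge0.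
  have [x0|x0] := ltP 0 x; last by rewrite /haar [0 < x]ltNge x0 mule0 mul0e.
  by rewrite (@integral_haar_scale x (EFin \o bump))// integral_bump mule1.
rewrite integral_swap; last 2 first.
- by move=> x t; rewrite !mule_ge0.
- apply: emeasurable_funM; apply: emeasurable_funM.
  + by apply: (measurableT_comp mF); apply: (measurableT_comp (mdiv c)).
  + by apply: (measurableT_comp mEhaar).
  + by apply: (measurableT_comp mEbump); exact: measurable_funM.
  + by apply: (measurableT_comp mEhaar).
(* For fixed [t], dilating [x] by [t] moves [t] out of [bump] and into [F]. *)
transitivity (\int[mu]_t \int[mu]_x
    (F (c / x * t)%R * (bump x)%:E * (haar x)%:E * (haar t)%:E))%E.
  apply: eq_integral => t _.
  have [t0|t0] := ltP 0 t; last first.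
    by apply: eq_integral => x _; rewrite /haar [0 < t]ltNge t0 !mule0.
  have mH : measurable_fun setT (fun x : R => F (c / x * t)%R * (bump x)%:E)%E.
    apply: emeasurable_funM => //; apply: (measurableT_comp mF).
    exact: measurable_funM.
  rewrite ge0_integralZr//; last 2 first.
  - exact: emeasurable_funM.
  - by move=> x _; rewrite !mule_ge0.
  rewrite -(@integral_haar_scale t (fun x : R => F (c / x * t)%R * (bump x)%:E)%E)//; last first.
    by move=> x; rewrite mule_ge0.
  rewrite -ge0_integralZr//.
  - apply: eq_integral => x _.
    have -> : c / (t * x) * t = c / x.
      by rewrite invfM; move: (x^-1) => y; field; rewrite gt_eqF.
    by rewrite [t * x]mulrC muleACA !muleA.
  - apply: emeasurable_funM => //; apply: emeasurable_funM.
      apply: (measurableT_comp mF); apply: measurable_funM => //.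
      by apply: (measurableT_comp (mdiv c)); exact: measurable_funM.
    by apply: (measurableT_comp mEbump); exact: measurable_funM.
  - by move=> x _; rewrite !mule_ge0.
rewrite integral_swap; last 2 first.
- by move=> x t; rewrite !mule_ge0.
- apply: emeasurable_funM; first apply: emeasurable_funM; first apply: emeasurable_funM.
  + apply: (measurableT_comp mF); apply: measurable_funM => //.
    by apply: (measurableT_comp (mdiv c)).
  + by apply: (measurableT_comp mEbump).
  + by apply: (measurableT_comp mEhaar).
  + by apply: (measurableT_comp mEhaar).
have I0 : (0 <= \int[mu]_x (F x * (haar x)%:E))%E.
  by apply: integral_ge0 => x _; rewrite mule_ge0.
(* For fixed [x], dilating [t] by [c / x] frees [F] from [x], and the two integrals separate. *)
transitivity (\int[mu]_x ((bump x)%:E * (haar x)%:E * \int[mu]_t (F t * (haar t)%:E)))%E.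
  apply: eq_integral => x _.
  have [x0|x0] := ltP 0 x; last first.
    rewrite /haar [0 < x]ltNge x0 !mule0 mul0e.
    by under eq_integral do rewrite mule0 mul0e; rewrite integral0.
  rewrite -(@integral_haar_scale (c / x) F)// ?divr_gt0// -ge0_integralZl//.
  - by apply: eq_integral => t _; rewrite -!muleA muleCA; congr (_ * _)%E; rewrite muleCA.
  - apply: emeasurable_funM => //; apply: (measurableT_comp mF).
    exact: measurable_funM.
  - by move=> t _; rewrite mule_ge0.
  - by rewrite mule_ge0.
rewrite ge0_integralZr//; first by rewrite integral_bump mul1e.
- exact: emeasurable_funM.
- by move=> x _; rewrite mule_ge0.
Qed.

End Inversion.

(** * Area integrals under inversion, translations and similarities *)

Section PlaneSubstitution.
Context {R : realType}.
Local Notation mu := (@lebesgue_measure R).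
Local Notation area := ((@lebesgue_measure R) \x (@lebesgue_measure R))%E.
Implicit Types Q : R * R -> \bar R.

Definition rpart (p : R * R) : R := if 0 < p.1 then 1 else 0.

Lemma measurable_rpart : measurable_fun setT rpart.
Proof. by apply: measurable_fun_ifT => //; exact: measurable_fun_ltr. Qed.

Lemma rpart_ge0 p : 0 <= rpart p. Proof. by rewrite /rpart; case: ifP. Qed.

Lemma measurable_pair (f g : R * R -> R) : measurable_fun setT f ->
  measurable_fun setT g -> measurable_fun setT (fun p => (f p, g p)).
Proof. exact: measurable_fun_pair. Qed.

(** Coordinates [(x, s)] with [y = x * s]. The Jacobian [x] is written [x ^+ 2 * haar x], ready for
    the invariance of Haar measure, since inversion preserves the slope [s]. *)
Lemma integral_slope Q : measurable_fun setT Q -> (forall p, (0 <= Q p)%E) ->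
  (\int[area]_p (Q p * (rpart p)%:E) =
   \int[mu]_s \int[mu]_x (Q (x, x * s)%R * (x ^+ 2)%:E * (haar x)%:E))%E.
Proof.
move=> mQ Q0.
have mE : measurable_fun setT (EFin \o rpart).
  by apply/measurable_EFinP; exact: measurable_rpart.
have mEhaar : measurable_fun setT (EFin \o (@haar R)).
  by apply/measurable_EFinP; exact: measurable_haar.
have haar0 x : (0 <= (haar x)%:E :> \bar R)%E by rewrite lee_fin haar_ge0.
rewrite integral_prod1; last 2 first.
- by move=> p; rewrite mule_ge0// lee_fin rpart_ge0.
- exact: emeasurable_funM.
rewrite [RHS]integral_swap; last 2 first.
- by move=> s x; rewrite !mule_ge0// lee_fin sqr_ge0.
- apply: emeasurable_funM; first apply: emeasurable_funM.
  + apply: (measurableT_comp mQ).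
    by apply: measurable_pair => //; exact: measurable_funM.
  + by apply/measurable_EFinP; exact: measurable_funX.
  + exact: (measurableT_comp mEhaar).
apply: eq_integral => x _; rewrite /rpart /haar /=.
have [x0|x0] := ltP 0 x; last first.
  by under eq_integral do rewrite mule0; under [RHS]eq_integral do rewrite mule0.
under eq_integral do rewrite mule1.
have mQx : measurable_fun setT (fun y => Q (x, y)).
  by apply: (measurableT_comp mQ); exact: measurable_fun_pair.
rewrite -(@integral_affine _ x 0)// ?gt_eqF// gtr0_norm// -ge0_integralZl//.
- apply: eq_integral => s _; rewrite addr0 -muleA -EFinM muleC; congr (_ * _%:E)%E.
  by rewrite expr2 mulfK// gt_eqF.
- apply: (measurableT_comp mQx); apply: measurable_funD; [exact: measurable_funM|exact: measurable_cst].
- by rewrite lee_fin ltW.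
Qed.

Definition inversion (p : R * R) : R * R :=
  (p.1 / (p.1 ^+ 2 + p.2 ^+ 2), p.2 / (p.1 ^+ 2 + p.2 ^+ 2)).

Lemma measurable_inversion : measurable_fun setT inversion.
Proof.
have m2 : measurable_fun setT (fun p : R * R => (p.1 ^+ 2 + p.2 ^+ 2)^-1).
  by apply: measurable_funVr; apply: measurable_funD; exact: measurable_funX.
by apply: measurable_pair; apply: measurable_funM.
Qed.

(** On the ray of slope [s] the inversion is [x] to [(1 + s ^+ 2)^-1 / x], so that
    [integral_haar_inv] applies ray by ray. *)
Lemma integral_inversion Q : measurable_fun setT Q -> (forall p, (0 <= Q p)%E) ->
  (\int[area]_p (Q (inversion p) * (((p.1 ^+ 2 + p.2 ^+ 2)^-1 ^+ 2)%R)%:E * (rpart p)%:E) =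
   \int[area]_p (Q p * (rpart p)%:E))%E.
Proof.
move=> mQ Q0; rewrite integral_slope; last 2 first.
- apply: emeasurable_funM; first exact: (measurableT_comp mQ measurable_inversion).
  apply/measurable_EFinP; apply: measurable_funX; apply: measurable_funVr.
  by apply: measurable_funD; exact: measurable_funX.
- by move=> p; rewrite mule_ge0// lee_fin sqr_ge0.
rewrite (integral_slope mQ Q0); apply: eq_integral => s _.
have s0 : 0 < 1 + s ^+ 2 by rewrite ltr_pwDl// sqr_ge0.
rewrite -[RHS](@integral_haar_inv _ (1 + s ^+ 2)^-1 (fun x : R => Q (x, x * s)%R * (x ^+ 2)%:E)%E).
- apply: eq_integral => x _ /=; rewrite /haar.
  case: ifPn => [x0|_]; last by rewrite !mule0.
  congr (_ * _)%E; rewrite /inversion/= -muleA -EFinM.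
  have x1 : x != 0 by rewrite gt_eqF.
  have xs : x ^+ 2 + (x * s) ^+ 2 = x ^+ 2 * (1 + s ^+ 2) by ring.
  rewrite xs; congr (Q (_, _) * _%:E)%E.
  + by field; rewrite x1 gt_eqF.
  + by field; rewrite x1 gt_eqF.
  + by field; rewrite x1 gt_eqF.
- by rewrite invr_gt0.
- apply: emeasurable_funM; first apply: (measurableT_comp mQ).
    by apply: measurable_fun_pair => //; exact: measurable_funM.
  by apply/measurable_EFinP; exact: measurable_funX.
- by move=> x; rewrite mule_ge0// lee_fin sqr_ge0.
Qed.

Lemma integral_translation Q (u v : R) : measurable_fun setT Q -> (forall p, (0 <= Q p)%E) ->
  (\int[area]_p Q (p.1 + u, p.2 + v)%R = \int[area]_p Q p)%E.
Proof.
move=> mQ Q0; rewrite integral_prod1//; last first.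
  by apply: (measurableT_comp mQ); apply: measurable_pair; exact: measurable_funD.
rewrite [RHS](integral_prod1 mu mu Q0 mQ).
have mQx x : measurable_fun setT (fun y => Q (x, y)).
  by apply: (measurableT_comp mQ); exact: measurable_fun_pair.
transitivity (\int[mu]_x \int[mu]_y Q (x + u, y)%R)%E.
  apply: eq_integral => x _.
  rewrite -[RHS](@integral_affine _ 1 v)// ?oner_neq0// normr1 mul1e.
  by apply: eq_integral => y _; rewrite mul1r.
have mF : measurable_fun setT (fun x => \int[mu]_y Q (x, y))%E.
  exact: measurable_fun_fubini_tonelli_F.
rewrite -[RHS](@integral_affine _ 1 u)// ?oner_neq0//; last by move=> x; exact: integral_ge0.
by rewrite normr1 mul1e; apply: eq_integral => x _; rewrite mul1r.
Qed.

Lemma integral_reflection Q : measurable_fun setT Q -> (forall p, (0 <= Q p)%E) ->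
  (\int[area]_p Q (p.1, - p.2)%R = \int[area]_p Q p)%E.
Proof.
move=> mQ Q0; rewrite integral_prod1//; last first.
  by apply: (measurableT_comp mQ); apply: measurable_pair => //; exact: measurable_funN.
rewrite [RHS](integral_prod1 mu mu Q0 mQ); apply: eq_integral => x _.
have mQx : measurable_fun setT (fun y => Q (x, y)).
  by apply: (measurableT_comp mQ); exact: measurable_fun_pair.
rewrite -[RHS](@integral_affine _ (- 1) 0)// ?oppr_eq0 ?oner_neq0// normrN normr1 mul1e.
by apply: eq_integral => y _; rewrite mulN1r addr0.
Qed.

Lemma integral_similarity Q (a b : R) : a ^+ 2 + b ^+ 2 != 0 ->
  measurable_fun setT Q -> (forall p, (0 <= Q p)%E) ->
  ((a ^+ 2 + b ^+ 2)%:E * \int[area]_p Q (a * p.1 - b * p.2, b * p.1 + a * p.2)%R =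
   \int[area]_p Q p)%E.
Proof.
move=> ab0 mQ Q0.
have mlin (k l : R) : measurable_fun setT (fun p : R * R => k * p.1 + l * p.2).
  by apply: measurable_funD; exact: measurable_funM.
have mlin2 (k l m n : R) : measurable_fun setT (fun p : R * R => Q (k * p.1 + l * p.2, m * p.1 + n * p.2)).
  by apply: (measurableT_comp mQ); exact: measurable_pair.
have mQx x : measurable_fun setT (fun y => Q (x, y)).
  by apply: (measurableT_comp mQ); exact: measurable_fun_pair.
have mQy y : measurable_fun setT (fun x => Q (x, y)).
  by apply: (measurableT_comp mQ); exact: measurable_fun_pair.
have mL : measurable_fun setT (fun p : R * R => Q (a * p.1 - b * p.2, b * p.1 + a * p.2)).
  by have := mlin2 a (- b) b a; under eq_fun do rewrite mulNr.
(* For [a = 0] the map only exchanges and rescales the axes. Otherwise it is a composite of two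
   shears with scaling. *)
have [a0|a0] := eqVneq a 0.
  have b0 : b != 0 by apply: contra ab0 => /eqP ->; rewrite a0 expr0n addr0.
  rewrite a0 expr0n add0r.
  have -> : (fun p : R * R => Q (0 * p.1 - b * p.2, b * p.1 + 0 * p.2)) =
      (fun p => Q (- b * p.2, b * p.1)).
    by apply/funext => p; rewrite !mul0r add0r addr0 mulNr.
  have mL2 : measurable_fun setT (fun p : R * R => Q (- b * p.2, b * p.1)).
    have := mlin2 0 (- b) b 0.
    by under eq_fun do rewrite mul0r add0r mul0r addr0.
  rewrite integral_prod2// [RHS]integral_prod1//=.
  have mG : measurable_fun setT (fun x => \int[mu]_y Q (x, y))%E.
    exact: measurable_fun_fubini_tonelli_F.
  have G0 x : (0 <= \int[mu]_y Q (x, y))%E by exact: integral_ge0.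
  rewrite -[RHS](@integral_affine _ (- b) 0 _ _ mG G0) ?oppr_eq0// normrN.
  have -> : (b ^+ 2)%:E = (`|b|%:E * `|b|%:E)%E by rewrite -EFinM -expr2 real_normK// num_real.
  have B0 : (0 <= `|b|%:E :> \bar R)%E by rewrite lee_fin.
  rewrite -muleA; congr (_ * _)%E; rewrite -ge0_integralZl//.
  - apply: eq_integral => y _; rewrite addr0 -[RHS](@integral_affine _ b 0)//.
    by under [in RHS]eq_integral do rewrite addr0.
  - by apply: (measurable_integral1 mu (G := fun x y => Q (- b * y, b * x))).
  - by move=> y _; exact: integral_ge0.
rewrite integral_prod2//.
(* With [x' = a * x - b * y] the second coordinate becomes [c * y + b / a * x']; one integrates
   first in [x], then in [y]. *)
pose c := (a ^+ 2 + b ^+ 2) / a.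
have c0 : c != 0 by rewrite mulf_neq0// invr_eq0.
have A0 : (0 <= `|a|%:E :> \bar R)%E by rewrite lee_fin.
have C0 : (0 <= `|c|%:E :> \bar R)%E by rewrite lee_fin.
have -> : (a ^+ 2 + b ^+ 2)%:E = (`|c|%:E * `|a|%:E)%E.
  rewrite -EFinM -normrM /c divfK// ger0_norm// addr_ge0// sqr_ge0 //.
have mS : measurable_fun setT (fun p : R * R => Q (p.1, c * p.2 + b / a * p.1)).
  have := mlin2 1 0 (b / a) c; rewrite (_ : (fun _ => _) = (fun p : R * R => Q (p.1, c * p.2 + b / a * p.1)))//.
  by apply/funext => p; rewrite mul1r mul0r addr0 addrC.
transitivity (`|c|%:E * \int[mu]_y \int[mu]_x Q (x, c * y + b / a * x)%R)%E.
  rewrite -muleA; congr (_ * _)%E; rewrite -ge0_integralZl//.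
  - apply: eq_integral => y _ /=.
    rewrite -[RHS](@integral_affine _ a (- (b * y)))//.
    + congr (_ * _)%E; apply: eq_integral => x _; congr (Q (_, _)).
      by rewrite /c; field.
    + have mp : measurable_fun setT (fun x : R => (x, y)) by exact: measurable_fun_pair.
      exact: (measurableT_comp mS mp).
  - by apply: (measurable_integral1 mu (G := fun x y => Q (a * x - b * y, b * x + a * y))).
  - by move=> y _; exact: integral_ge0.
rewrite -(@integral_swap _ _ _ _ _ mu mu (fun x y => Q (x, c * y + b / a * x)))//.
rewrite [RHS]integral_prod1// -ge0_integralZl//.
- by apply: eq_integral => x _; rewrite -[RHS](@integral_affine _ c (b / a * x)).
- by apply: (measurable_integral2 mu (G := fun x y => Q (x, c * y + b / a * x))).
- by move=> x _; exact: integral_ge0.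
Qed.

End PlaneSubstitution.

(** * The weighted Bergman space *)

Section HalfPlane.
Context {R : realType}.
Local Notation mu := (@lebesgue_measure R).
Local Notation area := ((@lebesgue_measure R) \x (@lebesgue_measure R))%E.
Implicit Types (h k : Cplus R -> R[i]) (z w : R[i]) (p q : R * R) (l : nat).

Definition toC p : R[i] := p.1 +i* p.2.
Definition ofC z : R * R := (Re z, Im z).

Lemma ofCK z : toC (ofC z) = z. Proof. by case: z. Qed.

Lemma ext_pos h z (z0 : 0 < Re z) : ext h z = h (exist _ z z0).
Proof. by rewrite /ext insubT. Qed.

Lemma ext_val h (z : Cplus R) : ext h (val z) = h z.
Proof. by case: z => z z0; rewrite ext_pos. Qed.

Lemma ext_neg h z : Re z <= 0 -> ext h z = 0.
Proof. by move=> z0; rewrite /ext insubF//= ltNge z0. Qed.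

Lemma open_half_plane z : 0 < Re z -> forall w, N (w - z) < Re z -> 0 < Re w.
Proof.
move=> z0 w wz; have := le_lt_trans (normc_Re (w - z)) wz.
by rewrite ReDc ReNc ltr_norml => /andP[+ _]; lra.
Qed.

Lemma analytic_cdiff h : analytic h <-> forall z, 0 < Re z -> cdiff (ext h) z.
Proof.
split=> [ah z z0|H z].
  by have := ah (exist _ z z0); move/derivable_cdiff.
by apply/derivable_cdiff/H; case: z.
Qed.

Lemma analytic_of_cdiff h (F : R[i] -> R[i]) :
  (forall z : Cplus R, h z = F (val z)) -> (forall z, 0 < Re z -> cdiff F z) -> analytic h.
Proof.
move=> hF dF; apply/analytic_cdiff => z z0; apply: (eq_cdiff z0 _ (dF z z0)).
by move=> w /(open_half_plane z0) w0; rewrite (ext_pos h w0) hF.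
Qed.

(** An open set is the union of the rational boxes inside it, a countable union of measurable
    rectangles. *)
Lemma locally_box_measurable (V : set (R * R)) :
  (forall p, V p -> exists2 r : R, 0 < r &
     forall q, `|q.1 - p.1| < r -> `|q.2 - p.2| < r -> V q) -> measurable V.
Proof.
move=> H.
pose box (i : (rat * rat) * (rat * rat)) : set (R * R) :=
  `](ratr i.1.1 : R), ratr i.1.2[%classic `*` `](ratr i.2.1 : R), ratr i.2.2[%classic.
have -> : V = \bigcup_i (if `[< box i `<=` V >] then box i else set0).
  apply/seteqP; split=> [[x y] /= Vp|p [i _]]; last first.
    by case: ifPn => // /asboolP; apply.
  have [r r0 Hr] := H _ Vp.
  have near_rat t : exists ab : rat * rat, [/\ (ratr ab.1 : R) < t, t < ratr ab.2,
      t - r < ratr ab.1 & ratr ab.2 < t + r].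
    have [|a] := @rat_in_itvoo R (t - r) t; first by lra.
    have [|b] := @rat_in_itvoo R t (t + r); first by lra.
    rewrite !in_itv/= => /andP[? ?] /andP[? ?]; by exists (a, b).
  have [i1 [a1 b1 c1 d1]] := near_rat x; have [i2 [a2 b2 c2 d2]] := near_rat y.
  exists (i1, i2) => //; rewrite ifT; first by rewrite /box/=; split; rewrite /= in_itv/= ?a1 ?a2.
  apply/asboolP => -[u v] [/=]; rewrite !in_itv/= => /andP[? ?] /andP[? ?].
  by apply: Hr => /=; rewrite ltr_norml; apply/andP; split; lra.
apply: countable_bigcupT_measurable => // i; case: ifPn => // _.
by apply: measurableX; exact: measurable_itv.
Qed.

(* Off the half-plane the function is constant, on it it is continuous. *)
Lemma measurable_half_plane_cont (u : R * R -> R) :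
  (forall p, p.1 <= 0 -> u p = 0) ->
  (forall p, 0 < p.1 -> forall e : R, 0 < e -> exists2 r : R, 0 < r &
     forall q, `|q.1 - p.1| < r -> `|q.2 - p.2| < r -> `|u q - u p| < e) ->
  measurable_fun setT u.
Proof.
move=> u0 cu mT; apply: (measurability _ (RGenOInfty.measurableE R)) => //.
move=> /= _ [_ [a ->] <-]; rewrite setTI.
have mH : measurable [set p : R * R | 0 < p.1].
  have := @measurable_rpart R measurableT `]0, +oo[%classic.
  rewrite setTI; set S := (_ @^-1` _); have -> : S = [set p : R * R | 0 < p.1].
    apply/seteqP; split => p; rewrite /S /rpart /= in_itv/= andbT; case: ifP => //.
    by rewrite ltxx.
  by apply; exact: measurable_itv.
pose V := [set p : R * R | 0 < p.1 /\ a < u p].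
have mV : measurable V.
  apply: locally_box_measurable => p [p0 ap].
  have ua : 0 < u p - a by rewrite subr_gt0.
  have [r r0 Hr] := cu p p0 _ ua.
  exists (Num.min r p.1); first by rewrite lt_min r0.
  move=> q; rewrite !lt_min => /andP[q1 q2] /andP[q3 q4]; split.
    by move: q2; rewrite ltr_norml => /andP[+ _]; lra.
  by have := Hr q q1 q3; rewrite ltr_norml => /andP[+ _]; lra.
have -> : u @^-1` `]a, +oo[ = V `|` (if a < 0 then ~` [set p | 0 < p.1] else set0).
  apply/seteqP; split => p /=; rewrite in_itv/= andbT.
    have [p0|p0] := ltP 0 p.1; first by move=> ap; left.
    by rewrite (u0 p p0) => a0; right; rewrite a0 /= => p1; move: p0; rewrite leNgt p1.
  move=> [[]//|]; case: ifPn => // a0 /= /negP; rewrite -leNgt => p0.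
  by rewrite (u0 p p0).
by apply: measurableU => //; case: ifP => // _; exact: measurableC.
Qed.

Lemma cmeas_half_plane (F : R[i] -> R[i]) : (forall z, Re z <= 0 -> F z = 0) ->
  (forall z, 0 < Re z -> cdiff F z) -> cmeas (fun p => F (toC p)).
Proof.
move=> F0 dF.
have H p : 0 < p.1 -> forall e : R, 0 < e -> exists2 r : R, 0 < r &
    forall q, `|q.1 - p.1| < r -> `|q.2 - p.2| < r -> N (F (toC q) - F (toC p)) < e.
  move=> p0 e e0; have [r r0 Hr] := cdiff_continuous (dF (toC p) p0) e0.
  exists (r / 2); first exact: divr_gt0.
  move=> q q1 q2; apply: Hr; apply: le_lt_trans (normc_le_ReIm _) _.
  by rewrite ReDc ReNc ImDc ImNc /=; lra.
split; apply: measurable_half_plane_cont => [p p0|p p0 e e0].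
- by rewrite F0.
- have [r r0 Hr] := H p p0 e e0; exists r => // q q1 q2.
  by apply: le_lt_trans (Hr q q1 q2); rewrite -ReNc -ReDc; exact: normc_Re.
- by rewrite F0.
- have [r r0 Hr] := H p p0 e e0; exists r => // q q1 q2.
  by apply: le_lt_trans (Hr q q1 q2); rewrite -ImNc -ImDc; exact: normc_Im.
Qed.

Lemma cmeas_ext h : analytic h -> cmeas (fun p => ext h (toC p)).
Proof. by move=> /analytic_cdiff dh; apply: cmeas_half_plane => // z; exact: ext_neg. Qed.

(** This is [pi] times the squared norm. The integral runs over the plane, as [ext h] vanishes off
    the half-plane. *)
Definition bsq l h : \bar R := (\int[area]_p (p.1 ^+ l * N (ext h (toC p)) ^+ 2)%:E)%E.

Lemma half_plane_restrict (f : R * R -> \bar R) : (forall p, p.1 <= 0 -> f p = 0%E) ->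
  (\int[area]_(p in @half_plane R) f p = \int[area]_p f p)%E.
Proof.
move=> f0; rewrite integral_mkcond; apply: eq_integral => p _.
rewrite patchE; case: ifPn => //; rewrite notin_setE /half_plane /= => /negP.
by rewrite -leNgt => /f0.
Qed.

Lemma bergman_sqnormE l h : bergman_sqnorm l h = ((pi^-1)%:E * bsq l h)%E.
Proof.
rewrite /bergman_sqnorm half_plane_restrict// => p p0.
by rewrite (ext_neg h (z := p.1 +i* p.2))// Normc.normc0 expr0n mulr0.
Qed.

Lemma bsq_ge0 l h : (0 <= bsq l h)%E.
Proof.
apply: integral_ge0 => p _; rewrite lee_fin.
have [p0|p0] := ltP 0 p.1; first by rewrite mulr_ge0 ?exprn_ge0 ?normc_ge0 ?ltW.
by rewrite ext_neg// Normc.normc0 expr0n mulr0.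
Qed.

Lemma bergmanP l h : bergman l h <-> analytic h /\ (bsq l h < +oo)%E.
Proof.
split=> -[ah hn]; split => //; move: hn; rewrite bergman_sqnormE.
  have [|] := ltP (bsq l h) +oo%E => //; rewrite leye_eq => /eqP ->.
  by rewrite gt0_muley// lte_fin invr_gt0 pi_gt0.
move=> hn; apply: lte_mul_pinfty => //; rewrite ?lee_fin ?invr_ge0 ?pi_ge0//.
Qed.

Definition dotf l h k p : R[i] :=
  (p.1 ^+ l)%:C * (ext h (toC p) * (ext k (toC p))^*).

Lemma bergman_dotE l h k : bergman_dot l h k = (pi^-1)%:C * cint area (dotf l h k).
Proof.
rewrite /bergman_dot /cint /Rintegral.
by congr (_ * (fine _ +i* fine _)); apply: half_plane_restrict => p p0;
  rewrite (ext_neg h (z := p.1 +i* p.2))//= mul0r mulr0.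
Qed.

Lemma rpart_mul (f : R * R -> R) p : (p.1 <= 0 -> f p = 0) -> rpart p * f p = f p.
Proof.
by move=> f0; rewrite /rpart; case: ltP => p0; rewrite ?mul1r// f0// mulr0.
Qed.

Lemma measurable_sq l h : analytic h ->
  measurable_fun setT (fun p => p.1 ^+ l * N (ext h (toC p)) ^+ 2).
Proof.
move=> ah; apply: measurable_funM; first exact: measurable_funX.
by apply: measurable_funX; apply: cmeas_normc; exact: cmeas_ext.
Qed.

Lemma cmeas_dotf l h k : analytic h -> analytic k -> cmeas (dotf l h k).
Proof.
move=> ah ak; apply: cmeasM; first by apply: cmeas_real; exact: measurable_funX.
by apply: cmeasM; [exact: cmeas_ext|apply: cmeas_conj; exact: cmeas_ext].
Qed.

Lemma normc_dotf_le l h k p : N (dotf l h k p) <=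
  p.1 ^+ l * N (ext h (toC p)) ^+ 2 + p.1 ^+ l * N (ext k (toC p)) ^+ 2.
Proof.
have [p0|p0] := ltP 0 p.1; last first.
  by rewrite /dotf !ext_neg// !(mul0r, mulr0) Normc.normc0 !(expr0n, mulr0) addr0.
rewrite /dotf !Normc.normcM normc_conj normc_real.
have pl : 0 <= p.1 ^+ l by rewrite exprn_ge0// ltW.
rewrite ger0_norm// -mulrDr ler_wpM2l//.
have := sqr_ge0 (N (ext h (toC p)) - N (ext k (toC p))).
have := sqr_ge0 (N (ext h (toC p))); have := sqr_ge0 (N (ext k (toC p))).
by rewrite !expr2; nra.
Qed.

Lemma cintegrable_dotf l h k : bergman l h -> bergman l k -> cintegrable area (dotf l h k).
Proof.
move=> /bergmanP[ah hn] /bergmanP[ak kn].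
have m2 := measurable_sq l; have mh := m2 _ ah; have mk := m2 _ ak.
pose G p := ((p.1 ^+ l * N (ext h (toC p)) ^+ 2)%:E + (p.1 ^+ l * N (ext k (toC p)) ^+ 2)%:E)%E.
apply: (@cintegrable_le R _ _ area (dotf l h k) G).
- exact: cmeas_dotf.
- by apply: emeasurable_funD; exact/measurable_EFinP.
- by move=> p; rewrite /G -EFinD lee_fin; exact: normc_dotf_le.
have P0 (j : Cplus R -> R[i]) p : (0 <= (p.1 ^+ l * N (ext j (toC p)) ^+ 2)%:E :> \bar R)%E.
  rewrite lee_fin; have [p0|p0] := ltP 0 p.1; first by rewrite mulr_ge0 ?exprn_ge0 ?normc_ge0 ?ltW.
  by rewrite ext_neg// Normc.normc0 expr0n mulr0.
rewrite ge0_integralD//; try exact/measurable_EFinP.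
exact: lte_add_pinfty.
Qed.

End HalfPlane.

(** * Area integrals under Moebius maps *)

Section MoebiusSubstitution.
Context {R : realType}.
Local Notation mu := (@lebesgue_measure R).
Local Notation area := ((@lebesgue_measure R) \x (@lebesgue_measure R))%E.
Implicit Types (h k f : Cplus R -> R[i]) (g : Cplus R -> Cplus R) (z w : R[i])
  (p q : R * R) (l : nat) (Q : R * R -> \bar R).

Lemma cmeas_toC : cmeas (@toC R).
Proof. by split => //=; [exact: measurable_fst|exact: measurable_snd]. Qed.

Lemma measurable_ofC d (T : measurableType d) (F : T -> R[i]) Q :
  measurable_fun setT Q -> cmeas F -> measurable_fun setT (fun t => Q (ofC (F t))).
Proof.
move=> mQ [F1 F2].
have mF : measurable_fun setT (fun t => ofC (F t)) by exact: measurable_fun_pair.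
exact: (measurableT_comp mQ mF).
Qed.

Lemma sqr_normc_toC p : N (toC p) ^+ 2 = p.1 ^+ 2 + p.2 ^+ 2.
Proof. by rewrite sqr_normcE. Qed.

Lemma toC_inversion p : toC (inversion p) = (toC p)^*^-1.
Proof.
by apply/eqP; rewrite eq_complex /inversion /toC /= sqrrN mulNr opprK !eqxx.
Qed.

(** The map is a composite of translation by [ka], inversion, reflection, multiplication by [ga] and
    translation by [de]; its Jacobian is [|ga|^2 / |z + ka|^4]. *)
Lemma integral_moebius (de ga ka : R[i]) Q : ga != 0 -> 0 <= Re ka ->
  measurable_fun setT Q -> (forall p, (0 <= Q p)%E) ->
  (\int[area]_p (Q (ofC (de + ga / (toC p + ka))%R) *
     (N ga ^+ 2 * ((N (toC p + ka) ^+ 2)^-1 ^+ 2) * rpart p)%:E)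
   <= \int[area]_p Q p)%E.
Proof.
move=> ga0 ka0 mQ Q0.
have mc (c : R[i]) : cmeas (fun _ : R * R => c) by exact: cmeas_cst.
have mw (G : R * R -> R[i]) : cmeas G ->
    measurable_fun setT (fun p => N ga ^+ 2 * ((N (G p) ^+ 2)^-1 ^+ 2)).
  move=> mG; apply: measurable_funM => //; apply: measurable_funX.
  by apply: measurable_funVr; apply: measurable_funX; exact: cmeas_normc.
have w0 z : 0 <= N ga ^+ 2 * ((N z ^+ 2)^-1 ^+ 2) by rewrite mulr_ge0// sqr_ge0.
pose F1 p := (Q (ofC (de + ga / toC p)%R) *
   (N ga ^+ 2 * ((N (toC p) ^+ 2)^-1 ^+ 2) * rpart p)%:E)%E.
have mF (G : R * R -> R[i]) : cmeas G -> measurable_fun setT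
    (fun p => Q (ofC (de + ga / G p)%R) * (N ga ^+ 2 * ((N (G p) ^+ 2)^-1 ^+ 2) * rpart p)%:E)%E.
  move=> mG; apply: emeasurable_funM.
    apply: measurable_ofC => //; apply: cmeasD => //; apply: cmeasM => //.
    exact: cmeasV.
  apply/measurable_EFinP; apply: measurable_funM; last exact: measurable_rpart.
  exact: mw.
have F10 p : (0 <= F1 p)%E.
  by rewrite mule_ge0// lee_fin mulr_ge0// rpart_ge0.
have mF1 : measurable_fun setT F1 by apply: mF; exact: cmeas_toC.
have toCD p : toC (p.1 + Re ka, p.2 + Im ka) = toC p + ka.
  by apply/eqP; rewrite eq_complex ReDc ImDc /= !eqxx.
(* Translation by [ka] maps the half-plane into itself. This inclusion, and dropping [rpart] after
   the inversion, are the only losses. *)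
apply: (@le_trans _ _ (\int[area]_p F1 (p.1 + Re ka, p.2 + Im ka)%R)%E).
  apply: ge0_le_integral => //.
  - by move=> p _; rewrite mule_ge0// lee_fin mulr_ge0// rpart_ge0.
  - by apply: mF; apply: cmeasD => //; exact: cmeas_toC.
  - apply: (measurableT_comp mF1); apply: measurable_pair; apply: measurable_funD => //.
  - move=> p _; rewrite /F1 toCD lee_wpmul2l// lee_fin ler_wpM2l//.
    by rewrite /rpart/=; case: (ltP 0 p.1) => p0; [rewrite ltr_wpDr|case: ifP].
rewrite integral_translation//.
pose Q2 (v : R * R) := Q (ofC (de + ga * (toC v)^*)).
have mQ2 : measurable_fun setT Q2.
  apply: measurable_ofC => //; apply: cmeasD => //; apply: cmeasM => //.
  by apply: cmeas_conj; exact: cmeas_toC.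
have G0 : (0 <= (N ga ^+ 2)%:E :> \bar R)%E by rewrite lee_fin sqr_ge0.
have -> : (\int[area]_p F1 p = (N ga ^+ 2)%:E * \int[area]_p (Q2 p * (rpart p)%:E))%E.
  rewrite -integral_inversion//; last by move=> p; exact: Q0.
  rewrite -ge0_integralZl//.
  - apply: eq_integral => p _; rewrite /F1.
    have EQ : Q2 (inversion p) = Q (ofC (de + ga / toC p)) by [].
    rewrite EQ.
    rewrite sqr_normc_toC -mulrA EFinM muleCA; congr (_ * _)%E.
    by rewrite EFinM muleA.
  - apply: emeasurable_funM; last by apply/measurable_EFinP; exact: measurable_rpart.
    apply: emeasurable_funM; first exact: (measurableT_comp mQ2 measurable_inversion).
    apply/measurable_EFinP; apply: measurable_funX; apply: measurable_funVr.
    by apply: measurable_funD; exact: measurable_funX.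
  - by move=> p _; rewrite !mule_ge0// ?Q0// lee_fin ?sqr_ge0// rpart_ge0.
apply: (@le_trans _ _ ((N ga ^+ 2)%:E * \int[area]_p Q2 p)%E).
  apply: lee_wpmul2l => //; apply: ge0_le_integral => //.
  - by move=> p _; rewrite mule_ge0// ?Q0// lee_fin rpart_ge0.
  - by apply: emeasurable_funM => //; apply/measurable_EFinP; exact: measurable_rpart.
  - move=> p _; rewrite -[leRHS]mule1 lee_wpmul2l ?Q0// lee_fin /rpart.
    by case: ifP.
pose Q4 p := Q (p.1 + Re de, p.2 + Im de).
have mQ4 : measurable_fun setT Q4.
  by apply: (measurableT_comp mQ); apply: measurable_pair; apply: measurable_funD.
pose Q3 p := Q4 (Re ga * p.1 - Im ga * p.2, Im ga * p.1 + Re ga * p.2).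
have mQ3 : measurable_fun setT Q3.
  apply: (measurableT_comp mQ4); apply: measurable_pair.
    by apply: measurable_funB; exact: measurable_funM.
  by apply: measurable_funD; exact: measurable_funM.
have -> : (\int[area]_p Q2 p = \int[area]_p Q3 p)%E.
  rewrite -[RHS]integral_reflection//; last by move=> p; exact: Q0.
  apply: eq_integral => p _; rewrite /Q2 /Q3 /Q4 /ofC /=; congr (Q (_, _)).
    by rewrite ReDc ReMc Re_conjc Im_conjc addrC.
  by rewrite ImDc ImMc Re_conjc Im_conjc addrC [X in X + _]addrC.
rewrite sqr_normcE integral_similarity//; last 2 first.
- by rewrite -sqr_normcE expf_neq0// normc_eq0.
- by move=> p; exact: Q0.
by rewrite integral_translation.
Qed.

End MoebiusSubstitution.

(** * Weighted composition operators and the conjugation *)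

Section WeightedSubstitution.
Context {R : realType}.
Local Notation mu := (@lebesgue_measure R).
Local Notation area := ((@lebesgue_measure R) \x (@lebesgue_measure R))%E.
Implicit Types (h k f : Cplus R -> R[i]) (g : Cplus R -> Cplus R)
  (p q : R * R) (l : nat) (Q : R * R -> \bar R).

Definition gmap g (z : R[i]) : R[i] := ext (fun w => val (g w)) z.

Lemma gmap_pos g (z : R[i]) (z0 : 0 < Re z) : gmap g z = val (g (exist _ z z0)).
Proof. by rewrite /gmap ext_pos. Qed.

Lemma Re_gmap g z : 0 < Re z -> 0 < Re (gmap g z).
Proof. by move=> z0; rewrite gmap_pos; case: (g _). Qed.

Definition Wop f g h : Cplus R -> R[i] := fun z => f z * h (g z).

Lemma ext_Wop f g h z : 0 < Re z ->
  ext (Wop f g h) z = ext f z * ext h (gmap g z).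
Proof. by move=> z0; rewrite (ext_pos _ z0) (ext_pos f z0) (gmap_pos g z0) ext_val. Qed.

Lemma analytic_Wop f g h : analytic f -> analytic (fun z => val (g z)) ->
  analytic h -> analytic (Wop f g h).
Proof.
move=> /analytic_cdiff df /analytic_cdiff dg /analytic_cdiff dh.
apply: (@analytic_of_cdiff _ _ (fun w => ext f w * ext h (gmap g w))).
  by move=> z; rewrite /gmap (ext_val (fun w => val (g w))) !ext_val.
move=> z z0; apply: cdiffM; first exact: df.
by apply: (@cdiff_comp _ (ext h) (gmap g)); [exact: dg|apply: dh; exact: Re_gmap].
Qed.

(** The measure of density [x^l |f|^2], pushed forward by [g], is at most [M] times the Bergman
    weight. It is tested on all [Q] because it serves twice: with [|h|^2] for boundedness, and with
    [|K_z|] divided by the square root of [Re w] for Schur's test. *)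
Definition bounded_change l f g (M : R) := forall Q, measurable_fun setT Q ->
  (forall p, (0 <= Q p)%E) ->
  (\int[area]_p ((p.1 ^+ l * N (ext f (toC p)) ^+ 2)%:E * Q (ofC (gmap g (toC p))))
   <= M%:E * \int[area]_p ((rpart p * p.1 ^+ l)%:E * Q p))%E.

Lemma weight_ge0 l h p : 0 <= p.1 ^+ l * N (ext h (toC p)) ^+ 2.
Proof.
have [p0|p0] := ltP 0 p.1; first by rewrite mulr_ge0 ?exprn_ge0 ?normc_ge0 ?ltW.
by rewrite ext_neg// Normc.normc0 expr0n mulr0.
Qed.

Lemma rpart_weight_ge0 l p : 0 <= rpart p * p.1 ^+ l.
Proof.
rewrite /rpart; case: ltP => p0; last by rewrite mul0r.
by rewrite mul1r exprn_ge0// ltW.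
Qed.

Lemma measurable_rpart_weight l : measurable_fun setT (fun p => rpart p * p.1 ^+ l : R).
Proof.
by apply: measurable_funM; [exact: measurable_rpart|exact: measurable_funX].
Qed.

Lemma cmeas_gmap g : analytic (fun z => val (g z)) -> cmeas (fun p => gmap g (toC p)).
Proof. exact: cmeas_ext. Qed.

Lemma bsq_Wop l f g h M : analytic f -> analytic (fun z => val (g z)) -> analytic h ->
  bounded_change l f g M -> (bsq l (Wop f g h) <= M%:E * bsq l h)%E.
Proof.
move=> af ag ah HM.
pose Q p := ((N (ext h (toC p)) ^+ 2)%:E : \bar R).
have mQ : measurable_fun setT Q.
  by apply/measurable_EFinP; apply: measurable_funX; apply: cmeas_normc; exact: cmeas_ext.
have Q0 p : (0 <= Q p)%E by rewrite lee_fin sqr_ge0.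
have := HM Q mQ Q0; congr (_ <= _ * _)%E; apply: eq_integral => p _.
  rewrite -EFinM; congr EFin; have [p0|p0] := ltP 0 p.1; last first.
    rewrite (@ext_neg _ f (toC p))// (@ext_neg _ (Wop f g h) (toC p))//.
    by rewrite Normc.normc0 expr0n !(mulr0, mul0r).
  by rewrite ext_Wop// Normc.normcM exprMn ofCK -[LHS]mulrA.
rewrite -EFinM -mulrA; congr EFin; apply: (@rpart_mul _ (fun p => p.1 ^+ l * N (ext h (toC p)) ^+ 2)).
by move=> p0; rewrite ext_neg// Normc.normc0 expr0n mulr0.
Qed.

(** The Schwarz-Pick inequality for [g(z) = de + (1 - de * ka) / (z + ka)], whose derivative has
    norm [|1 - de * ka| / |z + ka|^2]. *)
Lemma moebius_Re (de ka z : R[i]) : 0 <= Re ka -> 0 <= Re de ->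
  N (1 - de * ka) - Re (1 - de * ka) <= 2 * Re ka * Re de ->
  (Re de = 0 -> 0 <= Re (1 - de * ka)) -> 0 < Re z ->
  N (1 - de * ka) * Re z <= N (z + ka) ^+ 2 * Re (de + (1 - de * ka) / (z + ka)).
Proof.
move=> k0 d0; set ga := 1 - de * ka => H Hd z0.
have u0 : 0 < Re (z + ka) by rewrite ReDc ltr_wpDr.
have N0 : N (z + ka) ^+ 2 != 0 by rewrite expf_neq0// gt_eqF// normc_gt_Re.
rewrite ReDc ReMc ReVc ImVc mulrDr.
have -> : N (z + ka) ^+ 2 * (Re ga * (Re (z + ka) / N (z + ka) ^+ 2) -
    Im ga * (- Im (z + ka) / N (z + ka) ^+ 2)) = Re ga * Re (z + ka) + Im ga * Im (z + ka).
  by field; move: N0; rewrite expf_eq0.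
rewrite sqr_normcE ReDc ImDc; set y := Im z + Im ka; set x := Re z in z0 *.
set k := Re ka in k0 H *; set d := Re de in d0 H Hd *.
have G2 := sqr_normcE ga; have G0 := normc_ge0 ga.
set G := N ga in H G2 G0 *; set a := Re ga in H Hd G2 *; set b := Im ga in G2 *.
rewrite !expr2 in G2 *.
have [dd|dd] := ltP 0 d.
  (* The difference of the two sides is [d x^2 + (2 d k + a - G) x] plus this value at [x = 0].
     Multiplied by [4 d] the latter becomes a square in [y] plus [(2 d k + a)^2 - G^2]. *)
  suff : 0 <= d * k * k + d * y * y + a * k + b * y by nra.
  have : 0 <= 4 * d * (d * k * k + d * y * y + a * k + b * y).
    have -> : 4 * d * (d * k * k + d * y * y + a * k + b * y) =
      (2 * d * y + b) ^+ 2 + ((2 * d * k + a) ^+ 2 - (a * a + b * b)) by ring.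
    rewrite -G2; apply: addr_ge0; first exact: sqr_ge0.
    have : G <= 2 * d * k + a by lra.
    move: (2 * d * k + a) => s Gs; rewrite expr2; nra.
  by rewrite pmulr_rge0// mulr_gt0.
have d00 : d = 0 by apply/le_anti; rewrite dd d0.
have a0 := Hd d00; rewrite d00 mulr0 in H.
have Ga : G = a by apply/le_anti/andP; split; [lra|have := normc_Re ga; rewrite ger0_norm].
have b0 : b = 0 by apply/eqP; rewrite -sqrf_eq0 expr2; apply/eqP; rewrite Ga in G2; lra.
rewrite d00 b0 Ga !mul0r; have : 0 <= a * k by rewrite mulr_ge0.
by lra.
Qed.

(** In [|f|^2 = |r|^2 / |z + ka|^(2 l + 4)] four powers of [|z + ka|] belong to the Jacobian. The
    remaining [2 l] turn [x^l] into the weight at [g z], by the [l]-th power of the Schwarz-Pick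
    inequality. *)
Lemma moebius_bounded_change l f g (de ka r : R[i]) : analytic f ->
  analytic (fun z => val (g z)) -> 1 - de * ka != 0 -> 0 <= Re ka ->
  (forall z, 0 < Re z -> N (1 - de * ka) * Re z <= N (z + ka) ^+ 2 * Re (de + (1 - de * ka) / (z + ka))) ->
  (forall w : Cplus R, val (g w) = de + (1 - de * ka) / (val w + ka) /\
     f w = r / (val w + ka) ^+ (l + 2)) ->
  bounded_change l f g (N r ^+ 2 / N (1 - de * ka) ^+ (l + 2)).
Proof.
set ga := 1 - de * ka => af ag ga0 k0 geo fg Q mQ Q0.
have Ng0 : 0 < N ga by rewrite normc_gt0.
have mc (c : R[i]) : cmeas (fun _ : R * R => c) by exact: cmeas_cst.
have mu0 : cmeas (fun p : R * R => toC p + ka) by apply: cmeasD => //; exact: cmeas_toC.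
pose Q' p := ((rpart p * p.1 ^+ l)%:E * Q p)%E.
have mQ' : measurable_fun setT Q'.
  by apply: emeasurable_funM => //; apply/measurable_EFinP; exact: measurable_rpart_weight.
have Q'0 p : (0 <= Q' p)%E by rewrite mule_ge0// lee_fin rpart_weight_ge0.
pose gg p := ofC (de + ga / (toC p + ka)).
have mgg : cmeas (fun p : R * R => de + ga / (toC p + ka)).
  by apply: cmeasD => //; apply: cmeasM => //; exact: cmeasV.
have mT : measurable_fun setT (fun p : R * R => N ga ^+ 2 * ((N (toC p + ka) ^+ 2)^-1 ^+ 2) * rpart p).
  apply: measurable_funM; last exact: measurable_rpart.
  apply: measurable_funM => //; apply: measurable_funX; apply: measurable_funVr.
  by apply: measurable_funX; exact: cmeas_normc.
have T0 p : 0 <= N ga ^+ 2 * ((N (toC p + ka) ^+ 2)^-1 ^+ 2) * rpart p.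
  by rewrite mulr_ge0 ?rpart_ge0// mulr_ge0// sqr_ge0.
set M := N r ^+ 2 / N ga ^+ (l + 2).
have M0 : 0 <= M by rewrite divr_ge0 ?sqr_ge0 ?exprn_ge0 ?normc_ge0.
apply: (@le_trans _ _ (M%:E * \int[area]_p (Q' (gg p) *
     (N ga ^+ 2 * ((N (toC p + ka) ^+ 2)^-1 ^+ 2) * rpart p)%:E))%E); last first.
  by apply: lee_wpmul2l; [rewrite lee_fin|exact: integral_moebius].
have mR : measurable_fun setT (fun p => Q' (gg p) *
     (N ga ^+ 2 * ((N (toC p + ka) ^+ 2)^-1 ^+ 2) * rpart p)%:E)%E.
  by apply: emeasurable_funM; [exact: measurable_ofC|exact/measurable_EFinP].
rewrite -ge0_integralZl//; last by move=> p _; rewrite mule_ge0// lee_fin.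
apply: ge0_le_integral => //.
- by move=> p _; rewrite mule_ge0// lee_fin weight_ge0.
- apply: emeasurable_funM; last by apply: measurable_ofC => //; exact: cmeas_gmap.
  by apply/measurable_EFinP; exact: measurable_sq.
- exact: emeasurable_funM.
move=> p _; have [p0|p0] := ltP 0 p.1; last first.
  by rewrite (@ext_neg _ f (toC p))// Normc.normc0 expr0n mulr0 mul0e mule_ge0// mule_ge0// lee_fin.
have Re0 : 0 < Re (toC p) by [].
have [gE fE] := fg (exist _ (toC p) Re0).
have GE : gmap g (toC p) = de + ga / (toC p + ka) by rewrite (gmap_pos g Re0) gE.
have Rg : 0 < Re (de + ga / (toC p + ka)) by rewrite -GE; exact: Re_gmap.
have u0 : 0 < Re (toC p + ka) by rewrite ReDc ltr_wpDr.
have Nu := normc_gt_Re u0.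
rewrite GE -/(gg p) (ext_pos f Re0) fE /= /Q' /rpart p0 Rg mul1r mulr1.
rewrite [X in (_ <= _ * X)%E]muleAC -EFinM muleA -EFinM.
apply: lee_wpmul2r => //; rewrite lee_fin.
rewrite Normc.normcM Normc.normcV normcX.
have := geo _ Re0; rewrite -/ga; set v := Re (de + _); set U := N (toC p + ka) in Nu *.
move=> H; have {}H : (N ga * p.1) ^+ l <= (U ^+ 2 * v) ^+ l.
  apply: lerXn2r => //; rewrite ?nnegrE ?mulr_ge0 ?exprn_ge0 ?normc_ge0 ?ltW//.
have Ul : U ^+ l != 0 by rewrite expf_neq0// gt_eqF.
have U2l : (U ^+ 2) ^+ l = (U ^+ l) ^+ 2 by rewrite -!exprM mulnC.
have gl : N ga ^+ l != 0 by rewrite expf_neq0// gt_eqF.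
have -> : p.1 ^+ l * (N r / U ^+ (l + 2)) ^+ 2 =
    (N ga * p.1) ^+ l * (N r ^+ 2 / ((U ^+ 2) ^+ l * N ga ^+ l * U ^+ 4)).
  rewrite U2l [(N ga * _) ^+ l]exprMn exprD.
  by move: (U ^+ l) (N ga ^+ l) Ul gl => a b a0 b0; field; rewrite a0 b0 gt_eqF.
have -> : M * (v ^+ l * (N ga ^+ 2 * (U ^+ 2)^-1 ^+ 2)) =
    (U ^+ 2 * v) ^+ l * (N r ^+ 2 / ((U ^+ 2) ^+ l * N ga ^+ l * U ^+ 4)).
  rewrite /M [(U ^+ 2 * v) ^+ l]exprMn !U2l exprD.
  move: (U ^+ l) (N ga ^+ l) Ul gl => a b a0 b0; field.
  by rewrite a0 b0 !gt_eqF.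
apply: ler_wpM2r => //; rewrite divr_ge0 ?sqr_ge0// !mulr_ge0// ?exprn_ge0// ?exprn_ge0 ?ltW//.
Qed.

Lemma dilation_bounded_change l f g (la : R) (th : R[i]) : analytic f ->
  analytic (fun z => val (g z)) -> 0 < la ->
  (forall w : Cplus R, val (g w) = la%:C * val w /\ f w = th) ->
  bounded_change l f g (N th ^+ 2 / la ^+ (l + 2)).
Proof.
move=> af ag la0 fg Q mQ Q0.
pose Q' p := ((rpart p * p.1 ^+ l)%:E * Q p)%E.
have mQ' : measurable_fun setT Q'.
  by apply: emeasurable_funM => //; apply/measurable_EFinP; exact: measurable_rpart_weight.
have Q'0 p : (0 <= Q' p)%E by rewrite mule_ge0// lee_fin rpart_weight_ge0.
set M := N th ^+ 2 / la ^+ (l + 2).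
have M0 : 0 <= M by rewrite divr_ge0 ?sqr_ge0 ?exprn_ge0 ?ltW.
have la2 : la ^+ 2 + 0 ^+ 2 != 0 by rewrite expr0n addr0 expf_neq0// gt_eqF.
rewrite -(integral_similarity la2 mQ' Q'0) expr0n addr0.
have mD : measurable_fun setT (fun p : R * R => Q' (la * p.1 - 0 * p.2, 0 * p.1 + la * p.2)).
  apply: (measurableT_comp mQ'); apply: measurable_pair.
    by apply: measurable_funB; exact: measurable_funM.
  by apply: measurable_funD; exact: measurable_funM.
rewrite muleA -EFinM -ge0_integralZl//; last first.
  by rewrite lee_fin mulr_ge0 ?sqr_ge0.
apply: ge0_le_integral => //.
- by move=> p _; rewrite mule_ge0// lee_fin weight_ge0.
- apply: emeasurable_funM; last by apply: measurable_ofC => //; exact: cmeas_gmap.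
  by apply/measurable_EFinP; exact: measurable_sq.
- exact: emeasurable_funM.
move=> p _; have [p0|p0] := ltP 0 p.1; last first.
  rewrite (@ext_neg _ f (toC p))// Normc.normc0 expr0n mulr0 mul0e mule_ge0//.
  by rewrite lee_fin mulr_ge0 ?sqr_ge0.
have Re0 : 0 < Re (toC p) by [].
have [gE fE] := fg (exist _ (toC p) Re0).
have GE : ofC (gmap g (toC p)) = (la * p.1 - 0 * p.2, 0 * p.1 + la * p.2).
  by rewrite (gmap_pos g Re0) gE /ofC ReMc ImMc /= [X in (_, X)]addrC.
rewrite GE (ext_pos f Re0) fE /Q' !mul0r subr0 add0r /rpart /= mulr_gt0// mul1r.
rewrite muleA -EFinM; apply: lee_wpmul2r => //; rewrite lee_fin.
suff -> : p.1 ^+ l * N th ^+ 2 = M * la ^+ 2 * (la * p.1) ^+ l by [].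
by rewrite /M exprMn exprD; field; rewrite expf_neq0 ?gt_eqF.
Qed.

(** Inversion has Jacobian [|z|^-4] and turns [Re z] into [Re z / |z|^2]. Together these give
    [|z|^(-2 l - 4)], which explains the exponent [l + 2] in [C_star]. *)
Lemma bsq_C_star l h : analytic h -> bsq l (C_star l h) = bsq l h.
Proof.
move=> ah; pose Q p := (p.1 ^+ l * N (ext h (toC p)) ^+ 2)%:E.
have mQ : measurable_fun setT Q by apply/measurable_EFinP; exact: measurable_sq.
have Q0 p : (0 <= Q p)%E by rewrite lee_fin weight_ge0.
have -> : bsq l h = (\int[area]_p (Q p * (rpart p)%:E))%E.
  apply: eq_integral => p _; rewrite -EFinM [in RHS]mulrC; congr EFin.
  apply/esym/(@rpart_mul _ (fun p => p.1 ^+ l * N (ext h (toC p)) ^+ 2)) => p0.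
  by rewrite ext_neg// Normc.normc0 expr0n mulr0.
rewrite -integral_inversion//; apply: eq_integral => p _.
have [p0|p0] := ltP 0 p.1; last first.
  rewrite (@ext_neg _ _ (toC p))// Normc.normc0 expr0n mulr0 /rpart [0 < p.1]ltNge p0.
  by rewrite mule0.
have Re0 : 0 < Re (toC p) by [].
rewrite /rpart p0 mule1 /Q -EFinM; congr EFin.
rewrite (ext_pos _ Re0) /C_star Normc.normcM Normc.normcV normcX normc_conj.
rewrite toC_inversion.
have -> : ext h (((toC p)^*)^-1) = h (inv_conj (exist _ (toC p) Re0)).
  by rewrite -ext_val.
have -> : (inversion p).1 = p.1 / N (toC p) ^+ 2 by rewrite sqr_normc_toC.
rewrite -sqr_normc_toC.
have := normc_gt_Re Re0; set U := N (toC p) => U0.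
have Ul : U ^+ l != 0 by rewrite expf_neq0// gt_eqF.
have U2l : (U ^+ 2) ^+ l = (U ^+ l) ^+ 2 by rewrite -!exprM mulnC.
rewrite exprMn [(p.1 / _) ^+ l]exprMn [(U ^+ 2)^-1 ^+ l]exprVn U2l exprD.
by move: (U ^+ l) Ul => a a0; field; rewrite a0 gt_eqF.
Qed.

Lemma analytic_C_star l h : analytic h -> analytic (C_star l h).
Proof.
move=> /analytic_cdiff dh.
apply: (@analytic_of_cdiff _ _ (fun w => (w ^+ (l + 2))^-1 * (ext h ((w^*)^-1))^*)).
  by move=> z; rewrite /C_star -(ext_val h (inv_conj z)).
move=> z z0; apply: cdiffM.
  by apply: cdiffV; [rewrite expf_neq0// Re_neq0|apply: cdiffX; exact: cdiff_id].
apply: (@cdiff_reflect _ (fun w => ext h (w^-1))).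
have z1 : 0 < Re z^* by rewrite Re_conjc.
apply: (@cdiff_comp _ (ext h) (fun w => w^-1)).
  by apply: cdiffV; [exact: Re_neq0|exact: cdiff_id].
by apply: dh; rewrite ReVc divr_gt0// exprn_gt0// normc_gt_Re.
Qed.

Lemma bergman_C_star l h : bergman l h -> bergman l (C_star l h).
Proof.
move=> /bergmanP[ah hn]; apply/bergmanP; split; first exact: analytic_C_star.
by rewrite bsq_C_star.
Qed.

Lemma inv_conjK : involutive (@inv_conj R).
Proof. by move=> z; apply: val_inj; rewrite /inv_conj/= fmorphV/= conjCK invrK. Qed.

Lemma C_starK l h : C_star l (C_star l h) = h.
Proof.
apply/funext => z; rewrite /C_star inv_conjK rmorphM/= conjCK fmorphV rmorphXn/=.
rewrite /inv_conj/= fmorphV/= conjCK exprVn invrK mulrA mulVf ?mul1r//.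
by rewrite expf_neq0// Re_neq0//; case: z.
Qed.

End WeightedSubstitution.

(** * Integrals along vertical lines *)

Section Lines.
Context {R : realType}.
Local Notation mu := (@lebesgue_measure R).
Local Notation area := ((@lebesgue_measure R) \x (@lebesgue_measure R))%E.

(** An integrable function need not tend to 0, but it takes small values arbitrarily far out. That
    is enough to select contours. *)
Lemma small_value (f : R -> \bar R) (M e : R) : measurable_fun setT f ->
  (forall x, (0 <= f x)%E) -> (\int[mu]_x f x < +oo)%E -> 0 < e ->
  exists2 x, M < x & (f x < e%:E)%E.
Proof.
move=> mf f0 fi e0; apply: contrapT => H.
have Hf x : M < x -> (e%:E <= f x)%E.
  by move=> Mx; rewrite leNgt; apply/negP => fe; apply: H; exists x.
have : (\int[mu]_(x in `]M, +oo[) (cst e%:E) x <= \int[mu]_x f x)%E.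
  apply: (@le_trans _ _ (\int[mu]_(x in `]M, +oo[) f x)%E).
    apply: ge0_le_integral => //.
    - by move=> x _; rewrite lee_fin ltW.
    - exact: measurable_funTS.
    - by move=> x; rewrite /= in_itv/= andbT; exact: Hf.
  exact: ge0_subset_integral.
rewrite integral_cst// [X in (_ * X)%E]lebesgue_measure_itv/= ltry addye// gt0_muley ?lte_fin//.
by rewrite leye_eq => /eqP E; rewrite E in fi.
Qed.

Lemma rint_tail (q : R -> R) e : mu.-integrable setT (EFin \o q) -> 0 < e ->
  exists M, forall T, M <= T -> `|rint q (- T) T - \int[mu]_x q x| <= e.
Proof.
move=> qi e0.
have qn : mu.-integrable setT (EFin \o (fun x => `|q x|)) by exact: (integrable_norm qi).
have mqn : measurable_fun setT (EFin \o (fun x => `|q x|)) := measurable_int _ qn.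
pose F (n : nat) : set R := `[- n%:R, n%:R]%classic.
have nF : nondecreasing_seq F.
  move=> m n mn; apply/subsetPset => x; rewrite /F /= !in_itv/= => /andP[x1 x2].
  have nm : (m%:R : R) <= n%:R by rewrite ler_nat.
  by apply/andP; split; lra.
have mF n : measurable (F n) by exact: measurable_itv.
have FT : \bigcup_n F n = setT.
  apply/seteqP; split => // x _; exists (Num.bound x) => //; rewrite /F /= in_itv/=.
  have := archi_boundP (normr_ge0 x); rewrite -ler_norml => /ltW xb.
  by rewrite (le_trans xb)// ler_nat; rewrite /Num.bound normr_id.
have cvgF : (\int[mu]_(x in F n) (`|q x|)%:E @[n --> \oo] -->
    \int[mu]_(x in \bigcup_n F n) (`|q x|)%:E)%E.
  apply: ge0_nondecreasing_set_cvg_integral => //.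
  by move=> n; exact: measurable_funTS.
rewrite FT in cvgF.
have I0 : (\int[mu]_x (`|q x|)%:E)%E = (\int[mu]_x `|q x|)%:E.
  by rewrite /Rintegral fineK//; exact: integrable_fin_num.
rewrite I0 in cvgF; have /fine_cvg/cvgrPdist_lt/(_ e e0)[n _ /(_ n (leqnn n)) Hn] := cvgF.
exists n%:R => T nT.
pose A : set R := `[- T, T]%classic.
have mA : measurable A by exact: measurable_itv.
have FA : F n `<=` A.
  move=> x; rewrite /F /A /= !in_itv/= => /andP[x1 x2].
  by apply/andP; split; lra.
have qnS B : measurable B -> mu.-integrable B (EFin \o (fun x => `|q x|)).
  by move=> mB; apply: integrableS qn.
have qS B : measurable B -> mu.-integrable B (EFin \o q).
  by move=> mB; apply: integrableS qi.
have spl (f : R -> R) : mu.-integrable setT (EFin \o f) ->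
    \int[mu]_x f x = \int[mu]_(x in A) f x + \int[mu]_(x in ~` A) f x.
  move=> fi; rewrite -(setUv A) Rintegral_setU//; first exact: measurableC.
    by rewrite setUv.
  by apply/disj_setPS => x [? ?].
rewrite (spl q qi) opprD addrA /rint -/A subrr add0r normrN.
have mCA : measurable (~` A) by exact: measurableC.
apply: (@le_trans _ _ (\int[mu]_(x in ~` A) `|q x|)).
  by apply: le_normr_Rintegral => //; exact: qS.
have le1 : \int[mu]_(x in F n) `|q x| <= \int[mu]_(x in A) `|q x|.
  rewrite -lee_fin /Rintegral !fineK.
  - by apply: ge0_subset_integral => //; [exact: mF|exact: measurable_int (qnS _ mA)].
  - by apply: integrable_fin_num; [exact: mA|apply: qnS; exact: mA].
  - by apply: integrable_fin_num; [exact: mF|apply: qnS; exact: mF].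
have := spl _ qn; move: Hn => /=; rewrite ltr_norml => /andP[_].
rewrite -[fine _]/(\int[mu]_(x in F n) `|q x|).
move: le1; set a := \int[mu]_(x in F n) _; set b := \int[mu]_(x in A) _.
set c := \int[mu]_x _; set d := \int[mu]_(x in ~` A) _.
by lra.
Qed.

(** Convergence of the truncated integrals comes from integrability of [q]. Hence the limit is
    identified as soon as the bound [E] is small for arbitrarily large [T]. *)
Lemma line_limit (q : R -> R) (k : R) (E : R -> \bar R) (T0 : R) :
  mu.-integrable setT (EFin \o q) -> measurable_fun setT E ->
  (forall x, (0 <= E x)%E) -> (\int[mu]_x E x < +oo)%E ->
  (forall T, T0 < T -> ((`|rint q (- T) T - k|)%:E <= E T)%E) ->
  \int[mu]_x q x = k.
Proof.
move=> qi mE E0 Ei H; apply/eqP; rewrite -subr_eq0 -normr_le0.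
apply/ler_addgt0Pr => e e0; rewrite add0r.
have e2 : 0 < e / 2 by rewrite divr_gt0.
have [M HM] := rint_tail qi e2.
have [T MT ET] := small_value (Num.max M T0) mE E0 Ei e2.
move: MT; rewrite gt_max => /andP[MT T0T].
have := HM T (ltW MT); have := le_lt_trans (H T T0T) ET.
rewrite lte_fin !ltr_norml !ler_norml => /andP[? ?] /andP[? ?].
by apply/andP; split; lra.
Qed.

Lemma cint_eq_im_re (F G : R -> R[i]) (K : R[i]) : cintegrable mu F -> cintegrable mu G ->
  \int[mu]_y (Re (F y) - Re (G y)) = Re K ->
  \int[mu]_y (- Im (F y) - - Im (G y)) = - Im K -> cint mu F - cint mu G = K.
Proof.
move=> iF iG H1 H2; rewrite -cintB//; apply/eqP; rewrite eq_complex /cint/=.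
apply/andP; split; apply/eqP.
  by rewrite -H1; apply: eq_Rintegral => y _; rewrite ReDc ReNc.
rewrite -[Im K]opprK -H2 -mulN1r -RintegralZl//; last first.
  case: iF => _ iF; case: iG => _ iG.
  have := integrableB measurableT (integrableN iF) (integrableN iG).
  by apply: eq_integrable => // y _ /=.
by apply: eq_Rintegral => y _; rewrite ImDc ImNc; ring.
Qed.

Definition strip (x1 x2 T0 : R) (p : R * R) : R :=
  if (x1 <= p.1 <= x2) && (T0 <= `|p.2|) then 1 else 0.

Lemma measurable_strip x1 x2 T0 : measurable_fun setT (strip x1 x2 T0).
Proof.
apply: measurable_fun_ifT => //; apply: measurable_and.
  by apply: measurable_and; exact: measurable_fun_ler.
by apply: measurable_fun_ler => //; exact: measurableT_comp.
Qed.

(** The tall rectangles all have contour integral [i K]. Integrability of [Phi] over the strip makes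
    the contribution of the horizontal sides an integrable function of the height [T]. The threshold
    [T0] leaves room for a pole between the lines. *)
Lemma line_shift (Phi : R[i] -> R[i]) (x1 x2 T0 : R) (K : R[i]) :
  x1 < x2 -> 0 <= T0 ->
  measurable_fun setT (fun p => strip x1 x2 T0 p * N (Phi (toC p))) ->
  (\int[area]_p (strip x1 x2 T0 p * N (Phi (toC p)))%:E < +oo)%E ->
  cintegrable mu (fun y => Phi (x1 +i* y)) -> cintegrable mu (fun y => Phi (x2 +i* y)) ->
  (forall x y, x1 <= x <= x2 -> T0 < `|y| -> cdiff Phi (x +i* y)) ->
  (forall T, T0 < T -> re_circ Phi x1 x2 (- T) T = - Im K /\
     im_circ Phi x1 x2 (- T) T = Re K) ->
  cint mu (fun y => Phi (x2 +i* y)) - cint mu (fun y => Phi (x1 +i* y)) = K.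
Proof.
move=> x12 T00 mG iG i1 i2 dPhi HK.
pose G p : \bar R := (strip x1 x2 T0 p * N (Phi (toC p)))%:E.
have mEG : measurable_fun setT G by exact/measurable_EFinP.
have G0 p : (0 <= G p)%E.
  by rewrite lee_fin mulr_ge0 ?normc_ge0// /strip; case: ifP.
have mneg : measurable_fun setT (fun p : R * R => (p.1, - p.2)).
  by apply: measurable_pair => //; exact: measurable_funN.
pose E T : \bar R := (\int[mu]_x (G (x, - T)%R + G (x, T)))%E.
have mGG : measurable_fun setT (fun p : R * R => G (p.1, - p.2)%R + G (p.1, p.2))%E.
  apply: emeasurable_funD; first exact: (measurableT_comp mEG mneg).
  by apply: (measurableT_comp mEG); exact: measurable_pair.
have mE : measurable_fun setT E.
  apply: (measurable_integral1 mu (G := fun (x T : R) => G (x, - T)%R + G (x, T))%E) => //.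
  by move=> x y; rewrite adde_ge0.
have E0 T : (0 <= E T)%E by apply: integral_ge0 => x _; rewrite adde_ge0.
have Ei : (\int[mu]_T E T < +oo)%E.
  rewrite -(@integral_prod2 _ _ _ _ _ mu mu (fun p : R * R => G (p.1, - p.2)%R + G (p.1, p.2))%E)//; last first.
    by move=> p; rewrite adde_ge0.
  rewrite ge0_integralD//; last exact: (measurableT_comp mEG mneg).
  rewrite integral_reflection//.
  have -> : (\int[area]_p G (p.1, p.2) = \int[area]_p G p)%E.
    by apply: eq_integral => -[].
  exact: lte_add_pinfty.
have bnd (u : R[i] -> R) T : T0 < T -> (forall z, `|u z| <= N z) ->
    cont_on (fun x => u (Phi (x +i* - T)) - u (Phi (x +i* T))) x1 x2 ->
    ((`|rint (fun x => u (Phi (x +i* - T)) - u (Phi (x +i* T))) x1 x2|)%:E <= E T)%E.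
  move=> T0T uN cu.
  have ui := cont_on_integrable cu.
  rewrite /rint EFin_normr_Rintegral//.
  apply: le_trans (le_abse_integral _ _ _) _ => //; first exact: measurable_int ui.
  have mGx : measurable_fun setT (fun x : R => G (x, - T)%R + G (x, T))%E.
    have mp : measurable_fun setT (fun x : R => (x, T)) by exact: measurable_fun_pair.
    exact: (measurableT_comp mGG mp).
  apply: (@le_trans _ _ (\int[mu]_(x in `[x1, x2]) (G (x, - T)%R + G (x, T)))%E).
    apply: ge0_le_integral => //.
    - by apply: measurableT_comp => //; exact: measurable_int ui.
    - exact: measurable_funTS.
    - move=> x; rewrite /= in_itv/= => xx; rewrite /G /strip /= xx normrN.
      rewrite (ger0_norm (le_trans T00 (ltW T0T))) (ltW T0T) !mul1r.
      rewrite lee_fin; apply: le_trans (ler_normB _ _) _; exact: lerD.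
  apply: ge0_subset_integral => //.
  by move=> x _; rewrite adde_ge0.
have cP T : T0 < `|T| -> ccont_on (fun x => Phi (x +i* T)) x1 x2.
  by move=> T0T; apply: cdiff_ccont_hor => x xx; exact: dPhi.
have absT T : T0 < T -> T0 < `|T| /\ T0 < `|- T|.
  by move=> T0T; rewrite normrN ger0_norm// (le_trans T00)// ltW.
case: (i1) => i1r i1i; case: (i2) => i2r i2i.
apply: cint_eq_im_re => //.
- apply: (@line_limit _ _ E T0) => //.
    exact: (integrableB measurableT i2r i1r).
  move=> T T0T; have [_ <-] := HK T T0T; have [T1 T2] := absT T T0T.
  rewrite /im_circ /circulation opprD addrCA subrr addr0 normrN.
  apply: (bnd (@complex.Im R)) => //; first exact: normc_Im.
  by apply: cont_onB; [have [] := cP _ T2|have [] := cP _ T1].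
- apply: (@line_limit _ _ E T0) => //.
    have := integrableB measurableT (integrableN i2i) (integrableN i1i).
    by apply: eq_integrable => // y _ /=.
  move=> T T0T; have [<- _] := HK T T0T; have [T1 T2] := absT T T0T.
  rewrite /re_circ /circulation opprD addrCA subrr addr0 normrN.
  apply: (bnd (@complex.Re R)) => //; first exact: normc_Re.
  by apply: cont_onB; [have [] := cP _ T2|have [] := cP _ T1].
Qed.

Definition lorentz (m b y : R) : R := (m ^+ 2 + (y - b) ^+ 2)^-1.

Lemma lorentz_ge0 m b y : 0 <= lorentz m b y.
Proof. by rewrite invr_ge0 addr_ge0 ?sqr_ge0. Qed.

Lemma measurable_lorentz m b : measurable_fun setT (lorentz m b).
Proof.
apply: measurable_funVr; apply: measurable_funD => //.
by apply: measurable_funX; apply: measurable_funB.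
Qed.

Lemma integral_lorentz m b : 0 < m ->
  (\int[mu]_y (lorentz m b y)%:E = (pi / m)%:E)%E.
Proof.
move=> m0; have m1 : m != 0 by rewrite gt_eqF.
rewrite -(@integral_affine _ m b)//; last 2 first.
- by apply/measurable_EFinP; exact: measurable_lorentz.
- by move=> y; rewrite lee_fin lorentz_ge0.
rewrite gtr0_norm//.
transitivity (m%:E * \int[mu]_y ((m ^+ 2)^-1%:E * ((oneDsqr y)^-1)%:E))%E.
  congr (_ * _)%E; apply: eq_integral => y _; rewrite -EFinM; congr EFin.
  rewrite /lorentz /oneDsqr addrK; field.
  have h1 : 1 + y ^+ 2 != 0 by rewrite gt_eqF// ltr_pwDl ?sqr_ge0.
  have h2 : m ^+ 2 + (m * y) ^+ 2 != 0.
    by rewrite gt_eqF// ltr_pwDl ?sqr_ge0// exprn_gt0.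
  by rewrite h1 m1 h2.
have mo : measurable_fun setT (fun y : R => ((oneDsqr y)^-1)%:E).
  by apply/measurable_EFinP; apply: measurable_funVr; apply: measurable_funD => //; exact: measurable_funX.
have o0 y : (0 <= ((oneDsqr y)^-1)%:E :> \bar R)%E by rewrite lee_fin invr_ge0.
rewrite ge0_integralZl//; last by rewrite lee_fin invr_ge0 sqr_ge0.
rewrite ge0_symfun_integralT//; last 2 first.
- exact: continuous_oneDsqrV.
- by move=> y; rewrite /= /oneDsqr sqrrN.
rewrite -set_itvcy integral0y_oneDsqr -!EFinM; congr EFin.
by field.
Qed.

End Lines.

(** * Bergman functions on vertical lines *)

Section VerticalLines.
Context {R : realType}.
Local Notation mu := (@lebesgue_measure R).
Local Notation area := ((@lebesgue_measure R) \x (@lebesgue_measure R))%E.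
Variables (l : nat) (h : Cplus R -> R[i]).
Hypothesis bh : bergman l h.

Let ah : analytic h. Proof. by have /bergmanP[] := bh. Qed.
Let hfin : (bsq l h < +oo)%E. Proof. by have /bergmanP[] := bh. Qed.
Let mh : cmeas (fun p : R * R => ext h (toC p)). Proof. exact: cmeas_ext. Qed.

Lemma cmeas_line (F : R[i] -> R[i]) (x : R) : cmeas (fun p : R * R => F (toC p)) ->
  cmeas (fun y : R => F (x +i* y)).
Proof.
move=> [F1 F2].
have mp : measurable_fun setT (fun y : R => (x, y)) by exact: measurable_fun_pair.
by split; [exact: (measurableT_comp F1 mp)|exact: (measurableT_comp F2 mp)].
Qed.

Definition line_sq (x : R) : \bar R := (\int[mu]_y (N (ext h (x +i* y)) ^+ 2)%:E)%E.

(** Lines along which the contour integrals are known to converge; by Tonelli almost every line in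
    the half-plane is one. *)
Definition good_line x := 0 < x /\ (line_sq x < +oo)%E.

Let wline (x : R) : \bar R := (\int[mu]_y (x ^+ l * N (ext h (x +i* y)) ^+ 2)%:E)%E.

Let mw : measurable_fun setT (fun p : R * R => (p.1 ^+ l * N (ext h (toC p)) ^+ 2)%:E).
Proof. by apply/measurable_EFinP; exact: measurable_sq. Qed.

Let wline_ge0 x : (0 <= wline x)%E.
Proof. by apply: integral_ge0 => y _; rewrite lee_fin (weight_ge0 l h (x, y)). Qed.

Let measurable_wline : measurable_fun setT wline.
Proof.
apply: (measurable_integral2 mu (G := fun x y : R => (x ^+ l * N (ext h (x +i* y)) ^+ 2)%:E)) => //.
by move=> x y; rewrite lee_fin (weight_ge0 l h (x, y)).
Qed.

Let wline_lty : (\int[mu]_x wline x < +oo)%E.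
Proof.
rewrite -(@integral_prod1 _ _ _ _ _ mu mu (fun p : R * R => (p.1 ^+ l * N (ext h (toC p)) ^+ 2)%:E))//.
by move=> p; rewrite lee_fin weight_ge0.
Qed.

Let mline x : measurable_fun setT (fun y : R => (N (ext h (x +i* y)) ^+ 2)%:E).
Proof.
by apply/measurable_EFinP; apply: measurable_funX; apply: cmeas_normc; exact: cmeas_line.
Qed.

Let wlineE x : 0 < x -> wline x = ((x ^+ l)%:E * line_sq x)%E.
Proof.
move=> x0; rewrite /wline -ge0_integralZl//.
- exact: mline.
- by move=> y _; rewrite lee_fin sqr_ge0.
- by rewrite lee_fin exprn_ge0// ltW.
Qed.

Lemma ae_good_line : {ae mu, forall x, 0 < x -> good_line x}.
Proof.
have iw : mu.-integrable setT wline.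
  apply/integrableP; split => //; apply: le_lt_trans wline_lty.
  by under eq_integral => x _ do rewrite gee0_abs//.
apply: filterS (integrable_ae measurableT iw) => x /(_ I) wx x0; split => //.
move: wx; rewrite wlineE//.
have : (0 <= line_sq x)%E by apply: integral_ge0 => y _; rewrite lee_fin sqr_ge0.
case: (line_sq x) => [r _ _||//]; first exact: ltry.
by move=> _; rewrite gt0_muley// lte_fin exprn_gt0.
Qed.

Lemma exists_good_line a : 0 < a -> exists2 x, good_line x & x < a.
Proof.
move=> a0; apply: contrapT => H.
have [B [mB B0 NB]] := ae_good_line.
have sB : `]0, a[%classic `<=` B.
  move=> x /=; rewrite in_itv/= => /andP[x0 xa]; apply: NB => /= gx.
  by apply: H; exists x => //; exact: gx.
have : (mu `]0%R, a[%classic <= mu B)%E by apply: le_measure; rewrite ?inE.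
rewrite B0 [X in (X <= _)%E]lebesgue_measure_itv/= lte_fin a0 oppr0 adde0 lee_fin.
by rewrite leNgt a0.
Qed.

Lemma exists_small_line M e : 0 < e ->
  exists2 x, M < x & good_line x /\ (line_sq x < e%:E)%E.
Proof.
(* Beyond [x = 1] the weight [x ^+ l] is at least 1, so smallness of the weighted integral passes to
   [line_sq]. *)
move=> e0; have [x] := small_value (Num.max M 1) measurable_wline wline_ge0 wline_lty e0.
rewrite gt_max => /andP[Mx x1]; have x0 : 0 < x by exact: lt_trans x1.
have L0 : (0 <= line_sq x)%E by apply: integral_ge0 => y _; rewrite lee_fin sqr_ge0.
rewrite wlineE// => we; exists x => //.
have le : (line_sq x < e%:E)%E.
  apply: le_lt_trans we; rewrite -[leLHS]mul1e; apply: lee_wpmul2r => //.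
  by rewrite lee_fin exprn_ege1// ltW.
by split => //; split => //; apply: lt_trans le (ltry _).
Qed.

Definition cauchy_ker (ze : R[i]) n w : R[i] := ext h w / (ze - w) ^+ n.

Lemma cmeas_cauchy_ker ze n : cmeas (fun p : R * R => cauchy_ker ze n (toC p)).
Proof.
apply: cmeasM => //; apply: cmeasV; apply: cmeasX.
by apply: cmeasD; [exact: cmeas_cst|apply: cmeasN; exact: cmeas_toC].
Qed.

Lemma cdiff_cauchy_ker ze n w : 0 < Re w -> w != ze -> cdiff (cauchy_ker ze n) w.
Proof.
move=> w0 wz; apply: cdiffM; first by move/analytic_cdiff : ah; apply.
have d : cdiff (fun w => ze - w) w.
  apply/derivable_cdiff; apply: derivableB; [exact: derivable_cst|exact: derivable_id].
apply: cdiffV; last exact: cdiffX.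
by rewrite expf_neq0// subr_eq0 eq_sym.
Qed.

Lemma normc_cauchy_ker ze n w :
  N (cauchy_ker ze n w) <= N (ext h w) ^+ 2 + ((N (ze - w))^-1 ^+ n) ^+ 2.
Proof.
rewrite Normc.normcM Normc.normcV normcX -exprVn.
set u := N _; set v := _ ^+ n.
have u0 : 0 <= u by exact: normc_ge0.
have v0 : 0 <= v by rewrite exprn_ge0// invr_ge0 normc_ge0.
by rewrite !expr2; nra.
Qed.

Lemma normc_sub_lorentz (ze : R[i]) (x y m : R) n : 0 < m -> m <= `|Re ze - x| ->
  ((N (ze - (x +i* y)))^-1 ^+ n.+1) ^+ 2 <= m^-1 ^+ n ^+ 2 * lorentz m (Im ze) y.
Proof.
move=> m0 mx.
have m2 : m ^+ 2 <= (Re ze - x) ^+ 2.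
  rewrite -[leRHS]real_normK ?num_real//.
  by apply: lerXn2r => //; rewrite nnegrE ?normr_ge0// ltW.
have N2 : N (ze - (x +i* y)) ^+ 2 = (Re ze - x) ^+ 2 + (y - Im ze) ^+ 2.
  by rewrite sqr_normcE ReDc ImDc /= -[(y - Im ze) ^+ 2]sqrrN opprB.
have D0 : 0 < m ^+ 2 + (y - Im ze) ^+ 2 by rewrite ltr_pwDl ?sqr_ge0// exprn_gt0.
have N0 : 0 < N (ze - (x +i* y)).
  rewrite -(@ltr_pXn2r _ 2)// ?nnegrE ?normc_ge0// expr0n N2 (lt_le_trans D0)//.
  by rewrite lerD2r.
rewrite [_ ^+ n.+1]exprS exprMn mulrC; apply: ler_pM.
- exact: sqr_ge0.
- exact: sqr_ge0.
- have Nm : (N (ze - (x +i* y)))^-1 <= m^-1.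
    rewrite lef_pV2 ?posrE//; apply: le_trans mx _.
    by apply: le_trans (normc_Re _); rewrite ReDc ReNc.
  have Ni : 0 <= (N (ze - (x +i* y)))^-1 by rewrite invr_ge0 normc_ge0.
  have mi : 0 <= m^-1 by rewrite invr_ge0 ltW.
  by do 2 (apply: lerXn2r; rewrite ?nnegrE ?exprn_ge0//).
- rewrite exprVn /lorentz lef_pV2 ?posrE ?exprn_gt0// N2 lerD2r//.
Qed.

Lemma integral_lorentz_lty (C m b : R) : 0 <= C -> 0 < m ->
  (\int[mu]_y (C * lorentz m b y)%:E < +oo)%E.
Proof.
move=> C0 m0; under eq_integral do rewrite EFinM.
rewrite ge0_integralZl//; first by rewrite integral_lorentz// -EFinM ltry.
- by apply/measurable_EFinP; exact: measurable_lorentz.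
- by move=> y _; rewrite lee_fin lorentz_ge0.
Qed.

Lemma cauchy_ker_line ze n x : good_line x -> x != Re ze ->
  cintegrable mu (fun y => cauchy_ker ze n.+1 (x +i* y)) /\
  (\int[mu]_y (N (cauchy_ker ze n.+1 (x +i* y)))%:E <=
    line_sq x + (`|Re ze - x|^-1 ^+ n ^+ 2 * (pi / `|Re ze - x|))%:E)%E.
Proof.
move=> [x0 gx] xze; set m := `|Re ze - x|.
have m0 : 0 < m by rewrite normr_gt0 subr_eq0 eq_sym.
have C0 : 0 <= m^-1 ^+ n ^+ 2 by rewrite sqr_ge0.
have mC := cmeas_line x (cmeas_cauchy_ker ze n.+1).
pose B y : \bar R := ((N (ext h (x +i* y)) ^+ 2)%:E + (m^-1 ^+ n ^+ 2 * lorentz m (Im ze) y)%:E)%E.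
have mL : measurable_fun setT (fun y => (m^-1 ^+ n ^+ 2 * lorentz m (Im ze) y)%:E).
  by apply/measurable_EFinP; apply: measurable_funM => //; exact: measurable_lorentz.
have NB y : ((N (cauchy_ker ze n.+1 (x +i* y)))%:E <= B y)%E.
  rewrite /B -EFinD lee_fin; apply: le_trans (normc_cauchy_ker _ _ _) _.
  by rewrite lerD2l; exact: normc_sub_lorentz.
have L0 y : (0 <= (m^-1 ^+ n ^+ 2 * lorentz m (Im ze) y)%:E :> \bar R)%E.
  by rewrite lee_fin mulr_ge0// lorentz_ge0.
have iB : (\int[mu]_y B y = line_sq x + (m^-1 ^+ n ^+ 2 * (pi / m))%:E)%E.
  rewrite ge0_integralD//; last 2 first.
  - by move=> y _; rewrite lee_fin sqr_ge0.
  - exact: mline.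
  congr (_ + _)%E; under eq_integral do rewrite EFinM.
  rewrite ge0_integralZl//; first by rewrite integral_lorentz// -EFinM.
  - by apply/measurable_EFinP; exact: measurable_lorentz.
  - by move=> y _; rewrite lee_fin lorentz_ge0.
have mB : measurable_fun setT B by apply: emeasurable_funD => //; exact: mline.
split.
  apply: (@cintegrable_le _ _ _ mu _ B) => //.
  by rewrite iB lte_add_pinfty// ltry.
rewrite -iB; apply: ge0_le_integral => //.
- by move=> y _; rewrite lee_fin normc_ge0.
- by apply/measurable_EFinP; exact: cmeas_normc.
Qed.

(** The kernel is bounded by [|h|^2] plus a squared pole term. The first is integrable because the
    weight is at least [x1 ^+ l] on the strip, the second because it is dominated by a Lorentz
    density in [y] over a bounded range of [x]. *)
Lemma cauchy_ker_strip ze n x1 x2 T0 (C m : R) : 0 < x1 -> x1 < x2 -> 0 <= C -> 0 < m ->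
  (forall x y, x1 <= x <= x2 -> T0 <= `|y| ->
     ((N (ze - (x +i* y)))^-1 ^+ n) ^+ 2 <= C * lorentz m (Im ze) y) ->
  measurable_fun setT (fun p => strip x1 x2 T0 p * N (cauchy_ker ze n (toC p))) /\
  (\int[area]_p (strip x1 x2 T0 p * N (cauchy_ker ze n (toC p)))%:E < +oo)%E.
Proof.
move=> x10 x12 C0 m0 HC.
have mS : measurable_fun setT (fun p => strip x1 x2 T0 p * N (cauchy_ker ze n (toC p))).
  apply: measurable_funM; first exact: measurable_strip.
  by apply: cmeas_normc; exact: cmeas_cauchy_ker.
split => //.
pose A p : \bar R := ((x1 ^+ l)^-1%:E * (p.1 ^+ l * N (ext h (toC p)) ^+ 2)%:E)%E.
pose L p : \bar R := ((C * lorentz m (Im ze) p.2)%:E * (\1_(`[x1, x2]%classic : set R) p.1)%:E)%E.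
have x1l : 0 < x1 ^+ l by rewrite exprn_gt0.
have A0 p : (0 <= A p)%E by rewrite mule_ge0// lee_fin ?weight_ge0// invr_ge0 ltW.
have L0 p : (0 <= L p)%E by rewrite mule_ge0// lee_fin// mulr_ge0// lorentz_ge0.
have mA : measurable_fun setT A by apply: emeasurable_funM => //; exact: measurable_cst.
have m1 : measurable_fun setT (fun y => (C * lorentz m (Im ze) y)%:E).
  by apply/measurable_EFinP; apply: measurable_funM => //; exact: measurable_lorentz.
have mI : measurable_fun setT (fun x : R => (\1_(`[x1, x2]%classic : set R) x)%:E : \bar R).
  by apply/measurable_EFinP; apply: measurable_indic; exact: measurable_itv.
have mL : measurable_fun setT L.
  apply: emeasurable_funM; first exact: (measurableT_comp m1 measurable_snd).
  exact: (measurableT_comp mI measurable_fst).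
apply: (@le_lt_trans _ _ (\int[area]_p (A p + L p))%E).
  apply: ge0_le_integral => //.
  - by move=> p _; rewrite lee_fin mulr_ge0 ?normc_ge0// /strip; case: ifP.
  - exact/measurable_EFinP.
  - exact: emeasurable_funD.
  move=> [x y] _; rewrite /strip/=; case: ifPn; last by rewrite mul0r adde_ge0.
  move=> /andP[xx yy]; rewrite mul1r.
  apply: (@le_trans _ _ (N (ext h (x +i* y)) ^+ 2 + ((N (ze - (x +i* y)))^-1 ^+ n) ^+ 2)%:E).
    by rewrite lee_fin; exact: normc_cauchy_ker.
  rewrite EFinD; apply: leeD.
    rewrite /A -EFinM lee_fin /= mulrA ler_peMl ?sqr_ge0//.
    have /andP[xx1 _] := xx; have x0 : 0 < x := lt_le_trans x10 xx1.
    by rewrite mulrC ler_pdivlMr// mul1r; apply: lerXn2r => //; rewrite nnegrE ltW.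
  rewrite /L /= indicE mem_set ?mule1; last by rewrite /= in_itv.
  by rewrite lee_fin; exact: HC.
rewrite ge0_integralD//; apply: lte_add_pinfty.
  rewrite ge0_integralZl//.
  - by apply: lte_mul_pinfty => //; rewrite lee_fin invr_ge0 ltW.
  - by move=> p _; rewrite lee_fin weight_ge0.
  - by rewrite lee_fin invr_ge0 ltW.
rewrite (integral_prod2 mu mu L0 mL).
have l0 y : (0 <= (C * lorentz m (Im ze) y)%:E :> \bar R)%E.
  by rewrite lee_fin mulr_ge0// lorentz_ge0.
have EL y : (\int[mu]_x L (x, y) = (C * lorentz m (Im ze) y)%:E * (x2 - x1)%:E)%E.
  rewrite /L /= ge0_integralZl//.
  congr (_ * _)%E; rewrite integral_indic//.
  by rewrite setIT [LHS]lebesgue_measure_itv/= lte_fin x12 -EFinD.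
under eq_integral do rewrite EL.
have d0 : (0 <= (x2 - x1)%:E :> \bar R)%E by rewrite lee_fin subr_ge0 ltW.
rewrite ge0_integralZr//; apply: lte_mul_pinfty.
- exact: integral_ge0.
- by rewrite ge0_fin_numE ?integral_lorentz_lty//; exact: integral_ge0.
- exact: ltry.
Qed.

(** Both lines lie to the left of the pole [ze], so every rectangle between them has circulation
    0. *)
Lemma cauchy_ker_shift ze n x1 x2 : good_line x1 -> good_line x2 ->
  x1 < Re ze -> x2 < Re ze ->
  cint mu (fun y => cauchy_ker ze n.+1 (x1 +i* y)) =
  cint mu (fun y => cauchy_ker ze n.+1 (x2 +i* y)).
Proof.
wlog: x1 x2 / x1 < x2.
  move=> H; have [xx|xx|->//] := ltgtP x1 x2; first exact: H.
  by move=> *; apply/esym; exact: H.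
move=> x12 g1 g2 l1 l2; apply/esym/eqP; rewrite -subr_eq0; apply/eqP.
have [x10 _] := g1.
have m0 : 0 < Re ze - x2 by rewrite subr_gt0.
have [mS iS] : measurable_fun setT (fun p => strip x1 x2 0 p * N (cauchy_ker ze n.+1 (toC p))) /\
    (\int[area]_p (strip x1 x2 0 p * N (cauchy_ker ze n.+1 (toC p)))%:E < +oo)%E.
  apply: (@cauchy_ker_strip _ _ _ _ _ ((Re ze - x2)^-1 ^+ n ^+ 2) (Re ze - x2)) => //.
    exact: sqr_ge0.
  move=> x y /andP[xx1 xx2] _; apply: normc_sub_lorentz => //.
  by rewrite ger0_norm; lra.
have dk x y : x1 <= x <= x2 -> cdiff (cauchy_ker ze n.+1) (x +i* y).
  move=> /andP[xx1 xx2]; apply: cdiff_cauchy_ker => /=; first exact: lt_le_trans xx1.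
  by rewrite eq_complex/= negb_and lt_eqF//; lra.
apply: (line_shift x12 (lexx 0) mS iS).
- by apply: (cauchy_ker_line _ g1 _).1; rewrite lt_eqF.
- by apply: (cauchy_ker_line _ g2 _).1; rewrite lt_eqF.
- by move=> x y xx _; exact: dk.
- move=> T T0; rewrite oppr0; apply: circ_eq0; [exact: ltW|lra|].
  by move=> x y xx _; exact: dk.
Qed.

End VerticalLines.

(** * Cauchy's formula on a vertical line *)

Section CauchyLine.
Context {R : realType}.
Local Notation mu := (@lebesgue_measure R).
Local Notation area := ((@lebesgue_measure R) \x (@lebesgue_measure R))%E.

(** The line is moved across the pole to a far line [X], which collects the residue. The integral
    along [X] is small, because [line_sq X] is small for some arbitrarily large [X] and the kernel
    decays. *)
Lemma cauchy_line (l : nat) (h : Cplus R -> R[i]) (x0 : R) (z : R[i]) :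
  bergman l h -> good_line h x0 -> x0 < Re z ->
  cint mu (fun y => cauchy_ker h z 1 (x0 +i* y)) = (2 * pi)%:C * ext h z.
Proof.
move=> bh g0 l0; have [x00 _] := g0; have [ah _] := (bergmanP l h).1 bh.
case: z l0 => a b /= l0; set z := a +i* b.
pose Phi w := ext h w / (w - z).
have PhiE w : Phi w = -1 * cauchy_ker h z 1 w.
  by rewrite /Phi /cauchy_ker expr1 -opprB invrN mulrN mulN1r.
have iPhi x : good_line h x -> x != a -> cintegrable mu (fun y => Phi (x +i* y)).
  move=> gx xa; under eq_fun do rewrite PhiE.
  by apply: cintegrableZ; apply: (@cauchy_ker_line _ _ _ bh z 0%N x gx xa).1.
have NPhi w : N (Phi w) = N (cauchy_ker h z 1 w) by rewrite PhiE mulN1r normcN.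
pose K := (2 * pi)%:C * ext h z.
suff key e : 0 < e -> N (cint mu (fun y => cauchy_ker h z 1 (x0 +i* y)) - K) <= e.
  apply/eqP; rewrite -subr_eq0 -normc_eq0 -/K.
  rewrite eq_le normc_ge0 andbT; apply/ler_addgt0Pr => e e0; rewrite add0r; exact: key.
move=> e0; have e4 : 0 < e / 4 by rewrite divr_gt0.
(* The summand [pi / (e / 4)] makes [pi / (X - a)] at most [e / 4]. With [line_sq X] below [e / 4]
   and the factor 2 of [normc_cint_le] the total is [e]. *)
have [X MX [gX sX]] := exists_small_line bh (a + 1 + pi / (e / 4)) e4.
have pe : 0 < pi / (e / 4) by rewrite divr_gt0// pi_gt0.
have aX : a + 1 < X by apply: lt_trans MX; rewrite ltrDl.
have xX : x0 < X by apply: lt_trans l0 _; apply: lt_trans aX; rewrite ltrDl.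
have Xa : X != a by rewrite gt_eqF//; apply: lt_trans aX; rewrite ltrDl.
have xa : x0 != a by rewrite lt_eqF.
(* Heights beyond [|b| + 1] stay at distance at least 1 from the pole, which bounds the pole term by
   twice a Lorentz density of width 1. *)
have T00 : 0 <= `|b| + 1 by rewrite addr_ge0.
have [mS iS] : measurable_fun setT (fun p => strip x0 X (`|b| + 1) p * N (cauchy_ker h z 1 (toC p))) /\
    (\int[area]_p (strip x0 X (`|b| + 1) p * N (cauchy_ker h z 1 (toC p)))%:E < +oo)%E.
  apply: (@cauchy_ker_strip _ _ _ bh _ _ _ _ _ 2 1) => // x y xx yb.
  have yb1 : 1 <= (y - b) ^+ 2.
    rewrite -[leRHS]real_normK ?num_real// exprn_ege1//.
    have := ler_normD (y - b) b; rewrite subrK => h1.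
    by rewrite -(lerD2r `|b|) (le_trans _ h1)// addrC.
  rewrite expr1 exprVn sqr_normcE ReDc ImDc /= /lorentz -[b - y]opprB sqrrN.
  rewrite expr1n; have D1 : 0 < 1 + (y - b) ^+ 2 by rewrite ltr_pwDl ?sqr_ge0.
  have D2 : 0 < (a - x) ^+ 2 + (y - b) ^+ 2 by rewrite ltr_wpDl ?sqr_ge0// (lt_le_trans _ yb1).
  rewrite ler_pdivlMr// mulrC ler_pdivrMr//.
  by have := sqr_ge0 (a - x); lra.
have shift : cint mu (fun y => Phi (X +i* y)) - cint mu (fun y => Phi (x0 +i* y)) = K.
  apply: (line_shift xX T00).
  - by under eq_fun do rewrite NPhi.
  - by under eq_integral do rewrite NPhi.
  - exact: iPhi.
  - exact: iPhi.
  - move=> x y /andP[xx _] yb.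
    rewrite (_ : Phi = fun w => -1 * cauchy_ker h z 1 w); last exact/funext.
    apply: cdiffM; first exact: cdiff_cst.
    apply: (cdiff_cauchy_ker bh) => /=; first exact: lt_le_trans xx.
    rewrite eq_complex/= negb_and orbC; apply/orP; left.
    by apply: contraTN yb => /eqP ->; rewrite -leNgt lerDl.
  - move=> T bT.
    have [->->] := @cauchy_rectangle R (ext h) x0 X (- T) T a b
      ltac:(by rewrite l0 (lt_trans _ aX)// ltrDl) ltac:(by rewrite -ltr_norml (lt_trans _ bT)// ltrDl)
      ltac:(by move=> x y /andP[xx _] _; move/analytic_cdiff : ah; apply => /=; exact: lt_le_trans xx).
    by rewrite /K ImMc ReMc /=; split; ring.
have E0 : cint mu (fun y => Phi (x0 +i* y)) = - cint mu (fun y => cauchy_ker h z 1 (x0 +i* y)).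
  under [in LHS]eq_fun do rewrite PhiE.
  by rewrite cintZ ?mulN1r//; apply: (@cauchy_ker_line _ _ _ bh z 0%N x0 g0 xa).1.
rewrite E0 opprK in shift.
have -> : cint mu (fun y => cauchy_ker h z 1 (x0 +i* y)) - K = - cint mu (fun y => Phi (X +i* y)).
  by rewrite -shift opprD addrCA subrr addr0.
rewrite normcN -lee_fin; apply: le_trans (normc_cint_le (iPhi X gX Xa)) _.
under eq_integral do rewrite NPhi.
have := (@cauchy_ker_line _ _ _ bh z 0%N X gX Xa).2; rewrite expr0 expr1n mul1r.
move=> H; have {H} H := le_trans H (leeD (ltW sX) (lexx _)).
have ppX : pi / `|a - X| <= e / 4.
  rewrite ltr0_norm ?subr_lt0; last by apply: lt_trans aX; rewrite ltrDl.
  rewrite opprB ler_pdivrMr; last by rewrite subr_gt0 (lt_trans _ aX)// ltrDl.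
  by rewrite mulrC -ler_pdivrMr//; lra.
apply: (@le_trans _ _ (2%:E * ((e / 4)%:E + (pi / `|a - X|)%:E))%E).
  by apply: lee_wpmul2l => //; rewrite lee_fin.
by rewrite -EFinD -EFinM lee_fin; lra.
Qed.

End CauchyLine.

(** * The integral in the horizontal direction *)

Section RadialIntegral.
Context {R : realType}.
Local Notation mu := (@lebesgue_measure R).

Lemma is_derive_eps (f : R -> R) (x v : R) :
  (forall e : R, 0 < e -> exists2 r : R, 0 < r & forall t, `|t - x| < r ->
    `|f t - f x - v * (t - x)| <= e * `|t - x|) -> is_derive x 1 f v.
Proof.
move=> H.
have C : (h^-1 *: (f (h *: 1 + x) - f x)) @[h --> 0^'] --> v.
  apply/cvgrPdist_le => e e0; have [r r0 Hr] := H e e0.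
  apply/nbhs_ballP; exists r => // t; rewrite /ball/= sub0r normrN => tr t0.
  have := Hr (t + x); rewrite addrK => /(_ tr) Ht.
  rewrite /GRing.scale/= mulr1 distrC.
  have -> : t^-1 * (f (t + x) - f x) - v = (f (t + x) - f x - v * t) / t.
    by rewrite [in RHS]mulrBl mulfK// mulrC.
  by rewrite normrM normfV ler_pdivrMr ?normr_gt0.
by apply: DeriveDef; [apply/cvg_ex; exists v|exact: (cvg_lim (@Rhausdorff R) C)].
Qed.

Lemma cderiv_real (F : R[i] -> R[i]) (x : R) d : cderiv F (x +i* 0) d ->
  is_derive x 1 (fun t => Re (F (t +i* 0))) (Re d) /\
  is_derive x 1 (fun t => Im (F (t +i* 0))) (Im d).
Proof.
move=> dF.
have E t : (t +i* 0) - (x +i* 0) = (t - x)%:C by apply/eqP; rewrite eq_complex/= subrr !eqxx.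
split; apply: is_derive_eps => e e0; have [r r0 Hr] := dF e e0; exists r => // t tx;
  have := Hr (t +i* 0); rewrite E normc_real => /(_ tx); apply: le_trans.
- apply: le_trans (normc_Re _); rewrite !ReDc !ReNc ReMc /=.
  by rewrite mulr0 subr0.
- apply: le_trans (normc_Im _); rewrite !ImDc !ImNc ImMc /=.
  by rewrite mulr0 add0r.
Qed.

Lemma rint_cderiv (F G : R[i] -> R[i]) (a b : R) : a < b ->
  (forall x, a <= x <= b -> cderiv F (x +i* 0) (G (x +i* 0))) ->
  (forall x, a <= x <= b -> cdiff G (x +i* 0)) ->
  rint (fun x => Re (G (x +i* 0))) a b = Re (F (b +i* 0)) - Re (F (a +i* 0)) /\
  rint (fun x => Im (G (x +i* 0))) a b = Im (F (b +i* 0)) - Im (F (a +i* 0)).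
Proof.
move=> ab dF dG; have [c1 c2] := cdiff_ccont_hor dG.
split; [apply: (@rint_FTC _ _ (fun t => Re (F (t +i* 0)))) => // x xab|
        apply: (@rint_FTC _ _ (fun t => Im (F (t +i* 0)))) => // x xab].
  by have [] := cderiv_real (dF x xab).
by have [] := cderiv_real (dF x xab).
Qed.

(** The integrand that the reproducing formula leaves in the [x] direction, with
    [A = z - (x0 + i y)] and [w = x]. *)
Definition radial (l : nat) (A w : R[i]) : R[i] := w ^+ l / (A + 2 * w) ^+ (l + 2).
(** Since [w / (A + 2 * w)] has derivative [A / (A + 2 * w) ^+ 2], a power of this quotient is a
    primitive of [radial]. *)
Definition radial_prim (l : nat) (A w : R[i]) : R[i] :=
  (l.+1%:R * A)^-1 * (w / (A + 2 * w)) ^+ l.+1.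

Lemma cderiv_radial_prim l A w : A != 0 -> A + 2 * w != 0 ->
  cderiv (radial_prim l A) w (radial l A w).
Proof.
move=> A0 Aw0.
have d1 : is_derive (w : R[i]^o) 1 (fun w : R[i]^o => A + 2 * w : R[i]^o) 2.
  by apply: is_derive_eq; rewrite /GRing.scale/= mulr1 add0r.
have d2 : is_derive (w : R[i]^o) 1 (fun w : R[i]^o => (A + 2 * w)^-1 : R[i]^o) (- (A + 2 * w) ^- 2 * 2).
  have [D V] := d1; apply: DeriveDef; first exact: derivableV.
  by rewrite deriveV// V.
have d3 : is_derive (w : R[i]^o) 1 (fun w : R[i]^o => w / (A + 2 * w) : R[i]^o) (A / (A + 2 * w) ^+ 2).
  apply: is_derive_eq; rewrite /GRing.scale/= mulr1; field.
  by rewrite Aw0.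
have d4 : is_derive (w : R[i]^o) 1 (radial_prim l A : R[i]^o -> R[i]^o) (radial l A w).
  have E : radial_prim l A = (fun w : R[i]^o => (l.+1%:R * A)^-1 *: ((fun w : R[i]^o => w / (A + 2 * w) : R[i]^o) ^+ l.+1) w).
    by apply/funext => u; rewrite /radial_prim fctE.
  rewrite E; apply: is_derive_eq; rewrite /GRing.scale/= /radial.
  rewrite !exprMn exprVn exprD.
  have l0 : (l.+1%:R : R[i]) != 0 by rewrite pnatr_eq0.
  have Al : (A + 2 * w) ^+ l != 0 by rewrite expf_neq0.
  rewrite -mulr_natl; move: (l.+1%:R : R[i]) l0 => k k0.
  move: (w ^+ l) ((A + 2 * w) ^+ l) Al => a b b0; field.
  by rewrite b0 Aw0 A0 k0.
have [D V] := d4; rewrite -V; exact: derivable_cderiv.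
Qed.

Lemma cdiff_radial l A w : A + 2 * w != 0 -> cdiff (radial l A) w.
Proof.
move=> Aw0; apply: cdiffM; first by apply: cdiffX; exact: cdiff_id.
apply: cdiffV; first by rewrite expf_neq0.
apply: cdiffX; apply: cdiffD; first exact: cdiff_cst.
by apply: cdiffM; [exact: cdiff_cst|exact: cdiff_id].
Qed.

Definition pos_part (x : R) : R := if 0 < x then 1 else 0.

Lemma measurable_pos_part : measurable_fun setT pos_part.
Proof. by apply: measurable_fun_ifT => //; exact: measurable_fun_ltr. Qed.

Lemma addr_double (A : R[i]) (x : R) : A + 2 * (x +i* 0) = (Re A + 2 * x) +i* Im A.
Proof.
apply/eqP; rewrite eq_complex ReDc ImDc ReMc ImMc /=.
by apply/andP; split; apply/eqP; ring.
Qed.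

(** From [x <= |A + 2 x|] the [l]-th powers drop out. As [Re A > 0], the rest is at most
    [1 / (|A|^2 + 4 x^2)], a Lorentz density of width [|A| / 2]. *)
Lemma radial_bound l (A : R[i]) x : 0 < Re A ->
  pos_part x * N (radial l A (x +i* 0)) <= 4^-1 * lorentz (N A / 2) 0 x.
Proof.
move=> A0; have NA := normc_gt_Re A0.
rewrite /pos_part; case: ltP => x0; last by rewrite mul0r mulr_ge0// lorentz_ge0.
have E := addr_double A x.
have N2 : N (A + 2 * (x +i* 0)) ^+ 2 = N A ^+ 2 + 4 * Re A * x + 4 * x ^+ 2.
  by rewrite E !sqr_normcE/=; ring.
have Nx : x <= N (A + 2 * (x +i* 0)).
  rewrite E; apply: le_trans (normc_Re _) => /=.
  by rewrite ger0_norm ?addr_ge0 ?mulr_ge0 ?ltW//; lra.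
have Np : 0 < N (A + 2 * (x +i* 0)) by apply: lt_le_trans Nx.
rewrite mul1r /radial Normc.normcM Normc.normcV !normcX exprD.
have -> : N (x +i* 0) = x by rewrite -[_ +i* _]/(x%:C) normc_real gtr0_norm.
set u := N _ in N2 Nx Np *.
have ul : 0 < u ^+ l by rewrite exprn_gt0.
apply: (@le_trans _ _ (u ^+ 2)^-1).
  rewrite ler_pdivrMr; last by rewrite mulr_gt0// exprn_gt0.
  rewrite mulrCA mulVf ?mulr1; last by rewrite expf_neq0// gt_eqF.
  by apply: lerXn2r => //; rewrite nnegrE ltW.
rewrite N2 /lorentz subr0 -invfM lef_pV2 ?posrE.
- have := mulr_gt0 A0 x0; rewrite expr_div_n; lra.
- by rewrite -N2 exprn_gt0.
- by rewrite mulr_gt0// ltr_pwDl ?sqr_ge0// exprn_gt0// divr_gt0.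
Qed.

(** Along the half-line [w / (A + 2 * w)] runs from 0 to the limit [1 / 2], whence the power of 2 in
    the value. *)
Lemma radial_integral l (A : R[i]) : 0 < Re A ->
  cintegrable mu (fun x => (pos_part x)%:C * radial l A (x +i* 0)) /\
  cint mu (fun x => (pos_part x)%:C * radial l A (x +i* 0)) =
    (l.+1%:R * 2 ^+ l.+1 * A)^-1.
Proof.
move=> A0; have NA := normc_gt_Re A0; have A1 := Re_neq0 A0.
have Ax x : 0 <= x -> A + 2 * (x +i* 0) != 0.
  move=> x0; apply: Re_neq0; rewrite addr_double /=.
  by rewrite ltr_wpDr// mulr_ge0.
have mreal : cmeas (fun x : R => x +i* 0) by split => //=; exact: measurable_cst.
have mR : cmeas (fun x : R => radial l A (x +i* 0)).
  apply: cmeasM; first exact: cmeasX.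
  apply: cmeasV; apply: cmeasX; apply: cmeasD; first exact: cmeas_cst.
  by apply: cmeasM => //; exact: cmeas_cst.
have mP : cmeas (fun x : R => (pos_part x)%:C * radial l A (x +i* 0)).
  by apply: cmeasM => //; apply: cmeas_real; exact: measurable_pos_part.
have P0 x : 0 <= pos_part x by rewrite /pos_part; case: ifP.
have int : cintegrable mu (fun x => (pos_part x)%:C * radial l A (x +i* 0)).
  apply: (@cintegrable_le _ _ _ mu _ (fun x => (4^-1 * lorentz (N A / 2) 0 x)%:E)) => //.
  - by apply/measurable_EFinP; apply: measurable_funM => //; exact: measurable_lorentz.
  - move=> x; rewrite lee_fin Normc.normcM normc_real ger0_norm//.
    exact: radial_bound.
  - by apply: integral_lorentz_lty => //; rewrite divr_gt0.
split => //.
set L := (l.+1%:R * 2 ^+ l.+1 * A)^-1.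
case: (int) => i1 i2.
have l0 : (l.+1%:R : R[i]) != 0 by rewrite pnatr_eq0.
have prim0 : radial_prim l A (0 +i* 0) = 0.
  by rewrite /radial_prim -[0 +i* 0]/(0 : R[i]) mul0r expr0n mulr0.
have cutoff (u : R[i] -> R) T : (forall x z, u (x%:C * z) = x * u z) -> 0 < T ->
    cont_on (fun x => u (radial l A (x +i* 0))) 0 T ->
    rint (fun x => u ((pos_part x)%:C * radial l A (x +i* 0))) (- T) T =
    rint (fun x => u (radial l A (x +i* 0))) 0 T.
  move=> uZ T0 cu; have ui := cont_on_integrable cu.
  rewrite /rint -[RHS]Rintegral_itv_obnd_cbnd; last first.
    by apply: (integrableS _ _ _ ui) => //; apply: subset_itvr; rewrite bnd_simp.
  have -> : `]0, T]%classic = `[- T, T]%classic `&` `]0, +oo[%classic :> set R.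
    apply/seteqP; split => x /=; rewrite !in_itv/= andbT.
      by move=> /andP[x0 xT]; rewrite x0 xT andbT; split => //; lra.
    by move=> [/andP[_ ->] ->].
  rewrite Rintegral_mkcondr; apply: eq_Rintegral => x _.
  rewrite patchE uZ /pos_part mem_setE in_itv/= andbT.
  by case: ifP; rewrite ?mul1r ?mul0r.
have lim e M : 0 < e -> exists T, [/\ 0 < T, M <= T & N (radial_prim l A (T +i* 0) - L) < e].
  move=> e0.
  have dG : cdiff (fun w => (l.+1%:R * A)^-1 * w ^+ l.+1) 2^-1.
    by apply: cdiffM; [exact: cdiff_cst|apply: cdiffX; exact: cdiff_id].
  have [r r0 Hr] := cdiff_continuous dG e0.
  have q0 : 0 < N A / r by rewrite divr_gt0.
  pose T := Num.max M (N A / r); exists T.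
  have T0 : 0 < T by rewrite lt_max q0 orbT.
  split => //; first by rewrite le_max lexx.
  have -> : L = (l.+1%:R * A)^-1 * 2^-1 ^+ l.+1.
    by rewrite /L exprVn -invfM mulrAC.
  apply: Hr.
  have AT := Ax _ (ltW T0).
  have -> : (T +i* 0) / (A + 2 * (T +i* 0)) - 2^-1 = - A / (2 * (A + 2 * (T +i* 0))).
    by field.
  rewrite Normc.normcM Normc.normcV normcN Normc.normcM.
  have N2 : N (2 : R[i]) = 2 by rewrite -[2]/((1 + 1) +i* (0 + 0)) addr0 -[_ +i* _]/((1 + 1 : R)%:C) normc_real ger0_norm.
  have NT : T <= N (A + 2 * (T +i* 0)).
    apply: le_trans (normc_Re _); rewrite addr_double /=.
    by rewrite ger0_norm ?addr_ge0 ?mulr_ge0 ?ltW//; lra.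
  rewrite N2 ltr_pdivrMr; last by rewrite mulr_gt0// (lt_le_trans T0).
  apply: (@le_lt_trans _ _ (r * T)).
    by rewrite mulrC -ler_pdivrMr// le_max lexx orbT.
  rewrite ltr_pM2l//; lra.
have parts T : 0 < T ->
    rint (fun x => Re (radial l A (x +i* 0))) 0 T = Re (radial_prim l A (T +i* 0)) /\
    rint (fun x => Im (radial l A (x +i* 0))) 0 T = Im (radial_prim l A (T +i* 0)).
  move=> T0; have [||-> ->] := @rint_cderiv (radial_prim l A) (radial l A) 0 T T0.
  - by move=> x /andP[x0 _]; apply: cderiv_radial_prim => //; exact: Ax.
  - by move=> x /andP[x0 _]; apply: cdiff_radial; exact: Ax.
  by rewrite prim0 /= !subr0.
have cc T : 0 < T -> ccont_on (fun x => radial l A (x +i* 0)) 0 T.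
  by move=> T0; apply: cdiff_ccont_hor => x /andP[x0 _]; apply: cdiff_radial; exact: Ax.
have concl (u : R[i] -> R) : (forall x z, u (x%:C * z) = x * u z) ->
    (forall z w, u (z - w) = u z - u w) -> (forall z, `|u z| <= N z) ->
    mu.-integrable setT (EFin \o (fun x => u ((pos_part x)%:C * radial l A (x +i* 0)))) ->
    (forall T, 0 < T -> cont_on (fun x => u (radial l A (x +i* 0))) 0 T) ->
    (forall T, 0 < T -> rint (fun x => u (radial l A (x +i* 0))) 0 T = u (radial_prim l A (T +i* 0))) ->
    \int[mu]_x u ((pos_part x)%:C * radial l A (x +i* 0)) = u L.
  move=> uZ uB uN ui uc up; apply/eqP; rewrite -subr_eq0 -normr_le0.
  apply/ler_addgt0Pr => e e0; rewrite add0r.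
  have e2 : 0 < e / 2 by rewrite divr_gt0.
  have [M HM] := rint_tail ui e2; have [T [T0 MT HT]] := lim (e / 2) M e2.
  have := HM T MT; rewrite cutoff//; last exact: uc.
  rewrite up//; have := le_lt_trans (uN _) HT; rewrite uB.
  rewrite ltr_norml !ler_norml => /andP[? ?] /andP[? ?]; apply/andP; split; lra.
apply/eqP; rewrite eq_complex; apply/andP; split; apply/eqP.
- apply: (concl (@complex.Re R)) => //.
  + by move=> x z; rewrite ReMc /= mul0r subr0.
  + by move=> z w; rewrite ReDc ReNc.
  + exact: normc_Re.
  + by move=> T /cc[].
  + by move=> T /parts[].
- apply: (concl (@complex.Im R)) => //.
  + by move=> x z; rewrite ImMc /= mul0r addr0.
  + by move=> z w; rewrite ImDc ImNc.
  + exact: normc_Im.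
  + by move=> T /cc[].
  + by move=> T /parts[].
Qed.

End RadialIntegral.

(** * The reproducing kernel *)

Section FubiniMeasurable.
Context {R : realType} d1 d2 (T1 : measurableType d1) (T2 : measurableType d2).
Variables (m1 : {sigma_finite_measure set T1 -> \bar R})
          (m2 : {sigma_finite_measure set T2 -> \bar R}).
Variable F : T1 * T2 -> R[i].
Hypothesis iF : cintegrable (m1 \x m2)%E F.

Lemma cmeas_cint1 : cmeas (fun x => cint m2 (fun y => F (x, y))).
Proof.
by case: iF => i1 i2; split;
  [exact: (measurableT_comp _ (measurable_fubini_F i1))|exact: (measurableT_comp _ (measurable_fubini_F i2))].
Qed.

End FubiniMeasurable.

Section Reproducing.
Context {R : realType}.
Local Notation mu := (@lebesgue_measure R).
Local Notation area := ((@lebesgue_measure R) \x (@lebesgue_measure R))%E.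

Definition kconst (l : nat) : R := l.+1%:R * 2 ^+ l.

Lemma kconst_gt0 l : 0 < kconst l.
Proof. by rewrite mulr_gt0// exprn_gt0. Qed.

Definition bker (l : nat) (z : R[i]) : Cplus R -> R[i] :=
  fun w => (kconst l)%:C / (val w + z^*) ^+ (l + 2).

Lemma ext_bker l z w : 0 < Re w -> ext (bker l z) w = (kconst l)%:C / (w + z^*) ^+ (l + 2).
Proof. by move=> w0; rewrite (ext_pos _ w0). Qed.

Lemma Re_add_conj (z w : R[i]) : Re (w + z^*) = Re w + Re z.
Proof. by rewrite ReDc Re_conjc. Qed.

Lemma analytic_bker l z : 0 < Re z -> analytic (bker l z).
Proof.
move=> z0; apply: (@analytic_of_cdiff _ _ (fun w => (kconst l)%:C / (w + z^*) ^+ (l + 2))) => //.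
move=> w w0; apply: cdiffM; first exact: cdiff_cst.
have wz : w + z^* != 0 by apply: Re_neq0; rewrite Re_add_conj addr_gt0.
apply: cdiffV; first by rewrite expf_neq0.
by apply: cdiffX; apply: cdiffD; [exact: cdiff_id|exact: cdiff_cst].
Qed.

Lemma normc_add_conj (z : R[i]) x y :
  N ((x +i* y) + z^*) ^+ 2 = (x + Re z) ^+ 2 + (y - Im z) ^+ 2.
Proof. by rewrite sqr_normcE ReDc ImDc Re_conjc Im_conjc. Qed.

Lemma bker_lorentz l z x y : 0 < Re z -> 0 < x ->
  x ^+ l * N (ext (bker l z) (x +i* y)) <= kconst l * lorentz (x + Re z) (Im z) y.
Proof.
move=> z0 x0; rewrite ext_bker// Normc.normcM Normc.normcV normcX normc_real.
have k0 := ltW (kconst_gt0 l).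
rewrite (ger0_norm k0) [leLHS]mulrCA; apply: ler_wpM2l => //.
have xz : 0 < x + Re z by rewrite addr_gt0.
set u := N _; have u2 : u ^+ 2 = (x + Re z) ^+ 2 + (y - Im z) ^+ 2 by exact: normc_add_conj.
have xu : x <= u.
  apply: le_trans (normc_Re _); rewrite Re_add_conj /=; apply: le_trans (ler_norm _).
  by rewrite lerDl ltW.
have u0 : 0 < u by exact: lt_le_trans xu.
rewrite /lorentz -u2 exprD invfM mulrA ler_piMl ?invr_ge0 ?sqr_ge0//.
rewrite ler_pdivrMr ?exprn_gt0// mul1r; apply: lerXn2r => //; rewrite nnegrE ltW//.
Qed.

Lemma normc_bker_le l z x y : 0 < Re z -> 0 < x ->
  N (ext (bker l z) (x +i* y)) <= kconst l * (Re z ^- l * lorentz (Re z) 0 x).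
Proof.
move=> z0 x0; rewrite ext_bker// Normc.normcM Normc.normcV normcX normc_real.
have k0 := ltW (kconst_gt0 l).
rewrite (ger0_norm k0); apply: ler_wpM2l => //.
set u := N _; have xu : x + Re z <= u.
  by apply: le_trans (normc_Re _); rewrite Re_add_conj /= ler_norm.
have u0 : 0 < u by apply: lt_le_trans xu; rewrite addr_gt0.
rewrite exprD invfM; apply: ler_pM; rewrite ?invr_ge0 ?exprn_ge0 ?(ltW u0)//.
  rewrite lef_pV2 ?posrE ?exprn_gt0//; apply: lerXn2r; rewrite ?nnegrE ?(ltW u0) ?(ltW z0)//.
  by apply: le_trans xu; rewrite lerDr ltW.
rewrite /lorentz lef_pV2 ?posrE ?exprn_gt0 ?ltr_pwDl ?sqr_ge0 ?exprn_gt0//.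
rewrite subr0; have: (x + Re z) ^+ 2 <= u ^+ 2 by apply: lerXn2r => //; rewrite nnegrE ltW// addr_gt0.
apply: le_trans; rewrite sqrrD addrC addrAC lerDl.
by rewrite mulrn_wge0// mulr_ge0// ltW.
Qed.

Lemma integral_mul_prod (F G : R -> R) : measurable_fun setT F -> measurable_fun setT G ->
  (forall x, 0 <= F x) -> (forall y, 0 <= G y) ->
  (\int[area]_p ((F p.1)%:E * (G p.2)%:E) = (\int[mu]_x (F x)%:E) * (\int[mu]_y (G y)%:E))%E.
Proof.
move=> mF mG F0 G0; rewrite integral_prod1; first last.
- apply: emeasurable_funM; apply/measurable_EFinP; first exact: (measurableT_comp mF).
  exact: (measurableT_comp mG).
- by move=> p; rewrite mule_ge0// lee_fin.
under eq_integral => x _ /=.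
  rewrite ge0_integralZl ?lee_fin//; [|exact/measurable_EFinP|by move=> y _; rewrite lee_fin].
over.
rewrite ge0_integralZr//.
- exact/measurable_EFinP.
- by move=> x _; rewrite lee_fin.
- by apply: integral_ge0 => y _; rewrite lee_fin.
Qed.

(** One factor [|K_z|] is bounded by a function of [x] alone and the other, with the weight, by a
    function of [y] alone; the integrand is dominated by a product of Lorentz densities. *)
Lemma bsq_bker l z : 0 < Re z -> (bsq l (bker l z) < +oo)%E.
Proof.
move=> z0; have ak : analytic (bker l z) by exact: analytic_bker.
set a := Re z in z0.
have k0 := ltW (kconst_gt0 l).
pose F x := kconst l * (a ^- l * lorentz a 0 x).
pose G y := kconst l * lorentz a (Im z) y.
have F0 x : 0 <= F x by rewrite !mulr_ge0 ?lorentz_ge0// invr_ge0 exprn_ge0// ltW.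
have G0 x : 0 <= G x by rewrite !mulr_ge0 ?lorentz_ge0.
have mF : measurable_fun setT F.
  by apply: measurable_funM => //; apply: measurable_funM => //; exact: measurable_lorentz.
have mG : measurable_fun setT G.
  by apply: measurable_funM => //; exact: measurable_lorentz.
apply: (@le_lt_trans _ _ (\int[area]_p ((F p.1)%:E * (G p.2)%:E))%E).
  apply: ge0_le_integral => //.
  - by move=> p _; rewrite lee_fin weight_ge0.
  - by apply/measurable_EFinP; exact: measurable_sq.
  - apply: emeasurable_funM; apply/measurable_EFinP; first exact: (measurableT_comp mF).
    exact: (measurableT_comp mG).
  move=> [x y] _ /=; have [x0|x0] := ltP 0 x; last first.
    by rewrite ext_neg// Normc.normc0 expr0n mulr0 -EFinM lee_fin mulr_ge0.
  rewrite -EFinM lee_fin expr2 mulrA mulrC.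
  have ax : 0 < x + a by rewrite addr_gt0.
  apply: ler_pM; rewrite ?normc_ge0//; first by rewrite mulr_ge0 ?normc_ge0 ?exprn_ge0 ?(ltW x0).
    exact: normc_bker_le.
  apply: le_trans (bker_lorentz _ _ _ _) _ => //; apply: ler_wpM2l => //.
  rewrite /lorentz lef_pV2 ?posrE ?ltr_pwDl ?sqr_ge0 ?exprn_gt0// lerD2r.
  by apply: lerXn2r; rewrite ?nnegrE ?(ltW z0) ?(ltW ax)// lerDr ltW.
have lt C m b : 0 <= C -> 0 < m -> (\int[mu]_x (C * lorentz m b x)%:E < +oo)%E.
  by move=> *; apply: integral_lorentz_lty.
rewrite integral_mul_prod//; apply: lte_mul_pinfty.
- by apply: integral_ge0 => x _; rewrite lee_fin.
- rewrite ge0_fin_numE; last by apply: integral_ge0 => x _; rewrite lee_fin.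
  by rewrite /F; under eq_integral do rewrite mulrA; apply: lt => //; rewrite mulr_ge0// invr_ge0 exprn_ge0// ltW.
- exact: lt.
Qed.

Lemma bergman_bker l z : 0 < Re z -> bergman l (bker l z).
Proof. by move=> z0; apply/bergmanP; split; [exact: analytic_bker|exact: bsq_bker]. Qed.

Section ReproducingFormula.
Variables (l : nat) (h : Cplus R -> R[i]) (z : R[i]) (x0 : R).
Hypotheses (bh : bergman l h) (z0 : 0 < Re z) (gx0 : good_line h x0) (x0z : x0 < Re z).

Let Phi := dotf l h (bker l z).
Let c (x : R) : R := kconst l * pos_part x * x ^+ l.
(** [Phi] with its contour moved from the line [Re w = x] to the line [Re w = x0], while the pole
    [z + 2 x] stays in place. *)
Let Psi (p : R * R) := (c p.1)%:C * cauchy_ker h (z + (2 * p.1)%:C) (l + 2) (x0 +i* p.2).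
Let A (y : R) := z - (x0 +i* y).

Let ReA y : 0 < Re (A y). Proof. by rewrite /A ReDc ReNc /= subr_gt0. Qed.

(** On the line [Re w = x] the conjugate of [w + conj z] equals [z + 2 x - w]. So the conjugate
    kernel, which is antianalytic in [w], agrees there with an analytic function. *)
Let PhiE x y : Phi (x, y) = (c x)%:C * cauchy_ker h (z + (2 * x)%:C) (l + 2) (x +i* y).
Proof.
rewrite /Phi /dotf /c /pos_part /cauchy_ker /= /toC /=; case: ltP => xp; last first.
  by rewrite ext_neg// !mul0r !mulr0.
rewrite ext_bker// [X in _ * X]mulrC mulrA.
have -> : Num.conj ((kconst l)%:C / ((x +i* y) + conjc z) ^+ (l + 2)) =
    (kconst l)%:C / (z + (2 * x)%:C - (x +i* y)) ^+ (l + 2).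
  rewrite rmorphM/= fmorphV/= rmorphXn/= rmorphD/= ?conjcK ?conjCK ?oppr0; congr (_ * (_ ^+ _)^-1).
    by apply/eqP; rewrite eq_complex /= oppr0 !eqxx.
  by apply/eqP; rewrite eq_complex !(ReDc, ImDc, ReNc, ImNc)/=; apply/andP; split; apply/eqP; ring.
by rewrite mulr1 !rmorphM/=; ring.
Qed.

Let PsiE x y : Psi (x, y) =
  ((kconst l)%:C * ext h (x0 +i* y)) * ((pos_part x)%:C * radial l (A y) (x +i* 0)).
Proof.
rewrite /Psi /c /cauchy_ker /radial /=.
have -> : z + (2 * x)%:C - (x0 +i* y) = A y + 2 * (x +i* 0).
  rewrite addr_double; apply/eqP; rewrite eq_complex !(ReDc, ImDc, ReNc, ImNc)/=.
  by apply/andP; split; apply/eqP; ring.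
have -> : (x +i* 0) ^+ l = (x ^+ l)%:C by rewrite rmorphXn.
by rewrite !rmorphM/=; ring.
Qed.

Let cmeas_Psi : cmeas Psi.
Proof.
have [ah _] := (bergmanP l h).1 bh.
have m1 : cmeas (fun p : R * R => ext h (x0 +i* p.2)).
  by apply: (@cmeas_comp _ _ _ _ _ (fun y => ext h (x0 +i* y)) snd) => //;
    case: (cmeas_line x0 (cmeas_ext ah)).
apply: cmeasM.
  apply: cmeas_real; apply: measurable_funM; last exact: measurable_funX.
  by apply: measurable_funM => //; apply: (measurableT_comp measurable_pos_part).
apply: cmeasM => //; apply: cmeasV; apply: cmeasX; apply: cmeasD.
  by apply: cmeasD; [exact: cmeas_cst|apply: cmeas_real; exact: measurable_funM].
by apply: cmeasN; split => //=; exact: measurable_snd.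
Qed.

(** Integrating [radial_bound] in [x] leaves [2 pi / |A|], and [|h| / |A|] is the norm of the Cauchy
    kernel of exponent 1, integrable along a good line. *)
Let cintegrable_Psi : cintegrable area Psi.
Proof.
apply: cintegrableP => //.
have mP : measurable_fun setT (fun p => (N (Psi p))%:E).
  by apply/measurable_EFinP; exact: cmeas_normc.
rewrite integral_prod2//; last by move=> p; rewrite lee_fin normc_ge0.
have k0 := ltW (kconst_gt0 l).
have [ic _] := cauchy_ker_line bh (ze := z) 0 gx0 (negbT (lt_eqF x0z)).
apply: (@le_lt_trans _ _ (\int[mu]_y (kconst l * 4^-1 * (2 * pi) * N (cauchy_ker h z 1 (x0 +i* y)))%:E)%E).
  apply: ge0_le_integral => //.
  - by move=> y _; apply: integral_ge0 => x _; rewrite lee_fin normc_ge0.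
  - apply: (measurable_integral1 mu (G := fun x y : R => (N (Psi (x, y)))%:E)) => //.
    by move=> x y; rewrite lee_fin normc_ge0.
  - apply/measurable_EFinP; apply: measurable_funM => //; apply: cmeas_normc.
    exact: cintegrable_meas ic.
  move=> y _.
  have nA := normc_gt_Re (ReA y).
  have nA2 : 0 < N (A y) / 2 by rewrite divr_gt0.
  apply: (@le_trans _ _ (\int[mu]_x ((kconst l * N (ext h (x0 +i* y)) * 4^-1) * lorentz (N (A y) / 2) 0 x)%:E)%E).
    apply: ge0_le_integral => //.
    - by move=> x _; rewrite lee_fin normc_ge0.
    - apply: (measurableT_comp mP); exact: measurable_fun_pair.
    - by apply/measurable_EFinP; apply: measurable_funM => //; exact: measurable_lorentz.
    move=> x _; rewrite lee_fin PsiE 3!Normc.normcM !normc_real.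
    rewrite (ger0_norm k0) [X in _ * (X * _)]ger0_norm; last by rewrite /pos_part; case: ltP.
    by rewrite -[leRHS]mulrA; apply: ler_wpM2l; [rewrite mulr_ge0 ?normc_ge0|exact: radial_bound].
  under eq_integral do rewrite EFinM.
  rewrite ge0_integralZl//; last 3 first.
  - by apply/measurable_EFinP; exact: measurable_lorentz.
  - by move=> x _; rewrite lee_fin lorentz_ge0.
  - by rewrite lee_fin !mulr_ge0// normc_ge0.
  rewrite integral_lorentz// -EFinM lee_fin /cauchy_ker Normc.normcM Normc.normcV expr1.
  rewrite -/(A y) le_eqVlt; apply/orP; left; apply/eqP.
  by field; rewrite gt_eqF.
have := integral_normc_lty ic.
under [X in _ -> (X < _)%E]eq_integral do rewrite EFinM.
rewrite ge0_integralZl//; last 3 first.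
- by apply/measurable_EFinP; apply: cmeas_normc; exact: cintegrable_meas ic.
- by move=> x _; rewrite lee_fin normc_ge0.
- by rewrite lee_fin !mulr_ge0// pi_ge0.
by move=> i; apply: lte_mul_pinfty => //; rewrite lee_fin !mulr_ge0// pi_ge0.
Qed.

Let cint_lines : {ae mu, forall x, cint mu (fun y => Phi (x, y)) = cint mu (fun y => Psi (x, y))}.
Proof.
apply: (@filterS _ _ (ae_filter_ringOfSetsType mu) _ _ _ (ae_good_line bh)) => x gx.
under eq_fun do rewrite PhiE.
have [x_le|xp] := leP x 0.
  have c0 : c x = 0 by rewrite /c /pos_part ltNge x_le mulr0 mul0r.
  by congr cint; apply/funext => y; rewrite /Psi /= c0 !mul0r.
have {}gx := gx xp.
have Rz : Re (z + (2 * x)%:C) = Re z + 2 * x by rewrite ReDc.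
have xz : x < Re (z + (2 * x)%:C) by rewrite Rz; move: xp z0; move: (Re z : R) => r ? ?; lra.
have x0z' : x0 < Re (z + (2 * x)%:C) by rewrite Rz; move: xp x0z; move: (Re z : R) => r ? ?; lra.
have I x1 : good_line h x1 -> x1 < Re (z + (2 * x)%:C) ->
    cintegrable mu (fun y => cauchy_ker h (z + (2 * x)%:C) (l + 2) (x1 +i* y)).
  move=> g1 x1z; rewrite addn2.
  by have [] := cauchy_ker_line bh (ze := z + (2 * x)%:C) l.+1 g1 (negbT (lt_eqF x1z)).
rewrite cintZ; last exact: I.
rewrite /Psi /= cintZ; last exact: I.
by rewrite addn2 (cauchy_ker_shift bh l.+1 gx gx0 xz x0z').
Qed.

Lemma reproducing_line : bergman_dot l h (bker l z) = ext h z.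
Proof.
have iPhi : cintegrable area Phi by apply: cintegrable_dotf => //; exact: bergman_bker.
rewrite bergman_dotE -/Phi cint_prod1//.
rewrite (ae_eq_cint (cmeas_cint1 iPhi) (cmeas_cint1 cintegrable_Psi) cint_lines).
rewrite -cint_prod1// cint_prod2//.
(* The constant [kconst l] cancels the radial integral up to [1 / 2]. Cauchy's formula contributes
   [2 pi] and the inner product [1 / pi], with product 1. *)
have -> : (fun y => cint mu (fun x => Psi (x, y))) = (fun y => (2^-1)%:C * cauchy_ker h z 1 (x0 +i* y)).
  apply/funext => y; under eq_fun do rewrite PsiE.
  have [ir er] := radial_integral l (ReA y).
  rewrite (cintZ _ ir) er /cauchy_ker expr1 -/(A y).
  rewrite /kconst rmorphM rmorph_nat rmorphXn rmorph_nat fmorphV rmorph_nat exprSr.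
  have A1 := Re_neq0 (ReA y).
  have l1 : l.+1%:R != 0 :> R[i] by rewrite pnatr_eq0.
  have t1 : 2 ^+ l != 0 :> R[i] by rewrite expf_neq0// pnatr_eq0.
  move: (2 ^+ l) (l.+1%:R) (A y) (ext h _) A1 l1 t1 => t m a e A1 l1 t1.
  by field; rewrite A1 l1 t1.
have [i1 _] := cauchy_ker_line bh (ze := z) 0 gx0 (negbT (lt_eqF x0z)).
rewrite (cintZ _ i1) (cauchy_line bh gx0 x0z) !mulrA -!rmorphM.
suff -> : pi^-1 * 2^-1 * (2 * pi) = 1 :> R by rewrite mul1r.
have := pi_gt0 R; move: (pi : R) => p p0.
by field; rewrite gt_eqF.
Qed.

End ReproducingFormula.

Lemma reproducing l h z : bergman l h -> 0 < Re z -> bergman_dot l h (bker l z) = ext h z.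
Proof.
move=> bh z0; have [x0 gx0 x0z] := exists_good_line bh z0.
exact: reproducing_line gx0 x0z.
Qed.

End Reproducing.

(** * Schur test and adjoint *)

Section Schur.
Context {R : realType}.
Local Notation mu := (@lebesgue_measure R).
Local Notation area := ((@lebesgue_measure R) \x (@lebesgue_measure R))%E.

(** The integrands below have a singularity at 0, so primitives are used on [[e, +oo[] only and the
    bound passes to the limit by monotone convergence. *)
Lemma integral_pos_le (f : R -> R) (C : R) :
  measurable_fun setT f -> (forall x, 0 <= f x) ->
  (forall e : R, 0 < e -> (\int[mu]_(x in `[e, +oo[) (f x)%:E <= C%:E)%E) ->
  (\int[mu]_x (pos_part x * f x)%:E <= C%:E)%E.
Proof.
move=> mf f0 H.
pose F (i : nat) : set R := [set` `[i.+1%:R^-1, +oo[].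
have UF : \bigcup_i F i = `]0, +oo[%classic.
  apply/seteqP; split => x /=.
    by move=> [i _]; rewrite /F /= !in_itv/= !andbT; apply: lt_le_trans; rewrite invr_gt0.
  rewrite in_itv/= andbT => x0; have /= := archi_boundP (ltW (_ : 0 < x^-1)).
  rewrite invr_gt0 => /(_ x0) H1; exists (Num.bound x^-1) => //.
  rewrite /F /= in_itv/= andbT -[leRHS]invrK lef_pV2 ?posrE ?invr_gt0//.
  by apply: ltW (lt_trans H1 _); rewrite ltr_nat.
have -> : (\int[mu]_x (pos_part x * f x)%:E = \int[mu]_(x in \bigcup_i F i) (f x)%:E)%E.
  rewrite UF [RHS]integral_mkcond; apply: eq_integral => x _.
  rewrite patchE mem_setE in_itv/= andbT /pos_part.
  by case: ifP => _; rewrite ?mul1r ?mul0r.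
have mF i : measurable (F i) by exact: measurable_itv.
have cv : (\int[mu]_(x in F i) (f x)%:E)%E @[i --> \oo] --> (\int[mu]_(x in \bigcup_i F i) (f x)%:E)%E.
  apply: ge0_nondecreasing_set_cvg_integral => //.
  - move=> n m nm; apply/subsetPset => x; rewrite /F /= !in_itv/= !andbT; apply: le_trans.
    by rewrite lef_pV2 ?posrE// ler_nat.
  - by move=> i; apply/measurable_EFinP; apply: measurable_funTS.
  - by move=> i x _; rewrite lee_fin.
rewrite -(cvg_lim _ cv)//; apply: lime_le; first by apply: cvgP cv.
by apply: nearW => i; apply: H; rewrite invr_gt0.
Qed.

Lemma integral_sqrt_tail (b e : R) : 0 < b -> 0 < e ->
  (\int[mu]_(x in `[e, +oo[) ((Num.sqrt x + b)^-1 * (Num.sqrt x + b)^-1 * (2 * Num.sqrt x)^-1)%:E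
    <= (b^-1)%:E)%E.
Proof.
move=> b0 e0.
pose F (x : R) : R := - (Num.sqrt x + b)^-1.
have sb x : 0 < Num.sqrt x + b :> R by rewrite ltr_wpDl// sqrtr_ge0.
have dF (x : R) : 0 < x -> is_derive x 1 F
    ((Num.sqrt x + b)^-1 * (Num.sqrt x + b)^-1 * (2 * Num.sqrt x)^-1).
  move=> x0; have := is_derive1_sqrt x0 => ds.
  have ds2 : is_derive x 1 (fun y : R => Num.sqrt y + b) ((2 * Num.sqrt x)^-1 + 0).
    by apply: is_deriveD.
  have := @is_deriveV _ (fun y : R => Num.sqrt y + b) x _ 1 (lt0r_neq0 (sb x)) ds2 => dv.
  have := is_deriveN dv => dn; apply: is_derive_eq dn _.
  by rewrite addr0 scaleNr opprK /GRing.scale/= expr2 invfM.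
have cs (x : R) : {for x, continuous (@Num.sqrt R)} by exact: sqrt_continuous.
have cv (x : R) : {for x, continuous (fun y : R => (Num.sqrt y + b)^-1)}.
  apply: continuousV; first exact: lt0r_neq0.
  by apply: continuousD => //; exact: cst_continuous.
have cf (x : R) : 0 < x -> {for x, continuous (fun y : R => (Num.sqrt y + b)^-1 * (Num.sqrt y + b)^-1 * (2 * Num.sqrt y)^-1)}.
  move=> x0; apply: continuousM; first exact: continuousM.
  apply: continuousV; first by rewrite mulf_neq0// gt_eqF// sqrtr_gt0.
  by apply: continuousM => //; exact: cst_continuous.
rewrite (@ge0_continuous_FTC2y _ _ F e 0).
- by rewrite sub0e /F -EFinN opprK lee_fin lef_pV2 ?posrE// lerDr sqrtr_ge0.
- by move=> x xe; rewrite !mulr_ge0 ?invr_ge0 ?mulr_ge0 ?sqrtr_ge0// ltW.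
- apply/continuous_within_itvcyP; split.
    by move=> x; rewrite in_itv/= andbT => /(lt_trans e0); exact: cf.
  by apply: cvg_at_right_filter; exact: cf.
- rewrite -oppr0; apply: cvgN; apply/cvgrPdist_lt => d d0; near=> x.
  rewrite sub0r normrN gtr0_norm ?invr_gt0// -[ltRHS]invrK ltf_pV2 ?posrE ?invr_gt0//.
  apply: (@lt_le_trans _ _ (Num.sqrt x)); last by rewrite lerDl ltW.
  rewrite -[ltLHS]ger0_norm ?invr_ge0 ?(ltW d0)// -sqrtr_sqr.
  have dx : (d^-1) ^+ 2 < x by near: x; apply: nbhs_pinfty_gt; exact: num_real.
  by rewrite ltr_sqrt//; apply: le_lt_trans dx; exact: sqr_ge0.
- by move=> x ex; have [] := dF x (lt_trans e0 ex).
- by apply: cvg_at_right_filter; apply: cvgN; exact: cv.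
- move=> x; rewrite in_itv/= andbT => ex.
  by rewrite derive1E; have [_ ->] := dF x (lt_trans e0 ex).
Unshelve. all: by end_near.
Qed.

Lemma measurable_sqrt : measurable_fun setT (@Num.sqrt R).
Proof. by apply: continuous_measurable_fun; exact: sqrt_continuous. Qed.

(** Since [(s + b)^2 <= 2 (s^2 + b^2)], the factor [x + a] may be replaced by half the square of
    [sqrt x + sqrt a]. The new integrand has an elementary primitive. *)
Lemma integral_schur_slice (a : R) : 0 < a ->
  (\int[mu]_x (pos_part x * (Num.sqrt x * (`|x| + a))^-1)%:E <= (4 / Num.sqrt a)%:E)%E.
Proof.
move=> a0; have sa : 0 < Num.sqrt a by rewrite sqrtr_gt0.
have mV : measurable_fun setT (fun x : R => Num.sqrt x * (`|x| + a)).
  by apply: measurable_funM; [exact: measurable_sqrt|apply: measurable_funD => //; exact: measurable_normr].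
apply: integral_pos_le.
- exact: measurable_funVr.
- by move=> x; rewrite invr_ge0 mulr_ge0 ?sqrtr_ge0// addr_ge0// ltW.
move=> e e0.
apply: (@le_trans _ _ (\int[mu]_(x in `[e, +oo[) (4 * ((Num.sqrt x + Num.sqrt a)^-1 * (Num.sqrt x + Num.sqrt a)^-1 * (2 * Num.sqrt x)^-1))%:E)%E).
  apply: ge0_le_integral => //.
  - by move=> x _; rewrite lee_fin invr_ge0 mulr_ge0 ?sqrtr_ge0// addr_ge0// ltW.
  - by apply/measurable_EFinP; apply: measurable_funTS; exact: measurable_funVr.
  - apply/measurable_EFinP; apply: measurable_funTS; apply: measurable_funM => //.
    have ms := measurable_sqrt; have m1 : measurable_fun setT (fun x : R => (Num.sqrt x + Num.sqrt a)^-1).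
      by apply: measurable_funVr; exact: measurable_funD.
    by apply: measurable_funM; [exact: measurable_funM|apply: measurable_funVr; exact: measurable_funM].
  move=> x /=; rewrite in_itv/= andbT => ex; have x0 := lt_le_trans e0 ex.
  rewrite lee_fin gtr0_norm//.
  have := sqr_sqrtr (ltW x0); have := sqr_sqrtr (ltW a0).
  have : 0 < Num.sqrt x by rewrite sqrtr_gt0.
  move: (Num.sqrt x : R) (Num.sqrt a : R) sa => s b b0 s0 ba sx.
  rewrite -ba -sx -!invfM -[X in _ <= X * _]invrK -invfM lef_pV2 ?posrE; last 2 first.
  - by rewrite mulr_gt0// addr_gt0// exprn_gt0.
  - by rewrite !mulr_gt0 ?invr_gt0 ?addr_gt0.
  have -> : 4^-1 * ((s + b) * (s + b) * (2 * s)) = s * ((s + b) ^+ 2 / 2) by field.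
  rewrite ler_pM2l// ler_pdivrMr//.
  by have := sqr_ge0 (s - b); rewrite sqrrB sqrrD; lra.
under eq_integral do rewrite EFinM.
rewrite ge0_integralZl//; last first.
- apply/measurable_EFinP; apply: measurable_funTS.
  have ms := measurable_sqrt; have m1 : measurable_fun setT (fun x : R => (Num.sqrt x + Num.sqrt a)^-1).
    by apply: measurable_funVr; exact: measurable_funD.
  by apply: measurable_funM; [exact: measurable_funM|apply: measurable_funVr; exact: measurable_funM].
by rewrite EFinM; apply: lee_wpmul2l; [rewrite lee_fin|exact: integral_sqrt_tail].
Qed.

Definition schur (l : nat) (z : R[i]) (p : R * R) : R :=
  rpart p * p.1 ^+ l * (N (ext (bker l z) (toC p)) / Num.sqrt p.1).

Lemma schur_ge0 l z p : 0 <= schur l z p.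
Proof.
by rewrite mulr_ge0 ?rpart_weight_ge0// divr_ge0 ?normc_ge0 ?sqrtr_ge0.
Qed.

Lemma measurable_schur l z : 0 < Re z -> measurable_fun setT (schur l z).
Proof.
move=> z0; apply: measurable_funM; first exact: measurable_rpart_weight.
apply: measurable_funM.
  by apply: cmeas_normc; apply: cmeas_ext; exact: analytic_bker.
by apply: measurable_funVr; exact: (measurableT_comp measurable_sqrt).
Qed.

(** Integration in [y] gives [pi / (x + Re z)] and leaves the slice integral. The outcome is again a
    multiple of [(Re z)^(-1/2)], the property on which Schur's test depends. *)
Lemma integral_schur l z : 0 < Re z ->
  (\int[area]_p (schur l z p)%:E <= (4 * pi * kconst l / Num.sqrt (Re z))%:E)%E.
Proof.
move=> z0; have k0 : 0 <= kconst l :> R by rewrite ltW ?kconst_gt0.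
have mS : measurable_fun setT (fun p => (schur l z p)%:E).
  by apply/measurable_EFinP; exact: (measurable_schur l z0).
rewrite integral_prod1; last 2 first.
- by move=> p; rewrite lee_fin schur_ge0.
- by apply/measurable_EFinP; exact: (measurable_schur l z0).
apply: (@le_trans _ _ (\int[mu]_x ((pi * kconst l)%:E * (pos_part x * (Num.sqrt x * (`|x| + Re z))^-1)%:E))%E).
  apply: ge0_le_integral => //.
  - by move=> x _; apply: integral_ge0 => y _; rewrite lee_fin schur_ge0.
  - apply: (measurable_integral2 mu (G := fun x y : R => (schur l z (x, y))%:E)) => //.
      by move=> x y; rewrite lee_fin schur_ge0.
  - apply: emeasurable_funM => //; apply/measurable_EFinP; apply: measurable_funM; first exact: measurable_pos_part.
    apply: measurable_funVr; apply: measurable_funM; first exact: measurable_sqrt.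
    by apply: measurable_funD => //; exact: measurable_normr.
  move=> x _; have [x0|x0] := ltP 0 x; last first.
    rewrite [leLHS](_ : _ = 0%E); last first.
      apply: integral0_eq => y _; rewrite /schur /rpart /= ltNge x0 /=.
      by rewrite !mul0r.
    by rewrite mule_ge0// lee_fin ?mulr_ge0 ?invr_ge0 ?mulr_ge0 ?pi_ge0 ?sqrtr_ge0 ?addr_ge0 ?(ltW z0)// /pos_part; case: ifP.
  have xz : 0 < x + Re z by rewrite addr_gt0.
  have sx : 0 < Num.sqrt (x : R) by rewrite sqrtr_gt0.
  have q0 : 0 <= kconst l / Num.sqrt (x : R) by apply: mulr_ge0; rewrite ?invr_ge0 ?sqrtr_ge0.
  apply: (@le_trans _ _ (\int[mu]_y ((kconst l / Num.sqrt x)%:E * (lorentz (x + Re z) (Im z) y)%:E))%E).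
    apply: ge0_le_integral => //.
    - by move=> y _; rewrite lee_fin schur_ge0.
    - apply: (measurableT_comp mS); exact: measurable_fun_pair.
    - by apply: emeasurable_funM => //; apply/measurable_EFinP; exact: measurable_lorentz.
    move=> y _; rewrite -EFinM lee_fin /schur /rpart /= x0 mul1r mulrA [leRHS]mulrAC.
    by apply: ler_wpM2r; [rewrite invr_ge0 ltW|exact: bker_lorentz].
  have mL : measurable_fun setT (fun y : R => (lorentz (x + Re z) (Im z) y)%:E).
    by apply/measurable_EFinP; exact: measurable_lorentz.
  have L0 (y : R) : setT y -> (0 <= (lorentz (x + Re z) (Im z) y)%:E)%E.
    by move=> _; rewrite lee_fin lorentz_ge0.
  have q0' : (0 <= (kconst l / Num.sqrt (x : R))%:E)%E by rewrite lee_fin; exact: q0.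
  rewrite (ge0_integralZl mu measurableT mL L0 q0').
  rewrite integral_lorentz// -!EFinM lee_fin /pos_part x0 mul1r gtr0_norm// invfM.
  by rewrite le_eqVlt; apply/orP; left; apply/eqP; field; rewrite !gt_eqF.
have mP : measurable_fun setT (fun x : R => (pos_part x * (Num.sqrt x * (`|x| + Re z))^-1)%:E).
  apply/measurable_EFinP; apply: measurable_funM; first exact: measurable_pos_part.
  apply: measurable_funVr; apply: measurable_funM; first exact: measurable_sqrt.
  by apply: measurable_funD => //; exact: measurable_normr.
have P0 (x : R) : setT x -> (0 <= (pos_part x * (Num.sqrt x * (`|x| + Re z))^-1)%:E)%E.
  move=> _; rewrite lee_fin mulr_ge0 ?invr_ge0 ?mulr_ge0 ?sqrtr_ge0 ?addr_ge0 ?(ltW z0)//.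
  by rewrite /pos_part; case: ifP.
have c0 : (0 <= (pi * kconst l : R)%:E)%E by rewrite lee_fin mulr_ge0 ?pi_ge0.
rewrite (ge0_integralZl mu measurableT mP P0 c0).
apply: le_trans (lee_wpmul2l _ (integral_schur_slice z0)) _; first by rewrite lee_fin mulr_ge0 ?pi_ge0.
by rewrite -EFinM lee_fin; rewrite le_eqVlt; apply/orP; left; apply/eqP; ring.
Qed.

End Schur.

(** * Fubini's theorem for pairs of points of the plane *)

Section AreaFubini.
Context {R : realType}.
Local Notation mu := (@lebesgue_measure R).
Local Notation area := ((@lebesgue_measure R) \x (@lebesgue_measure R))%E.

(* A name for planar measure that carries a sigma-finite structure: on a product
   [m1 \x m2] only the instance for finite [m1] and [m2] is inferred. *)
Definition area_measure := area.

Let area_sigma_finite : sigma_finite setT area_measure.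
Proof.
exact: (isSigmaFinite.sigma_finiteT
  (lebesgue_integral_fubini.measure_function_Measure_isSigmaFinite__to__measure_function_isSigmaFinite
     mu mu)).
Qed.

HB.instance Definition _ := Measure.on area_measure.
HB.instance Definition _ := Measure_isSigmaFinite.Build _ _ _ area_measure area_sigma_finite.

Lemma integral_area1 G : (forall p, (0 <= G p)%E) -> measurable_fun setT G ->
  (\int[area_measure \x area_measure]_p G p = \int[area]_x \int[area]_y G (x, y))%E.
Proof. exact: (@integral_prod1 _ _ _ _ _ area_measure area_measure). Qed.

Lemma integral_area2 G : (forall p, (0 <= G p)%E) -> measurable_fun setT G ->
  (\int[area_measure \x area_measure]_p G p = \int[area]_y \int[area]_x G (x, y))%E.
Proof. exact: (@integral_prod2 _ _ _ _ _ area_measure area_measure). Qed.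

Lemma measurable_integral_area1 (G : R * R -> R * R -> \bar R) : (forall x y, (0 <= G x y)%E) ->
  measurable_fun setT (fun p => G p.1 p.2) ->
  measurable_fun setT (fun y => \int[area]_x G x y)%E.
Proof. exact: (measurable_integral1 area_measure). Qed.

Lemma measurable_integral_area2 (G : R * R -> R * R -> \bar R) : (forall x y, (0 <= G x y)%E) ->
  measurable_fun setT (fun p => G p.1 p.2) ->
  measurable_fun setT (fun x => \int[area]_y G x y)%E.
Proof. exact: (measurable_integral2 area_measure). Qed.

Lemma cint_area1 F : cintegrable (area_measure \x area_measure)%E F ->
  cint (area_measure \x area_measure)%E F = cint area (fun x => cint area (fun y => F (x, y))).
Proof. exact: (@cint_prod1 _ _ _ _ _ area_measure area_measure). Qed.

Lemma cint_area2 F : cintegrable (area_measure \x area_measure)%E F ->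
  cint (area_measure \x area_measure)%E F = cint area (fun y => cint area (fun x => F (x, y))).
Proof. exact: (@cint_prod2 _ _ _ _ _ area_measure area_measure). Qed.

End AreaFubini.

(** * Expansion in kernels under the inner product *)

Section KernelFubini.
Context {R : realType}.
Local Notation mu := (@lebesgue_measure R).
Local Notation area_measure := (@area_measure R).
Local Notation area := ((@lebesgue_measure R) \x (@lebesgue_measure R))%E.

Variables (l : nat) (f : Cplus R -> R[i]) (g : Cplus R -> Cplus R) (M : R)
  (h p : Cplus R -> R[i]).
Hypotheses (af : analytic f) (ag : analytic (fun z => val (g z)))
  (HM : bounded_change l f g M) (bh : bergman l h) (bp : bergman l p).

Let ah : analytic h. Proof. by have [] := (bergmanP l h).1 bh. Qed.
Let ap : analytic p. Proof. by have [] := (bergmanP l p).1 bp. Qed.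

(** This is [K_b (g a)], and also the conjugate of [K_(g a) (b)]. The bare formula is measurable in
    both points jointly. *)
Let kk (a b : R * R) : R[i] := (kconst l)%:C / (gmap g (toC a) + conjc (toC b)) ^+ (l + 2).

(** Integrated over the second point first, [D] gives the integrand of [<W h, p>] by the reproducing
    formula. Integrated over the first point first, it gives [h b] times [<W K_b, p>]. *)
Let D (t : (R * R) * (R * R)) : R[i] :=
  ((t.1.1 ^+ l)%:C * (ext f (toC t.1) * conjc (ext p (toC t.1)))) *
  (((t.2.1 ^+ l)%:C * ext h (toC t.2)) * kk t.1 t.2).

Let cm1 (F : R * R -> R[i]) : cmeas F -> cmeas (fun t : (R * R) * (R * R) => F t.1).
Proof. by move=> [F1 F2]; exact: (@cmeas_comp _ _ _ _ _ F fst). Qed.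

Let cm2 (F : R * R -> R[i]) : cmeas F -> cmeas (fun t : (R * R) * (R * R) => F t.2).
Proof. by move=> [F1 F2]; exact: (@cmeas_comp _ _ _ _ _ F snd). Qed.

Let rm1 (F : R * R -> R) : measurable_fun setT F ->
  measurable_fun setT (fun t : (R * R) * (R * R) => F t.1).
Proof. by move=> mF; exact: (measurableT_comp mF). Qed.

Let rm2 (F : R * R -> R) : measurable_fun setT F ->
  measurable_fun setT (fun t : (R * R) * (R * R) => F t.2).
Proof. by move=> mF; exact: (measurableT_comp mF). Qed.

Let cmeas_kk : cmeas (fun t : (R * R) * (R * R) => kk t.1 t.2).
Proof.
apply: cmeasM; first exact: cmeas_cst.
apply: cmeasV; apply: cmeasX; apply: cmeasD.
  by apply: (cm1 (F := fun a => gmap g (toC a))); exact: cmeas_gmap.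
by apply: (cm2 (F := fun b => conjc (toC b))); apply: cmeas_conj; exact: cmeas_toC.
Qed.

Let cmeas_D : cmeas D.
Proof.
apply: cmeasM.
  apply: (cm1 (F := fun a => (a.1 ^+ l)%:C * (ext f (toC a) * conjc (ext p (toC a))))).
  apply: cmeasM; first by apply: cmeas_real; exact: measurable_funX.
  by apply: cmeasM; [exact: cmeas_ext|apply: cmeas_conj; exact: cmeas_ext].
apply: cmeasM => //.
apply: (cm2 (F := fun b => (b.1 ^+ l)%:C * ext h (toC b))).
by apply: cmeasM; [apply: cmeas_real; exact: measurable_funX|exact: cmeas_ext].
Qed.

Let kkE1 a b : 0 < b.1 -> kk a b = conjc (ext (bker l (gmap g (toC a))) (toC b)).
Proof.
move=> b0; rewrite ext_bker// rmorphM/= fmorphV/= rmorphXn/= rmorphD/= conjcK addrC.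
by congr (_ * _); apply/eqP; rewrite eq_complex /= oppr0 !eqxx.
Qed.

Let kkE2 a b : 0 < a.1 -> kk a b = ext (bker l (toC b)) (gmap g (toC a)).
Proof. by move=> a0; rewrite ext_bker//; exact: Re_gmap. Qed.

Let DE1 a b : D (a, b) = ((a.1 ^+ l)%:C * (ext f (toC a) * conjc (ext p (toC a)))) *
  dotf l h (bker l (gmap g (toC a))) b.
Proof.
rewrite /D /= /dotf; congr (_ * _); have [b0|b0] := ltP 0 b.1; last first.
  by rewrite ext_neg// !(mul0r, mulr0).
by rewrite -mulrA kkE1.
Qed.

Let DE2 a b : D (a, b) = ((b.1 ^+ l)%:C * ext h (toC b)) *
  dotf l (Wop f g (bker l (toC b))) p a.
Proof.
rewrite /D /= /dotf; have [a0|a0] := ltP 0 a.1; last first.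
  by rewrite !(@ext_neg _ _ (toC a))// !(mul0r, mulr0).
by rewrite ext_Wop// -kkE2//; ring.
Qed.

Let P (a : R * R) : R := a.1 ^+ l * N (ext p (toC a)) ^+ 2.
Let F (a : R * R) : R := a.1 ^+ l * N (ext f (toC a)) ^+ 2.
Let H (b : R * R) : R := b.1 ^+ l * N (ext h (toC b)) ^+ 2.
Let sg (a : R * R) : R := Num.sqrt (Re (gmap g (toC a))).
Let nk (t : (R * R) * (R * R)) : R := N (kk t.1 t.2).
(** [T1] is to be integrated over the second point first, where [integral_schur] at [g a] cancels
    [sg] and leaves [|p|^2]. [T2] is to be integrated over the first point first, where
    [bounded_change] reduces it to [integral_schur] at [b] and leaves [|h|^2]. *)
Let T1 (t : (R * R) * (R * R)) : R :=
  (P t.1 * sg t.1) * ((rpart t.2 * t.2.1 ^+ l) * (nk t / Num.sqrt t.2.1)).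
Let T2 (t : (R * R) * (R * R)) : R :=
  (H t.2 * Num.sqrt t.2.1) * (F t.1 * (nk t / sg t.1)).

Let P0 a : 0 <= P a. Proof. exact: weight_ge0. Qed.
Let F0 a : 0 <= F a. Proof. exact: weight_ge0. Qed.
Let H0 a : 0 <= H a. Proof. exact: weight_ge0. Qed.
Let nk0 t : 0 <= nk t. Proof. exact: normc_ge0. Qed.

Let T10 t : 0 <= T1 t.
Proof.
by rewrite /T1 mulr_ge0//; rewrite mulr_ge0 ?sqrtr_ge0 ?rpart_weight_ge0// divr_ge0 ?sqrtr_ge0.
Qed.

Let T20 t : 0 <= T2 t.
Proof. by rewrite /T2 mulr_ge0// mulr_ge0 ?sqrtr_ge0// divr_ge0 ?sqrtr_ge0. Qed.

Let mP : measurable_fun setT P. Proof. exact: measurable_sq. Qed.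
Let mF : measurable_fun setT F. Proof. exact: measurable_sq. Qed.
Let mH : measurable_fun setT H. Proof. exact: measurable_sq. Qed.
Let msg : measurable_fun setT sg.
Proof. by have [m _] := cmeas_gmap ag; exact: (measurableT_comp (@measurable_sqrt R) m). Qed.
Let mnk : measurable_fun setT nk.
Proof. exact: cmeas_normc. Qed.
Let ms1 : measurable_fun setT (fun b : R * R => Num.sqrt b.1 : R).
Proof. exact: (measurableT_comp (@measurable_sqrt R)). Qed.

Let mT1 : measurable_fun setT (fun t => (T1 t)%:E).
Proof.
apply/measurable_EFinP; apply: measurable_funM.
  by apply: measurable_funM; exact: rm1.
apply: measurable_funM; first by apply: (rm2 (F := fun b => rpart b * b.1 ^+ l)); exact: measurable_rpart_weight.
by apply: measurable_funM => //; apply: measurable_funVr; exact: (rm2 ms1).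
Qed.

Let mT2 : measurable_fun setT (fun t => (T2 t)%:E).
Proof.
apply/measurable_EFinP; apply: measurable_funM.
  by apply: measurable_funM; [exact: rm2|exact: (rm2 ms1)].
apply: measurable_funM; first exact: rm1.
by apply: measurable_funM => //; apply: measurable_funVr; exact: (rm1 msg).
Qed.

(* AM-GM with the Schur weight [sqrt (Re w)]. *)
Let normc_D_le t : N (D t) <= T1 t + T2 t.
Proof.
case: t => a b; have [a0|a0] := ltP 0 a.1; last first.
  by rewrite DE2 /dotf !(@ext_neg _ _ (toC a))// !(mul0r, mulr0) Normc.normc0 addr_ge0.
have [b0|b0] := ltP 0 b.1; last first.
  by rewrite DE1 /dotf !(@ext_neg _ _ (toC b))// !(mul0r, mulr0) Normc.normc0 addr_ge0.
have s0 : 0 < sg a by rewrite sqrtr_gt0 Re_gmap.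
have t0 : 0 < Num.sqrt b.1 by rewrite sqrtr_gt0.
rewrite /D /= 5!Normc.normcM normc_conj !normc_real /T1 /T2 /= /P /F /H.
rewrite -[N (kk a b)]/(nk (a, b)).
have A0 : 0 <= a.1 ^+ l by rewrite exprn_ge0// ltW.
have B0 : 0 <= b.1 ^+ l by rewrite exprn_ge0// ltW.
rewrite (ger0_norm A0) (ger0_norm B0) /rpart b0 mul1r.
have n0 := nk0 (a, b); have p0 := normc_ge0 (ext p (toC a)).
have f0 := normc_ge0 (ext f (toC a)); have h0 := normc_ge0 (ext h (toC b)).
move: (a.1 ^+ l) (b.1 ^+ l) (nk (a, b)) (N (ext p _)) (N (ext f _)) (N (ext h _))
  (sg a) (Num.sqrt b.1) s0 t0 A0 B0 n0 p0 f0 h0 => A B n u v w s t s0 t0 A0 B0 n0 u0 v0 w0.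
have -> : A * u ^+ 2 * s * (B * (n / t)) + B * w ^+ 2 * t * (A * v ^+ 2 * (n / s)) =
    (A * B * n) * (u ^+ 2 * (s / t) + (w * v) ^+ 2 * (t / s)) by field; rewrite !gt_eqF.
have -> : A * (v * u) * (B * w * n) = (A * B * n) * (u * (w * v)) by ring.
apply: ler_wpM2l; first by rewrite !mulr_ge0.
have {w v w0 v0} [v v0 ->] : exists2 v', 0 <= v' & w * v = v' by exists (w * v); rewrite ?mulr_ge0.
have -> : u ^+ 2 * (s / t) + v ^+ 2 * (t / s) = (u ^+ 2 * s ^+ 2 + v ^+ 2 * t ^+ 2) / (s * t).
  by field; rewrite !gt_eqF.
rewrite ler_pdivlMr ?mulr_gt0//.
have := sqr_ge0 (u * s - v * t); have := sqr_ge0 (u * s); have := sqr_ge0 (v * t).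
rewrite !exprMn sqrrB.
have : 0 <= (u * s) * (v * t) by rewrite !mulr_ge0// ltW.
rewrite !exprMn; lra.
Qed.

Let C : R := 4 * pi * kconst l.
Let C0 : 0 <= C. Proof. by rewrite !mulr_ge0 ?pi_ge0// ltW ?kconst_gt0. Qed.

Let int_T1 : (\int[area_measure \x area_measure]_t (T1 t)%:E < +oo)%E.
Proof.
have [_ np] := (bergmanP l p).1 bp.
rewrite integral_area1//.
apply: (@le_lt_trans _ _ (\int[area]_a (C%:E * (P a)%:E))%E); last first.
  have mPE : measurable_fun setT (fun a => (P a)%:E) by exact/measurable_EFinP.
  have PE0 a : setT a -> (0 <= (P a)%:E)%E by rewrite lee_fin.
  have CE0 : (0 <= C%:E)%E by rewrite lee_fin.
  rewrite (ge0_integralZl area measurableT mPE PE0 CE0).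
  exact: lte_mul_pinfty.
apply: ge0_le_integral => //.
- by move=> a _; apply: integral_ge0 => b _; rewrite lee_fin T10.
- apply: (measurable_integral_area2 (G := fun a b => (T1 (a, b))%:E)) => //.
  by move=> a b; rewrite lee_fin T10.
- by apply: emeasurable_funM => //; exact/measurable_EFinP.
move=> a _; have [a0|a0] := ltP 0 a.1; last first.
  rewrite integral0_eq ?mule_ge0 ?lee_fin// => b _.
  by rewrite /T1 /P /= ext_neg// Normc.normc0 expr0n !(mulr0, mul0r).
have s0 : 0 < sg a by rewrite sqrtr_gt0 Re_gmap.
have -> : (fun b => (T1 (a, b))%:E) = (fun b => (P a * sg a)%:E * (schur l (gmap g (toC a)) b)%:E)%E.
  apply/funext => b; rewrite -EFinM /T1 /schur /nk /=; congr ((_ * _)%:E).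
  have [b0|b0] := ltP 0 b.1; first by rewrite kkE1// normc_conj.
  by rewrite /rpart ltNge b0 !mul0r.
have ga0 := Re_gmap g (a0 : 0 < Re (toC a)).
have mS : measurable_fun setT (fun b => (schur l (gmap g (toC a)) b)%:E).
  by apply/measurable_EFinP; exact: measurable_schur.
have S0 b : setT b -> (0 <= (schur l (gmap g (toC a)) b)%:E)%E by rewrite lee_fin schur_ge0.
have Ps0 : (0 <= (P a * sg a)%:E)%E by rewrite lee_fin mulr_ge0 ?sqrtr_ge0.
rewrite (ge0_integralZl area measurableT mS S0 Ps0).
apply: le_trans (lee_wpmul2l Ps0 (integral_schur l ga0)) _.
rewrite -!EFinM lee_fin -/(sg a) -/C le_eqVlt; apply/orP; left; apply/eqP.
by field; rewrite gt_eqF.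
Qed.

Let int_T2 : (\int[area_measure \x area_measure]_t (T2 t)%:E < +oo)%E.
Proof.
have [_ nh] := (bergmanP l h).1 bh.
rewrite integral_area2//.
have MC : `|M| * C >= 0 by rewrite mulr_ge0.
apply: (@le_lt_trans _ _ (\int[area]_b ((`|M| * C)%:E * (H b)%:E))%E); last first.
  have mHE : measurable_fun setT (fun a => (H a)%:E) by exact/measurable_EFinP.
  have HE0 a : setT a -> (0 <= (H a)%:E)%E by rewrite lee_fin.
  have CE0 : (0 <= (`|M| * C)%:E)%E by rewrite lee_fin.
  rewrite (ge0_integralZl area measurableT mHE HE0 CE0).
  exact: lte_mul_pinfty.
apply: ge0_le_integral => //.
- by move=> a _; apply: integral_ge0 => b _; rewrite lee_fin T20.
- apply: (measurable_integral_area1 (G := fun a b => (T2 (a, b))%:E)) => //.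
  by move=> a b; rewrite lee_fin T20.
- by apply: emeasurable_funM => //; exact/measurable_EFinP.
move=> b _; have [b0|b0] := ltP 0 b.1; last first.
  rewrite integral0_eq ?mule_ge0 ?lee_fin// => a _.
  by rewrite /T2 /H /= ext_neg// Normc.normc0 expr0n !(mulr0, mul0r).
have s0 : 0 < Num.sqrt b.1 by rewrite sqrtr_gt0.
pose Q (q : R * R) : \bar R := (N (ext (bker l (toC b)) (toC q)) / Num.sqrt q.1)%:E.
have Q0 q : (0 <= Q q)%E by rewrite lee_fin divr_ge0 ?normc_ge0 ?sqrtr_ge0.
have mQ : measurable_fun setT Q.
  apply/measurable_EFinP; apply: measurable_funM.
    by apply: cmeas_normc; apply: cmeas_ext; exact: analytic_bker.
  by apply: measurable_funVr; exact: ms1.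
have := HM mQ Q0.
have -> : (fun q => ((rpart q * q.1 ^+ l)%:E * Q q)%E) = (fun q => (schur l (toC b) q)%:E).
  by apply/funext => q; rewrite -EFinM.
have Q1 a : setT a -> (0 <= (a.1 ^+ l * N (ext f (toC a)) ^+ 2)%:E * Q (ofC (gmap g (toC a))))%E.
  by move=> _; rewrite mule_ge0// lee_fin weight_ge0.
have mQ1 : measurable_fun setT (fun a : R * R => (a.1 ^+ l * N (ext f (toC a)) ^+ 2)%:E * Q (ofC (gmap g (toC a))))%E.
  apply: emeasurable_funM; first by apply/measurable_EFinP; exact: measurable_sq.
  by apply: measurable_ofC => //; exact: cmeas_gmap.
have -> : (fun a => (T2 (a, b))%:E) = (fun a : R * R => (H b * Num.sqrt b.1)%:E *
    ((a.1 ^+ l * N (ext f (toC a)) ^+ 2)%:E * Q (ofC (gmap g (toC a)))))%E.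
  apply/funext => a; rewrite -!EFinM /T2 /nk /= ofCK /sg /F; congr ((_ * _)%:E).
  have [a0|a0] := ltP 0 a.1; first by rewrite kkE2.
  by rewrite ext_neg// Normc.normc0 expr0n !(mulr0, mul0r).
have Hs0 : (0 <= (H b * Num.sqrt b.1)%:E)%E by rewrite lee_fin mulr_ge0 ?sqrtr_ge0.
rewrite (ge0_integralZl area measurableT mQ1 Q1 Hs0) => HQ.
apply: le_trans (lee_wpmul2l Hs0 HQ) _.
have I0 : (0 <= \int[area]_q (schur l (toC b) q)%:E)%E.
  by apply: integral_ge0 => q _; rewrite lee_fin schur_ge0.
have M1 : (M%:E * \int[area]_q (schur l (toC b) q)%:E <= (`|M| * (C / Num.sqrt b.1))%:E)%E.
  rewrite EFinM; apply: (@le_trans _ _ (`|M|%:E * \int[area]_q (schur l (toC b) q)%:E)%E).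
    by apply: lee_wpmul2r => //; rewrite lee_fin ler_norm.
  by apply: lee_wpmul2l; [rewrite lee_fin|exact: (integral_schur l (b0 : 0 < Re (toC b)))].
apply: le_trans (lee_wpmul2l Hs0 M1) _.
rewrite -!EFinM lee_fin le_eqVlt; apply/orP; left; apply/eqP.
by field; rewrite gt_eqF.
Qed.

Let cintegrable_D : cintegrable (area_measure \x area_measure)%E D.
Proof.
have mT := emeasurable_funD mT1 mT2.
have le t : ((N (D t))%:E <= (T1 t)%:E + (T2 t)%:E)%E by rewrite -EFinD lee_fin normc_D_le.
apply: (@cintegrable_le _ _ _ (area_measure \x area_measure)%E D _ cmeas_D mT le).
have E1 t : setT t -> (0 <= (T1 t)%:E)%E by rewrite lee_fin.
have E2 t : setT t -> (0 <= (T2 t)%:E)%E by rewrite lee_fin.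
rewrite (ge0_integralD (area_measure \x area_measure)%E measurableT E1 mT1 E2 mT2).
exact: lte_add_pinfty.
Qed.

Lemma bergman_dot_Wop (q : Cplus R -> R[i]) :
  (forall v, 0 < Re v -> bergman_dot l (Wop f g (bker l v)) p = conjc (ext q v)) ->
  (forall v, 0 < Re v -> bergman l (Wop f g (bker l v))) ->
  bergman l (Wop f g h) -> bergman l q ->
  bergman_dot l (Wop f g h) p = bergman_dot l h q.
Proof.
move=> Hq Hb bW bq.
have pin : (pi : R)%:C != 0 by rewrite fmorph_eq0 gt_eqF// pi_gt0.
have dotpi (u v : Cplus R -> R[i]) : cint area (dotf l u v) = pi%:C * bergman_dot l u v.
  by rewrite bergman_dotE mulrA -rmorphM mulfV ?gt_eqF ?pi_gt0// mul1r.
have I1 : cint (area_measure \x area_measure)%E D = pi%:C * cint area (dotf l (Wop f g h) p).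
  rewrite cint_area1//.
  have -> : (fun a => cint area (fun b => D (a, b))) = (fun a => pi%:C * dotf l (Wop f g h) p a).
    apply/funext => a; under eq_fun do rewrite DE1.
    have [a0|a0] := ltP 0 a.1; last first.
      have F00 : ext f (toC a) = 0 by exact: ext_neg.
      have W0 : ext (Wop f g h) (toC a) = 0 by exact: ext_neg.
      have -> : (fun b => (a.1 ^+ l)%:C * (ext f (toC a) * conjc (ext p (toC a))) *
          dotf l h (bker l (gmap g (toC a))) b) = (fun b => 0 * dotf l h h b).
        by apply/funext => b; rewrite F00 mul0r mulr0 !mul0r.
      by rewrite (cintZ 0 (cintegrable_dotf bh bh)) /dotf W0 !mul0r !mulr0.
    have ga0 := Re_gmap g (a0 : 0 < Re (toC a)).
    rewrite (cintZ _ (cintegrable_dotf bh (bergman_bker l ga0))) dotpi (reproducing bh ga0).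
    by rewrite /dotf (ext_Wop f g h (a0 : 0 < Re (toC a))); ring.
  by rewrite (cintZ _ (cintegrable_dotf bW bp)).
have I2 : cint (area_measure \x area_measure)%E D = pi%:C * cint area (dotf l h q).
  rewrite cint_area2//.
  have -> : (fun b => cint area (fun a => D (a, b))) = (fun b => pi%:C * dotf l h q b).
    apply/funext => b; under eq_fun do rewrite DE2.
    have [b0|b0] := ltP 0 b.1; last first.
      have H00 : ext h (toC b) = 0 by exact: ext_neg.
      have -> : (fun a => (b.1 ^+ l)%:C * ext h (toC b) *
          dotf l (Wop f g (bker l (toC b))) p a) = (fun a => 0 * dotf l h h a).
        by apply/funext => a; rewrite H00 mulr0 !mul0r.
      by rewrite (cintZ 0 (cintegrable_dotf bh bh)) /dotf H00 !mul0r !mulr0.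
    have b1 : 0 < Re (toC b) by [].
    rewrite (cintZ _ (cintegrable_dotf (Hb _ b1) bp)) dotpi (Hq _ b1).
    by rewrite /dotf; ring.
  by rewrite (cintZ _ (cintegrable_dotf bh bq)).
apply: (mulfI pin); rewrite -!dotpi; apply: (mulfI pin).
by rewrite -I1 I2.
Qed.

End KernelFubini.

(** * Sufficiency and boundedness *)

Section Operators.
Context {R : realType}.
Local Notation area := ((@lebesgue_measure R) \x (@lebesgue_measure R))%E.

Lemma conjc_mul (a b : R[i]) : conjc (a * b) = conjc a * conjc b.
Proof. exact: rmorphM. Qed.

Lemma conjc_exp (a : R[i]) n : conjc (a ^+ n) = conjc a ^+ n.
Proof. exact: rmorphXn. Qed.

Lemma num_conjE (a : R[i]) : Num.conj a = conjc a. Proof. by []. Qed.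

Lemma ext_scale (c : R[i]) (h : Cplus R -> R[i]) z : ext (fun w => c * h w) z = c * ext h z.
Proof.
have [z0|z0] := ltP 0 (Re z); first by rewrite !(ext_pos _ z0).
by rewrite !ext_neg// mulr0.
Qed.

Lemma bsq_scale l (c : R[i]) (h : Cplus R -> R[i]) : analytic h ->
  bsq l (fun w => c * h w) = ((N c ^+ 2)%:E * bsq l h)%E.
Proof.
move=> ah; have mh : measurable_fun setT (fun p : R * R => (p.1 ^+ l * N (ext h (toC p)) ^+ 2)%:E).
  by apply/measurable_EFinP; exact: measurable_sq.
have h0 (p : R * R) : setT p -> (0 <= (p.1 ^+ l * N (ext h (toC p)) ^+ 2)%:E)%E.
  by rewrite lee_fin weight_ge0.
have c0 : (0 <= (N c ^+ 2)%:E)%E by rewrite lee_fin sqr_ge0.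
rewrite /bsq -(ge0_integralZl area measurableT mh h0 c0); apply: eq_integral => p _.
by rewrite ext_scale Normc.normcM exprMn -EFinM mulrCA.
Qed.

Lemma analytic_scale (c : R[i]) (h : Cplus R -> R[i]) : analytic h -> analytic (fun w => c * h w).
Proof.
move=> /analytic_cdiff ah; apply: (@analytic_of_cdiff _ _ (fun w => c * ext h w)).
  by move=> z; rewrite ext_val.
by move=> z z0; apply: cdiffM; [exact: cdiff_cst|exact: ah].
Qed.

Lemma bergman_scale l (c : R[i]) (h : Cplus R -> R[i]) : bergman l h -> bergman l (fun w => c * h w).
Proof.
move=> /bergmanP[ah nh]; apply/bergmanP; split; first exact: analytic_scale.
by rewrite bsq_scale//; apply: lte_mul_pinfty => //; rewrite lee_fin sqr_ge0.
Qed.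

Lemma bergman_dotZl l c (h k : Cplus R -> R[i]) : bergman l h -> bergman l k ->
  bergman_dot l (fun w => c * h w) k = c * bergman_dot l h k.
Proof.
move=> bh bk; rewrite !bergman_dotE mulrCA -(cintZ c (cintegrable_dotf bh bk)).
by congr (_ * _); congr cint; apply/funext => p; rewrite /dotf ext_scale; ring.
Qed.

Lemma bergman_dot_conj l (h k : Cplus R -> R[i]) : bergman l h -> bergman l k ->
  bergman_dot l k h = conjc (bergman_dot l h k).
Proof.
move=> bh bk; rewrite !bergman_dotE.
have cr (x : R) : conjc x%:C = x%:C by rewrite /conjc /= oppr0.
rewrite conjc_mul cr -(cint_conj (cintegrable_dotf bh bk)).
congr (_ * cint _ _); apply/funext => p; rewrite /dotf !conjc_mul cr conjcK.
by rewrite [conjc (ext h _) * _]mulrC.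
Qed.

Lemma bergman_dotZr l c (h k : Cplus R -> R[i]) : bergman l h -> bergman l k ->
  bergman_dot l h (fun w => c * k w) = conjc c * bergman_dot l h k.
Proof.
move=> bh bk; rewrite (bergman_dot_conj (bergman_scale c bk) bh) bergman_dotZl// conjc_mul.
by rewrite (bergman_dot_conj bh bk) conjcK.
Qed.

Lemma bergman_ext_eq l (u v : Cplus R -> R[i]) : bergman l u -> bergman l v ->
  (forall h, bergman l h -> bergman_dot l h u = bergman_dot l h v) -> u = v.
Proof.
move=> bu bv H; apply/funext => z; have z0 : 0 < Re (val z) by case: z.
have bz := bergman_bker l z0.
rewrite -(ext_val u) -(ext_val v) -(reproducing bu z0) -(reproducing bv z0).
by rewrite (bergman_dot_conj bz bu) (bergman_dot_conj bz bv) H.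
Qed.

Lemma bsq_fin_num l (h : Cplus R -> R[i]) : bergman l h -> bsq l h \is a fin_num.
Proof. by move=> /bergmanP[_ nh]; rewrite ge0_fin_numE// bsq_ge0. Qed.

(** The pointwise bound [2 |h K| <= |h|^2 + |K|^2] is not homogeneous in [h]. Applied to [s h] with
    the best [s], it yields the homogeneous estimate. *)
Lemma bergman_eval_bound l (z : R[i]) : 0 < Re z ->
  exists2 c : R, 0 <= c & forall h, bergman l h -> N (ext h z) ^+ 2 <= c * fine (bsq l h).
Proof.
move=> z0; have bz := bergman_bker l z0.
pose B : R := fine (bsq l (bker l z)).
have B0 : 0 <= B by rewrite fine_ge0 ?bsq_ge0.
have p0 : 0 < (pi : R) := pi_gt0 R.
pose d : R := pi^-1 * 2.
have d0 : 0 < d by rewrite mulr_gt0 ?invr_gt0.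
have key h : bergman l h -> N (ext h z) <= d * (fine (bsq l h) + B).
  move=> bh; rewrite -(reproducing bh z0) bergman_dotE Normc.normcM normc_real.
  rewrite ger0_norm ?invr_ge0 ?(ltW p0)// /d -mulrA ler_wpM2l ?invr_ge0 ?(ltW p0)//.
  rewrite -lee_fin; apply: le_trans (normc_cint_le (cintegrable_dotf bh bz)) _.
  rewrite EFinM (EFinD (fine (bsq l h)) B) (fineK (bsq_fin_num bh)) (fineK (bsq_fin_num bz)).
  apply: lee_wpmul2l => //.
  have [ah _] := (bergmanP l h).1 bh; have [az _] := (bergmanP l _).1 bz.
  have m1 : measurable_fun setT (fun p : R * R => (p.1 ^+ l * N (ext h (toC p)) ^+ 2)%:E).
    by apply/measurable_EFinP; exact: measurable_sq.
  have m2 : measurable_fun setT (fun p : R * R => (p.1 ^+ l * N (ext (bker l z) (toC p)) ^+ 2)%:E).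
    by apply/measurable_EFinP; exact: measurable_sq.
  have h1 (p : R * R) : setT p -> (0 <= (p.1 ^+ l * N (ext h (toC p)) ^+ 2)%:E)%E.
    by rewrite lee_fin weight_ge0.
  have h2 (p : R * R) : setT p -> (0 <= (p.1 ^+ l * N (ext (bker l z) (toC p)) ^+ 2)%:E)%E.
    by rewrite lee_fin weight_ge0.
  rewrite /bsq -(ge0_integralD area measurableT h1 m1 h2 m2).
  apply: ge0_le_integral => //.
  - by move=> p _; rewrite lee_fin normc_ge0.
  - by apply/measurable_EFinP; apply: cmeas_normc; exact: cmeas_dotf.
  - exact: emeasurable_funD.
  - by move=> p _; rewrite -EFinD lee_fin normc_dotf_le.
have keyS h (s : R) : bergman l h -> 0 < s -> s * N (ext h z) <= d * (s ^+ 2 * fine (bsq l h) + B).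
  move=> bh s0; have := key _ (bergman_scale s%:C bh).
  rewrite ext_scale Normc.normcM normc_real gtr0_norm// bsq_scale; last by have [] := (bergmanP l h).1 bh.
  by rewrite normc_real gtr0_norm// fineM ?bsq_fin_num.
exists ((d * (1 + B)) ^+ 2) => [|h bh]; first exact: sqr_ge0.
have A0 : 0 <= fine (bsq l h) by rewrite fine_ge0 ?bsq_ge0.
have X0 := normc_ge0 (ext h z).
(* If [h] has norm 0 the scale [s] is free, and a large one contradicts the bound unless [h z = 0].
   Otherwise [s] normalizes [bsq l h] to 1. *)
move: A0; rewrite le_eqVlt => /orP[/eqP A0|A0].
  rewrite -A0 mulr0; have [->|X1] := eqVneq (N (ext h z)) 0; first by rewrite expr0n.
  have {}X1 : 0 < N (ext h z) by rewrite lt0r X1.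
  have sp : 0 < (d * B + 1) / N (ext h z) by rewrite divr_gt0// ltr_wpDl// mulr_ge0// ltW.
  have := keyS h _ bh sp; rewrite -A0 mulr0 add0r divfK ?gt_eqF//.
  by rewrite gerDl ler10.
have s0 : 0 < (Num.sqrt (fine (bsq l h)))^-1 by rewrite invr_gt0 sqrtr_gt0.
have := keyS h _ bh s0; rewrite exprVn sqr_sqrtr ?(ltW A0)// mulVf ?gt_eqF//.
rewrite ler_pdivrMl ?sqrtr_gt0// => H.
have -> : (d * (1 + B)) ^+ 2 * fine (bsq l h) = (Num.sqrt (fine (bsq l h)) * (d * (1 + B))) ^+ 2.
  by rewrite [RHS]exprMn sqr_sqrtr ?(ltW A0)// mulrC.
by apply: lerXn2r; rewrite // nnegrE (le_trans X0).
Qed.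

Lemma bounded_op_W l f g (M : R) : 0 <= M ->
  (forall h, bergman l h -> bergman l (Wop f g h) /\ (bsq l (Wop f g h) <= M%:E * bsq l h)%E) ->
  bounded_op l (@W_max R l f g).
Proof.
move=> M0 H; split.
  apply/seteqP; split => h /=; first by case=> u [].
  by move=> bh; exists (Wop f g h); split => //; have [] := H h bh.
(* The summand 1 keeps the bound positive when [M = 0]. *)
exists (Num.sqrt M + 1) => [|h u [/= bh _ ->]]; first by rewrite ltr_wpDl ?sqrtr_ge0.
have [bW W_le] := H h bh.
apply: (@le_trans _ _ (Num.sqrt M * bergman_norm l h)); last first.
  by apply: ler_wpM2r; rewrite ?sqrtr_ge0// lerDl.
rewrite /bergman_norm -sqrtrM// !bergman_sqnormE; apply: ler_wsqrtr.
have fW := bsq_fin_num bW; have fh := bsq_fin_num bh.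
rewrite !fineM// mulrCA ler_wpM2l ?invr_ge0 ?pi_ge0//.
by rewrite -lee_fin EFinM (fineK fW) (fineK fh).
Qed.

Definition kernel_symmetric l (f : Cplus R -> R[i]) (g : Cplus R -> Cplus R) :=
  forall w z, f w / (1 + val z * val (g w)) ^+ (l + 2) = f z / (1 + val (g z) * val w) ^+ (l + 2).

Lemma val_neq0 (z : Cplus R) : val z != 0.
Proof. by apply: Re_neq0; case: z. Qed.

(** With [z = 1 / conj v] one has [g w + conj v = (1 + z * g w) / z], so the symmetry turns [W K_v]
    into a multiple of the kernel at [1 / conj (g z)]. *)
Lemma Wop_bker l f g (v : Cplus R) : kernel_symmetric l f g ->
  Wop f g (bker l (val v)) = (fun w => (f (inv_conj v) * val (inv_conj v) ^+ (l + 2) /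
     val (g (inv_conj v)) ^+ (l + 2)) * bker l (val (inv_conj (g (inv_conj v)))) w).
Proof.
move=> sfg; apply/funext => w; rewrite /Wop /bker !num_conjE.
set z := inv_conj v; set G := g z.
have -> : conjc (val v) = (val z)^-1 by rewrite /z /= ?num_conjE invrK.
have -> : conjc (val (inv_conj G)) = (val G)^-1 by rewrite /= ?num_conjE conjc_inv conjcK.
have z0 := val_neq0 z; have G0 := val_neq0 G.
have -> : val (g w) + (val z)^-1 = (1 + val z * val (g w)) / val z by field.
have -> : val w + (val G)^-1 = (1 + val G * val w) / val G by field.
have := sfg w z; rewrite -/G.
rewrite !expr_div_n !invfM !invrK.
move: ((1 + val z * val (g w)) ^+ (l + 2))^-1 ((1 + val G * val w) ^+ (l + 2))^-1 => A B E.
have zn : val G ^+ (l + 2) != 0 by rewrite expf_neq0.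
rewrite (_ : f w * _ = (f w * A) * ((kconst l)%:C * val z ^+ (l + 2))); last by ring.
by rewrite E; field.
Qed.

Lemma dot_Wop_bker l f g k v : kernel_symmetric l f g -> bergman l k -> 0 < Re v ->
  bergman_dot l (Wop f g (bker l v)) (C_star l k) = conjc (ext (C_star l (Wop f g k)) v).
Proof.
move=> sfg bk v0; have -> : v = val (exist _ v v0 : Cplus R) by [].
move: (exist _ v v0) => {v0}u.
rewrite ext_val Wop_bker//; set z := inv_conj u; set G := g z.
have G0 : 0 < Re (val (inv_conj G)) by case: (inv_conj G).
have bG := bergman_bker l G0; have bC := bergman_C_star bk.
rewrite bergman_dotZl// (bergman_dot_conj bC bG) (reproducing bC G0) ext_val.
rewrite /C_star inv_conjK -/z /Wop -/G.
rewrite !conjc_mul !conjc_inv !conjc_exp ?num_conjE ?conjc_mul ?conjc_inv ?conjc_exp !conjcK.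
have zE : val z = (conjc (val u))^-1 by rewrite /z /= ?num_conjE.
have -> : (val G)^-1 ^- (l + 2) = val G ^+ (l + 2) by rewrite exprVn invrK.
have -> : conjc (val u) ^- (l + 2) = val z ^+ (l + 2) by rewrite zE exprVn.
have Gn : val G ^+ (l + 2) != 0 by rewrite expf_neq0// val_neq0.
by field.
Qed.

(** With full domain the adjoint is single valued: by the second hypothesis it sends [C k] to
    [C (W k)], and [bergman_ext_eq] excludes any other value. *)
Lemma selfadjoint_W l f g : (forall h, bergman l h -> bergman l (Wop f g h)) ->
  (forall h k, bergman l h -> bergman l k ->
     bergman_dot l (Wop f g h) (C_star l k) = bergman_dot l h (C_star l (Wop f g k))) ->
  C_selfadjoint l (C_star l) (@W_max R l f g).
Proof.
move=> bW H; split.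
  move=> h bh e e0; exists h; first by exists (Wop f g h); split => //; exact: bW.
  have -> : bergman_norm l (h \- h) = 0.
    rewrite /bergman_norm bergman_sqnormE /bsq integral0_eq ?mule0 ?sqrtr0// => p _.
    have -> : h \- h = (fun w => 0 * h w) by apply/funext => w /=; rewrite subrr mul0r.
    by rewrite ext_scale mul0r Normc.normc0 expr0n mulr0.
  by [].
have adj h : bergman l h -> bergman l (C_star l (Wop f g h)).
  by move=> bh; apply: bergman_C_star; exact: bW.
apply/seteqP; split => -[a b].
  move=> [/= ba bWa ->]; split => //=; exists (C_star l (Wop f g a)); last by rewrite C_starK.
  split => /=; [exact: bergman_C_star|exact: adj|].
  by move=> h u [/= bh _ ->]; exact: H.
move=> [/= ba [u [/= bCa bu Hu] ->]]; split => //=; first exact: bW.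
suff -> : u = C_star l (Wop f g a) by rewrite C_starK.
apply: (bergman_ext_eq bu (adj _ ba)) => h bh; rewrite -H//; symmetry; apply: Hu.
by split => //; exact: bW.
Qed.

Lemma Wop_bounded_change l (f : Cplus R -> R[i]) g M h : analytic f -> analytic (fun z => val (g z)) ->
  bounded_change l f g M -> bergman l h ->
  bergman l (Wop f g h) /\ (bsq l (Wop f g h) <= M%:E * bsq l h)%E.
Proof.
move=> af ag HM bh; have [ah nh] := (bergmanP l h).1 bh.
have W_le := bsq_Wop af ag ah HM; split; last exact: W_le.
apply/bergmanP; split; first exact: (analytic_Wop af ag ah).
by apply: le_lt_trans W_le _; rewrite -(fineK (bsq_fin_num bh)) -EFinM ltry.
Qed.

Lemma selfadjoint_bounded_change l (f : Cplus R -> R[i]) g M : analytic f -> analytic (fun z => val (g z)) ->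
  0 <= M -> bounded_change l f g M -> kernel_symmetric l f g ->
  C_selfadjoint l (C_star l) (@W_max R l f g) /\ bounded_op l (@W_max R l f g).
Proof.
move=> af ag M0 HM sfg.
have HW h : bergman l h -> bergman l (Wop f g h) /\ (bsq l (Wop f g h) <= M%:E * bsq l h)%E.
  exact: Wop_bounded_change.
split; last exact: bounded_op_W HW.
apply: selfadjoint_W => [h bh|h k bh bk]; first by have [] := HW h bh.
have [bWk _] := HW k bk; have [bWh _] := HW h bh.
have bK v : 0 < Re v -> bergman l (Wop f g (bker l v)).
  by move=> v0; have [] := HW _ (bergman_bker l v0).
have dK v : 0 < Re v -> bergman_dot l (Wop f g (bker l v)) (C_star l k) =
    conjc (ext (C_star l (Wop f g k)) v).
  exact: (dot_Wop_bker sfg bk).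
exact: (bergman_dot_Wop af ag HM bh (bergman_C_star bk) dK bK bWh (bergman_C_star bWk)).
Qed.

Lemma kconst_neq0 l : (kconst l)%:C != 0 :> R[i].
Proof. by rewrite fmorph_eq0 gt_eqF// kconst_gt0. Qed.

Lemma constant_case_selfadjoint l (f : Cplus R -> R[i]) g : constant_case l f g ->
  C_selfadjoint l (C_star l) (W_max l f g) /\ bounded_op l (W_max l f g).
Proof.
move=> [al [be fg]].
have gE w : g w = al by have [] := fg w.
have fE w : f w = be / (1 + val al * val w) ^+ (l + 2) by have [] := fg w.
have a0 := val_neq0 al.
have sfg : kernel_symmetric l f g.
  by move=> w z; rewrite !gE !fE [val z * _]mulrC mulrAC.
have fker : f = (fun w => (be / val al ^+ (l + 2) / (kconst l)%:C) * bker l (val (inv_conj al)) w).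
  apply/funext => w; rewrite fE /bker num_conjE.
  have -> : conjc (val (inv_conj al)) = (val al)^-1 by rewrite /= ?num_conjE conjc_inv conjcK.
  have -> : val w + (val al)^-1 = (1 + val al * val w) / val al by field.
  rewrite expr_div_n invfM invrK; have k0 := kconst_neq0 l.
  move: ((1 + val al * val w) ^+ (l + 2))^-1 => A.
  have an : val al ^+ (l + 2) != 0 by rewrite expf_neq0.
  by field; rewrite an k0.
have al0 : 0 < Re (val al) by case: al {fg gE fE a0 sfg fker}.
have i0 : 0 < Re (val (inv_conj al)) by case: (inv_conj al).
have bf : bergman l f by rewrite fker; apply: bergman_scale; exact: bergman_bker.
have WE h : Wop f g h = (fun w => h al * f w).
  by apply/funext => w; rewrite /Wop gE mulrC.
have bW h : bergman l (Wop f g h) by rewrite WE; exact: bergman_scale.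
split.
  apply: selfadjoint_W => [h _|h k bh bk]; first exact: bW.
  have bC := bergman_C_star bk.
  set D := bergman_dot l f (C_star l k).
  have CE : C_star l (Wop f g k) = (fun v => conjc D * bker l (val al) v).
    apply/funext => v; have v0 : 0 < Re (val v) by case: v.
    have := dot_Wop_bker sfg bk v0; rewrite ext_val WE bergman_dotZl// -/D => E.
    rewrite -[LHS]conjcK -E conjc_mul mulrC; congr (_ * _).
    rewrite /bker num_conjE num_conjE conjc_mul conjc_inv conjc_exp.
    have -> : conjc ((kconst l)%:C : R[i]) = (kconst l)%:C by rewrite /conjc /= oppr0.
    congr (_ / _ ^+ _); apply/eqP; rewrite eq_complex !(ReDc, ImDc, Re_conjc, Im_conjc)/=.
    by apply/andP; split; apply/eqP; ring.
  rewrite WE (bergman_dotZl _ bf bC) CE (bergman_dotZr _ bh (bergman_bker l al0)).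
  by rewrite conjcK (reproducing bh al0) ext_val mulrC.
have [c c0 Hc] := bergman_eval_bound l al0.
have A0 : 0 <= fine (bsq l f) by rewrite fine_ge0 ?bsq_ge0.
apply: (@bounded_op_W l f g (c * fine (bsq l f))); first exact: mulr_ge0.
move=> h bh; split => //.
rewrite WE bsq_scale; last by have [] := (bergmanP l f).1 bf.
rewrite -(fineK (bsq_fin_num bf)) -(fineK (bsq_fin_num bh)) -!EFinM lee_fin.
have := Hc h bh; rewrite ext_val => E.
by rewrite [leRHS]mulrAC; apply: ler_wpM2r.
Qed.

Lemma dilation_case_selfadjoint l (f : Cplus R -> R[i]) g : analytic f ->
  analytic (fun z => val (g z)) -> dilation_case f g ->
  C_selfadjoint l (C_star l) (W_max l f g) /\ bounded_op l (W_max l f g).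
Proof.
move=> af ag [la [th [la0 fg]]].
have HM := dilation_bounded_change l af ag la0 fg.
apply: (selfadjoint_bounded_change af ag _ HM).
  by rewrite divr_ge0 ?sqr_ge0// exprn_ge0// ltW.
move=> w z; have [-> ->] := fg w; have [-> ->] := fg z.
by congr (_ / (1 + _) ^+ _); ring.
Qed.

Lemma moebius_case_selfadjoint l (f : Cplus R -> R[i]) g : analytic f ->
  analytic (fun z => val (g z)) -> moebius_case l f g ->
  C_selfadjoint l (C_star l) (W_max l f g) /\ bounded_op l (W_max l f g).
Proof.
move=> af ag [de [ka [r [cond fg]]]].
pose ga := 1 - de * ka.
have Rga : Re ga = 1 - Re (de * ka) by rewrite /ga ReDc ReNc.
(* Both alternatives on the parameters are brought to the hypotheses of [moebius_Re]. In the second,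
   [Re ka >= 0] follows from [Re ga <= |ga|] and [Re de > 0]. *)
have [k0 [d0 [H Hd]]] : 0 <= Re ka /\ 0 <= Re de /\
    N ga - Re ga <= 2 * Re ka * Re de /\ (Re de = 0 -> 0 < Re ga).
  case: cond => [[d0 i0 dk1 k0]|[d0 Hk]].
    have g0 : 0 < Re ga by rewrite Rga subr_gt0.
    split => //; split; first by rewrite d0.
    split => //; rewrite d0 mulr0 subr_le0.
    have I0 : Im ga = 0 by rewrite /ga ImDc ImNc i0 subr0.
    have := sqr_normcE ga; rewrite I0 expr0n addr0 => E.
    rewrite -(ler_pXn2r (n := 2))// ?nnegrE ?normc_ge0 ?(ltW g0)//.
    by rewrite E.
  have {}d0 : 0 < Re de by rewrite -oppr_lt0.
  have Ng : N (de * ka - 1) = N ga by rewrite normcB_sym.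
  have Rg : Re (de * ka - 1) = - Re ga by rewrite /ga !(ReDc, ReNc) opprB.
  move: Hk; rewrite Ng Rg subr_ge0 ler_pdivrMr ?mulr_gt0// => Hk.
  have G0 : 0 <= N ga - Re ga by rewrite subr_ge0 (le_trans (ler_norm _))// normc_Re.
  have Hk' : N ga - Re ga <= 2 * Re ka * Re de.
    by rewrite addrC (le_trans Hk)// le_eqVlt; apply/orP; left; apply/eqP; ring.
  split; last by split; [exact: ltW|split => // d1; rewrite d1 ltxx in d0].
  have : 0 <= 2 * Re ka * Re de by apply: le_trans Hk'.
  by rewrite -mulrA pmulr_rge0// pmulr_lge0.
have zk (w : Cplus R) : val w + ka != 0.
  by apply: Re_neq0; rewrite ReDc ltr_wpDr//; case: w.
(* For [ga = 0] the Moebius map degenerates to the constant [de]. *)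
have [ga0|ga0] := eqVneq ga 0.
  have dk : de * ka = 1 by apply/esym/eqP; rewrite -subr_eq0; apply/eqP.
  have dn : de != 0 by apply: contraTneq (oner_neq0 R[i]) => de0; rewrite negbK -dk de0 mul0r.
  have {}d0 : 0 < Re de.
    rewrite lt_neqAle d0 andbT; apply/eqP => /esym/Hd; rewrite ga0 ltxx//.
  apply: constant_case_selfadjoint; exists (exist _ de d0), (r * de ^+ (l + 2)) => w.
  have [gw ->] := fg w; split.
    by apply: val_inj; rewrite gw -/ga ga0 mul0r addr0.
  have -> : 1 + de * val w = de * (val w + ka) by rewrite -dk; ring.
  have zn : (val w + ka) ^+ (l + 2) != 0 by rewrite expf_neq0.
  have den : de ^+ (l + 2) != 0 by rewrite expf_neq0.
  by rewrite exprMn; field; rewrite zn den.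
have geo z : 0 < Re z -> N ga * Re z <= N (z + ka) ^+ 2 * Re (de + ga / (z + ka)).
  by apply: moebius_Re => // d1; rewrite ltW// Hd.
have HM := moebius_bounded_change af ag ga0 k0 geo fg.
apply: (selfadjoint_bounded_change af ag _ HM).
  by rewrite divr_ge0 ?sqr_ge0// exprn_ge0// normc_ge0.
move=> w z; have [-> ->] := fg w; have [-> ->] := fg z.
have zw := zk w; have zz := zk z.
rewrite -!mulrA -!invfM -!exprMn; congr (_ / _ ^+ _); rewrite /ga.
by field; rewrite zw zz.
Qed.

End Operators.

(** * Necessity *)

Section Rigidity.
Context {R : realType}.

(** If [rho] is not 1, its powers up to [n] sum to 0, so the numbers [rho ^+ i - 1] sum to [- n.+1].
    But each has norm at most [n * N (rho - 1)], which is below 1. *)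
Lemma root_unity_gap (rho : R[i]) n : rho ^+ n.+1 = 1 -> N (rho - 1) < n.+1%:R^-1 -> rho = 1.
Proof.
move=> E H; have N1 : N rho = 1.
  have := congr1 (fun t => N t) E; rewrite normcX (_ : N 1 = 1); last first.
    by rewrite -[1]/(1%:C) normc_real normr1.
  by move/eqP; rewrite pexpr_eq1 ?normc_ge0// => /eqP.
have P k : N (rho ^+ k - 1) <= k%:R * N (rho - 1).
  elim: k => [|k IH]; first by rewrite expr0 subrr Normc.normc0 mul0r.
  have -> : rho ^+ k.+1 - 1 = rho * (rho ^+ k - 1) + (rho - 1) by rewrite exprS; ring.
  apply: le_trans (le_normcD _ _) _; rewrite Normc.normcM N1 mul1r.
  by rewrite -natr1 mulrDl mul1r lerD2r.
move/eqP: E; rewrite expfS_eq1 => /orP[/eqP//|/eqP S0]; exfalso.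
have n0 : 0 < (n.+1%:R : R) by rewrite ltr0n.
have : N (\sum_(i < n.+1) (rho ^+ i - 1)) <= \sum_(i < n.+1) N (rho - 1) * n%:R.
  elim/big_ind2 : _ => [|x1 x2 y1 y2 h1 h2|i _]; first by rewrite Normc.normc0.
    by apply: le_trans (le_normcD _ _) _; exact: lerD.
  apply: le_trans (P i) _; rewrite mulrC ler_wpM2l ?normc_ge0// ler_nat -ltnS; exact: ltn_ord.
rewrite sumr_const card_ord sumrB S0 sumr_const card_ord sub0r normcN.
rewrite (_ : N (1 *+ n.+1) = n.+1%:R); last first.
  by rewrite -[1 *+ n.+1](rmorph_nat (real_complex R)) normc_real ger0_norm.
rewrite -[leRHS]mulr_natl; apply/negP; rewrite -ltNge -[ltRHS]mulr1 ltr_pM2l//.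
have [->|np] := posnP n; first by rewrite mulr0.
have n1 : 0 < (n%:R : R) by rewrite ltr0n.
apply: (@lt_le_trans _ _ (n.+1%:R^-1 * n%:R)); first by rewrite ltr_pM2r.
by rewrite ler_pdivrMl// mulr1 ler_nat.
Qed.

(** By the gap between roots of unity [F] is locally constant. Its restriction to the segment from
    [w] to [z] then has derivative 0, and integrating this compares the end points. *)
Lemma root_unity_const (F : R[i] -> R[i]) n : (forall z, 0 < Re z -> cdiff F z) ->
  (forall z, 0 < Re z -> F z ^+ n.+1 = 1) ->
  forall z w, 0 < Re z -> 0 < Re w -> F z = F w.
Proof.
move=> dF F1 z w z0 w0.
have loc p : 0 < Re p -> exists2 r : R, 0 < r & forall q, N (q - p) < r -> F q = F p.
  move=> p0; have n0 : 0 < (n.+1%:R : R)^-1 by rewrite invr_gt0.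
  have [r r0 Hr] := cdiff_continuous (dF p p0) n0.
  exists (Num.min r (Re p)) => [|q]; first by rewrite lt_min r0.
  rewrite lt_min => /andP[qr qp].
  have q0 : 0 < Re q.
    have := le_lt_trans (normc_Re _) qp; rewrite ReDc ReNc ltr_norml => /andP[+ _].
    by rewrite ltrBrDr addNr.
  have Fp : F p != 0.
    by apply: contra_eq_neq (F1 p p0) => ->; rewrite expr0n eq_sym oner_eq0.
  have NF : N (F p) = 1.
    have := congr1 (fun t => N t) (F1 p p0); rewrite normcX (_ : N 1 = 1); last first.
      by rewrite -[1]/(1%:C) normc_real normr1.
    by move/eqP; rewrite pexpr_eq1 ?normc_ge0// => /eqP.
  have : F q / F p = 1.
    apply: (@root_unity_gap _ n); first by rewrite expr_div_n !F1// divr1.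
    have -> : F q / F p - 1 = (F q - F p) / F p by field.
    by rewrite Normc.normcM Normc.normcV NF invr1 mulr1; exact: Hr.
  by move/(congr1 (fun t => t * F p)); rewrite divfK// mul1r.
pose H (u : R[i]) := F (w + u * (z - w)).
have Hd (x : R) : 0 <= x <= 1 -> cderiv H (x +i* 0) 0.
  move=> /andP[x0 x1] e e0; set p := w + (x +i* 0) * (z - w).
  have p0 : 0 < Re p.
    rewrite /p ReDc ReMc ReDc ReNc/= mul0r subr0.
    have [->|xn] := eqVneq x 0; first by rewrite mul0r addr0.
    have -> : Re w + x * (Re z - Re w) = (1 - x) * Re w + x * Re z by ring.
    apply: ltr_wpDl; first by rewrite mulr_ge0 ?subr_ge0// ltW.
    by rewrite mulr_gt0// lt0r xn.
  have [r r0 Hr] := loc p p0; have K0 : 0 < N (z - w) + 1 by rewrite ltr_wpDl// normc_ge0.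
  exists (r / (N (z - w) + 1)) => [|u]; first exact: divr_gt0.
  rewrite ltr_pdivlMr// => ur.
  have -> : H u = H (x +i* 0).
    apply: Hr; have -> : w + u * (z - w) - p = (u - (x +i* 0)) * (z - w) by rewrite /p; ring.
    rewrite Normc.normcM; apply: le_lt_trans ur; apply: ler_wpM2l; first exact: normc_ge0.
    by rewrite lerDl.
  by rewrite subrr mul0r subrr Normc.normc0 mulr_ge0 ?normc_ge0// ltW.
have [] := @rint_cderiv R H (fun=> 0) 0 1 ltr01 Hd (fun x _ => cdiff_cst 0 _).
have r0 : rint (fun=> 0 : R) 0 1 = 0 by rewrite /rint /Rintegral integral0_eq.
have -> : H (1 +i* 0) = F z by rewrite /H -[1 +i* 0]/(1 : R[i]) mul1r addrC subrK.
have -> : H (0 +i* 0) = F w by rewrite /H -[0 +i* 0]/(0 : R[i]) mul0r addr0.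
rewrite /= r0 => /eqP; rewrite eq_sym subr_eq0 => /eqP e1 /eqP; rewrite eq_sym subr_eq0 => /eqP e2.
by apply/eqP; rewrite eq_complex e1 e2 !eqxx.
Qed.

End Rigidity.

(** * From the kernel symmetry to the three cases *)

Section Necessity.
Context {R : realType}.
Variables (l : nat) (f : Cplus R -> R[i]) (g : Cplus R -> Cplus R).

Lemma C_star_bker (c z : R[i]) : 0 < Re z -> C_star l (fun w => c * bker l z w) =
  (fun w => conjc c * (kconst l)%:C / (1 + z * val w) ^+ (l + 2)).
Proof.
move=> z0; apply/funext => w; rewrite /C_star /bker ?num_conjE.
have w0 := val_neq0 w.
have k0 : conjc ((kconst l)%:C : R[i]) = (kconst l)%:C by rewrite /conjc /= oppr0.
have -> : val (inv_conj w) + conjc z = conjc ((1 + z * val w) / val w).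
  rewrite (_ : (1 + z * val w) / val w = (val w)^-1 + z); last by field.
  rewrite /= ?num_conjE -conjc_inv; apply/eqP.
  by rewrite eq_complex !(ReDc, ImDc, Re_conjc, Im_conjc) -!opprD !eqxx.
rewrite !(conjc_mul, conjc_inv, conjc_exp) !conjcK k0.
rewrite exprMn exprVn invfM invrK.
have wn : val w ^+ (l + 2) != 0 by rewrite expf_neq0.
move: ((1 + z * val w) ^- (l + 2)) => A.
by field.
Qed.

(** The adjoint sends [K_z] to [conj (f z) K_(g z)], by the reproducing formula for [h] and [W h]
    with [h] in the domain. Selfadjointness then equates [W (C K_z)] with the conjugation of that
    image; the symmetry is its value at [w]. *)
Lemma kernel_symmetric_of_selfadjoint : C_selfadjoint l (C_star l) (W_max l f g) ->
  kernel_symmetric l f g.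
Proof.
move=> [_ WE] w z.
have z0 : 0 < Re (val z) by case: z.
have gz0 : 0 < Re (val (g z)) by case: (g z).
have bz := bergman_bker l z0; have bg := bergman_bker l gz0.
(* The factor 1 lets [C_star_bker] rewrite both functions. *)
set k := fun v => 1 * bker l (val z) v; set u := fun v => conjc (f z) * bker l (val (g z)) v.
have bk : bergman l k by exact: bergman_scale.
have bu : bergman l u by exact: bergman_scale.
have : conj_by l (C_star l) (adjoint l (W_max l f g)) (C_star l k, C_star l u).
  split => /=; first exact: bergman_C_star.
  exists u; last exact: erefl.
  rewrite /fst C_starK; split; [exact: bk|exact: bu|move=> h v [/= bh bW ->]].
  have kE : k = bker l (val z) by apply/funext => t; rewrite /k mul1r.
  rewrite kE /u (bergman_dotZr _ bh bg) conjcK.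
  have := reproducing bW z0; rewrite ext_val => ->.
  by rewrite (reproducing bh gz0) ext_val.
rewrite -WE => -[_ _]; rewrite /= => /(congr1 (fun F => F w)).
rewrite (C_star_bker _ gz0) (C_star_bker _ z0) conjcK.
have -> : conjc (1 : R[i]) = 1 by rewrite -[1]/(1 +i* 0) /conjc oppr0.
have K0 := kconst_neq0 l (R := R).
move: ((1 + val z * val (g w)) ^- (l + 2)) ((1 + val (g z) * val w) ^- (l + 2)) => A B E.
apply: (mulfI K0); rewrite mulrA [_ * f w]mulrC -mulrA; rewrite mul1r in E.
by rewrite -E mulrCA mulrA.
Qed.

Lemma one_add_mul_neq0 (z w : R[i]) : 0 < Re z -> 0 < Re w -> 1 + z * w != 0.
Proof.
move=> z0 w0; have wn := Re_neq0 w0.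
have -> : 1 + z * w = (w^-1 + z) * w by field.
rewrite mulf_neq0//; apply: Re_neq0; rewrite ReDc ReVc ltr_wpDl//.
by rewrite divr_ge0 ?sqr_ge0// ltW.
Qed.

Let p1 (z : Cplus R) : 0 < Re (val z). Proof. by case: z. Qed.

Let Re1 : 0 < Re (1 : R[i]). Proof. exact: ltr01. Qed.
Let one : Cplus R := exist _ 1 Re1.
Let a : R[i] := val (g one).

Hypotheses (ag : analytic (fun z => val (g z))) (sfg : kernel_symmetric l f g)
  (f_neq0 : exists w, f w <> 0).

Let n1 (z w : Cplus R) : 1 + val z * val (g w) != 0.
Proof. by apply: one_add_mul_neq0; exact: p1. Qed.

Let n2 (z w : Cplus R) : 1 + val (g z) * val w != 0.
Proof. by apply: one_add_mul_neq0; exact: p1. Qed.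

(** By the symmetry a single zero of [f] would make [f] vanish everywhere. *)
Let f_nz z : f z != 0.
Proof.
have [w0 /eqP fw] := f_neq0; have := sfg w0 z; apply: contra_eq_neq => ->.
by rewrite mul0r mulf_neq0// invr_neq0// expf_neq0.
Qed.

(** The symmetry at [z = 1] expresses [f] by [g]; inserting this eliminates [f] and leaves an
    equation for [g] alone. *)
Let f1 (w : Cplus R) : f w = f one * (1 + val (g w)) ^+ (l + 2) / (1 + a * val w) ^+ (l + 2).
Proof.
have := sfg w one; have := n1 one w; have := n2 one w.
rewrite /= mul1r -/a => q1 q2 /(congr1 (fun t => t * (1 + val (g w)) ^+ (l + 2))).
by rewrite divfK ?expf_neq0// => ->; rewrite mulrAC.
Qed.

Let powers (z w : Cplus R) :
  ((1 + val (g w)) * (1 + val w * val (g z)) * (1 + a * val z)) ^+ (l + 2) =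
  ((1 + val (g z)) * (1 + val z * val (g w)) * (1 + a * val w)) ^+ (l + 2).
Proof.
have := sfg w z; rewrite (f1 w) (f1 z) [val (g z) * _]mulrC.
have X n (x : R[i]) : x != 0 -> x ^+ n != 0 by exact: expf_neq0.
have := X (l + 2)%N _ (n1 z w); have := X (l + 2)%N _ (n1 w z).
have := X (l + 2)%N _ (n2 one w); have := X (l + 2)%N _ (n2 one z).
rewrite -/a !exprMn; have := f_nz one.
move: (f one) ((1 + a * val z) ^+ _) ((1 + a * val w) ^+ _) ((1 + val w * _) ^+ _)
  ((1 + val z * _) ^+ _) ((1 + val (g w)) ^+ _) ((1 + val (g z)) ^+ _).
move=> c x y u v s t c0 x0 y0 u0 v0 E.
apply: (mulfI c0); have -> : c * (s * u * x) = (c * s / y / v) * (x * y * u * v).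
  by field; rewrite y0 v0.
by rewrite E; field; rewrite x0 u0.
Qed.

Let identity (z w : Cplus R) :
  (1 + val (g w)) * (1 + val w * val (g z)) * (1 + a * val z) =
  (1 + val (g z)) * (1 + val z * val (g w)) * (1 + a * val w).
Proof.
pose P (q : R[i]) := (1 + val (g w)) * (1 + val w * gmap g q) * (1 + a * q).
pose Q (q : R[i]) := (1 + gmap g q) * (1 + q * val (g w)) * (1 + a * val w).
have dg q : 0 < Re q -> cdiff (gmap g) q by move/analytic_cdiff: ag; exact.
have Pz (v : Cplus R) : P (val v) = (1 + val (g w)) * (1 + val w * val (g v)) * (1 + a * val v).
  by rewrite /P /gmap (ext_val (fun z => val (g z))).
have Qz (v : Cplus R) : Q (val v) = (1 + val (g v)) * (1 + val v * val (g w)) * (1 + a * val w).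
  by rewrite /Q /gmap (ext_val (fun z => val (g z))).
have Q0 (v : Cplus R) : Q (val v) != 0.
  by rewrite Qz; have := n1 one v; rewrite /= mul1r => t; rewrite !mulf_neq0 ?n1//; exact: (n2 one w).
have cst c q : cdiff (fun=> c : R[i]) q := cdiff_cst c q.
have dP q : 0 < Re q -> cdiff P q.
  move=> q0; apply: cdiffM; last by apply: cdiffD => //; apply: cdiffM => //; exact: cdiff_id.
  by apply: cdiffM => //; apply: cdiffD => //; apply: cdiffM => //; exact: dg.
have dQ q : 0 < Re q -> cdiff Q q.
  move=> q0; apply: cdiffM => //; apply: cdiffM; first by apply: cdiffD => //; exact: dg.
  by apply: cdiffD => //; apply: cdiffM => //; exact: cdiff_id.
(* The point [w] is fixed and [z] is replaced by the variable [q]; the quotient is compared with its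
   value 1 at [q = w]. *)
have E := @root_unity_const R (fun q => P q / Q q) l.+1 _ _ (val z) (val w) (p1 z) (p1 w).
rewrite -Pz -Qz; apply: (mulIf (invr_neq0 (Q0 z))); rewrite mulfV// E.
- rewrite [P _](_ : _ = Q (val w)) ?mulfV//.
  by rewrite Pz Qz.
- move=> q q0; apply: cdiffM; first exact: dP.
  by apply: cdiffV; [exact: (Q0 (exist _ q q0))|exact: dQ].
move=> q q0; have := powers (exist _ q q0) w; rewrite -Pz -Qz addn2 /= => PQ.
by rewrite expr_div_n PQ mulfV// expf_neq0//; exact: (Q0 (exist _ q q0)).
Qed.

Let mk (z : R[i]) (z0 : 0 < Re z) : Cplus R := exist _ z z0.

Let D (z : Cplus R) := val (g z) - a * val z.

Let dilation_of_symmetric : (forall z, D z = 0) -> dilation_case f g.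
Proof.
move=> D0; have gE z : val (g z) = a * val z by apply/eqP; rewrite -subr_eq0 -/(D z) D0.
have a0 : 0 < Re a := p1 (g one).
have Ia : Im a = 0.
  apply/eqP; apply/negPn/negP => Ia.
  (* Multiplication by a nonreal [a] sends this point of the half-plane to the imaginary axis. *)
  have b0 : 0 < Re (1 +i* (Re a / Im a)) by rewrite /= ltr01.
  have := p1 (g (mk b0)); rewrite gE ReMc/= mulr1 mulrCA mulfV// mulr1 subrr ltxx.
  by [].
have aE : a = (Re a)%:C by apply/eqP; rewrite eq_complex /= Ia !eqxx.
exists (Re a), (f one); split => // w; split; first by rewrite gE {1}aE.
have := sfg w one; rewrite !gE /= mulr1 mul1r => /(congr1 (fun t => t * (1 + a * val w) ^+ (l + 2))).
by rewrite !divfK// expf_neq0//; exact: (n2 one w).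
Qed.

Let constant_of_const (al : Cplus R) : (forall w, g w = al) -> constant_case l f g.
Proof.
move=> gE; exists al, (f one * (1 + val al) ^+ (l + 2)) => w; split => //.
by rewrite f1 /a !gE.
Qed.

(** For fixed [z] the identity is affine in [w] and in [g w] separately. The product [w * g w] has
    coefficient [D z] and the constant term is [- D z], so division by [D z] gives the normalized
    relation. *)
Let moebius_relation z : D z != 0 -> exists de ka : R[i], forall w : Cplus R,
  val (g w) * (val w + ka) = 1 + de * val w.
Proof.
move=> Dz; exists ((a + a * val (g z) - val (g z) - a * val z * val (g z)) / D z),
  ((1 - val z + a * val z - val z * val (g z)) / D z) => w.
have := identity z w; have : val (g z) = D z + a * val z by rewrite /D subrK.
move: (D z) Dz (val (g w)) (val (g z)) (val w) (val z) => d d0 X Y v u YE E.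
apply: (mulIf d0); transitivity (X * (v * d + (1 - u + a * u - u * Y))); first by field.
transitivity (d + (a + a * Y - Y - a * u * Y) * v); last by field.
have -> : d = Y - a * u by rewrite YE addrK.
apply/eqP; rewrite -subr_eq0; apply/eqP.
transitivity ((1 + X) * (1 + v * Y) * (1 + a * u) - (1 + Y) * (1 + u * X) * (1 + a * v)); first by ring.
by rewrite E subrr.
Qed.

(** A negative [d] fails for large [v]. For [d = 0] the form is affine in [v], so [g2 = 0]. For
    positive [d] the minimum over [v] is taken at [- g2 / (2 * d)], and [s] tends to [k]. *)
Lemma half_plane_quadratic (d k g1 g2 : R) : 0 <= k ->
  (forall s v, k < s -> 0 < d * (s ^+ 2 + v ^+ 2) + g1 * s + g2 * v) ->
  [/\ d = 0, g2 = 0 & 0 < g1] \/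
  (0 < d /\ (g1 ^+ 2 + g2 ^+ 2 <= (2 * d * k + g1) ^+ 2 /\ 0 <= 2 * d * k + g1)).
Proof.
move=> k0 H; have kk : k < k + 1 by rewrite ltrDl.
have [d0|d0|d0] := ltgtP d 0.
- exfalso; set s := k + 1 in kk; pose C := d * s ^+ 2 + g1 * s.
  pose v := 1 + `|C| / (- d).
  have v1 : 1 <= v by rewrite lerDl divr_ge0// oppr_ge0 ltW.
  have dv : - d * v = - d + `|C| by rewrite /v; field; rewrite lt_eqF.
  have vv : - d * v <= - d * v ^+ 2 by apply: ler_wpM2l; [rewrite oppr_ge0 ltW|rewrite expr2 ler_peMl// (le_trans ler01)].
  have := H s v kk; have := H s (- v) kk; have := ler_norm C; rewrite sqrrN /C.
  by rewrite /C in dv vv; lra.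
- right; split => //.
  have K s : k < s -> g1 ^+ 2 + g2 ^+ 2 < (2 * d * s + g1) ^+ 2.
    move=> ks; have := H s (- g2 / (2 * d)) ks.
    rewrite -(pmulr_rgt0 _ (_ : 0 < 4 * d)); last by rewrite mulr_gt0.
    rewrite (_ : 4 * d * _ = (2 * d * s + g1) ^+ 2 - (g1 ^+ 2 + g2 ^+ 2)); first by rewrite subr_gt0.
    by field; rewrite gt_eqF.
  have S0 : 0 <= g1 ^+ 2 + g2 ^+ 2 by rewrite addr_ge0 ?sqr_ge0.
  have pos : 0 <= 2 * d * k + g1.
    (* Otherwise [s = - g1 / (2 * d)] exceeds [k] and makes the square in [K] vanish. *)
    rewrite leNgt; apply/negP => neg.
    have ks : k < - g1 / (2 * d) by rewrite ltr_pdivlMr ?mulr_gt0// mulrC; lra.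
    have := K _ ks; rewrite (_ : 2 * d * (- g1 / (2 * d)) + g1 = 0); last by field; rewrite gt_eqF.
    by rewrite expr0n /= ltNge S0.
  split => //; rewrite leNgt; apply/negP => lt1.
  pose B := 2 * d * k + g1.
  have {}lt1 : B ^+ 2 < g1 ^+ 2 + g2 ^+ 2 by [].
  (* For [e <= 1] one has [(B + e)^2 <= B^2 + e (2 B + 1)], so this [e] contradicts [K] at
     [s = k + e / (2 * d)]. *)
  pose e := Num.min 1 ((g1 ^+ 2 + g2 ^+ 2 - B ^+ 2) / (2 * B + 1)).
  have B0 : 0 < 2 * B + 1 by rewrite ltr_wpDl// mulr_ge0.
  have e0 : 0 < e by rewrite lt_min ltr01 divr_gt0// subr_gt0.
  have e1 : e <= 1 by rewrite ge_min lexx.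
  have e2 : e * (2 * B + 1) <= g1 ^+ 2 + g2 ^+ 2 - B ^+ 2.
    by rewrite -ler_pdivlMr// ge_min lexx orbT.
  have := K (k + e / (2 * d)); rewrite ltrDl divr_gt0 ?mulr_gt0// => /(_ isT).
  rewrite (_ : 2 * d * (k + e / (2 * d)) + g1 = B + e); last by rewrite /B; field; rewrite gt_eqF.
  have : e ^+ 2 <= e by rewrite expr2 ler_piMl// ltW.
  by rewrite sqrrD mulr2n; lra.
left; split => //.
  apply/eqP; apply/negPn/negP => g20.
  have := H (k + 1) (- (g1 * (k + 1)) / g2) kk.
  by rewrite d0 mul0r add0r mulrCA mulfV// mulr1 addrN ltxx.
have := H (k + 1) 0 kk; rewrite d0 mul0r mulr0 add0r addr0 pmulr_lgt0//.
by apply: le_lt_trans k0 kk.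
Qed.

Let moebius_of_relation (de ka : R[i]) :
  (forall w : Cplus R, val (g w) * (val w + ka) = 1 + de * val w) -> de * ka != 1 ->
  moebius_case l f g.
Proof.
move=> rel dk; pose ga := 1 - de * ka.
(* At [w = - ka] the relation would read [0 = 1 - de * ka]. *)
have w0 (w : Cplus R) : val w + ka != 0.
  apply/negP => /eqP w0; have := rel w; rewrite w0 mulr0 => /eqP.
  have -> : val w = - ka by apply/eqP; rewrite -addr_eq0 w0.
  by rewrite mulrN eq_sym subr_eq0 eq_sym; apply/negP.
have gE w : val (g w) = de + ga / (val w + ka).
  apply: (mulIf (w0 w)); rewrite rel mulrDl divfK// /ga; ring.
have k0 : 0 <= Re ka.
  rewrite leNgt; apply/negP => k0.
  have nk : 0 < Re (- ka) by rewrite ReNc oppr_gt0.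
  by have := w0 (mk nk); rewrite /= addNr eqxx.
(* In the variable [u = w + ka] this form is [|u|^2 Re (g w)]. *)
have quad (s v : R) : Re ka < s -> 0 < Re de * (s ^+ 2 + v ^+ 2) + Re ga * s + Im ga * v.
  move=> ks; pose u : R[i] := s +i* v.
  have b0 : 0 < Re (u - ka) by rewrite ReDc ReNc subr_gt0.
  have := p1 (g (mk b0)); rewrite gE /= subrK ReDc ReMc ReVc ImVc sqr_normcE /=.
  have s0 : 0 < s := le_lt_trans k0 ks.
  have q0 : 0 < s ^+ 2 + v ^+ 2 by rewrite ltr_pwDl ?sqr_ge0 ?exprn_gt0.
  rewrite -(pmulr_rgt0 _ q0); congr (0 < _); field; rewrite gt_eqF//.
exists de, ka, (f one * (1 + ka) ^+ (l + 2)); split; last first.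
  move=> w; split; first exact: gE.
  have wn := w0 w; have on := w0 one; rewrite /= in on.
  rewrite f1 -mulrA -mulrA; congr (_ * _).
  have n := n2 one w; have n' := n1 one w; rewrite /= mul1r -/a in n n'.
  have X (x : R[i]) : x != 0 -> x ^+ (l + 2) != 0 by exact: expf_neq0.
  apply/eqP; rewrite eqr_div ?X// -!exprMn; apply/eqP; congr (_ ^+ _).
  have r1 := rel one; have r := rel w; rewrite /= mulr1 -/a in r1.
  transitivity ((val w + ka) + val (g w) * (val w + ka)); first by ring.
  transitivity ((1 + ka) + a * (1 + ka) * val w); last by ring.
  by rewrite r r1; ring.
have Rga : Re ga = 1 - Re (de * ka) by rewrite /ga ReDc ReNc.
have Iga : Im ga = - Im (de * ka) by rewrite /ga ImDc ImNc /= sub0r.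
case: (half_plane_quadratic k0 quad) => [[d0 i0 r0]|[d0 [le1 le0]]]; [left|right].
  split => //; first by apply/eqP; rewrite -oppr_eq0 -Iga i0.
  by rewrite -subr_gt0 -Rga.
rewrite oppr_lt0; split => //.
have Ng : N (de * ka - 1) = N ga by rewrite normcB_sym.
have Rg : Re (de * ka - 1) = - Re ga by rewrite /ga !(ReDc, ReNc) opprB.
rewrite Ng Rg subr_ge0 ler_pdivrMr ?mulr_gt0//.
have : N ga <= 2 * Re de * Re ka + Re ga.
  by rewrite -(ler_pXn2r (n := 2))// ?nnegrE ?normc_ge0// sqr_normcE.
move=> H; rewrite addrC lerBlDr; apply: le_trans H _.
by rewrite le_eqVlt; apply/orP; left; apply/eqP; ring.
Qed.

Lemma cases_of_kernel_symmetric :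
  constant_case l f g \/ dilation_case f g \/ moebius_case l f g.
Proof.
have [D0|/existsNP[z /eqP Dz]] := pselect (forall z, D z = 0).
  by right; left; exact: dilation_of_symmetric.
have [de [ka rel]] := moebius_relation Dz.
have [dk|dk] := eqVneq (de * ka) 1; last by right; right; exact: moebius_of_relation rel dk.
left.
have relE w : val (g w) * (val w + ka) = de * (val w + ka) by rewrite rel mulrDr dk addrC.
have de0 : 0 < Re de.
  (* At most one of the points 1 and 2 equals [- ka]. At the other the relation gives [g w = de],
     which places [de] in the half-plane. *)
  pose two : Cplus R := mk (addr_gt0 Re1 Re1 : 0 < Re (1 + 1)).
  have [w wk] : exists w : Cplus R, val w + ka != 0.
    have [e|?] := eqVneq (val one + ka) 0; last by exists one.
    exists two; rewrite /= -addrA -/(val one) e addr0; exact: oner_neq0.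
  by rewrite -(mulIf wk (relE w)).
have dn := Re_neq0 de0.
have ka0 : 0 < Re ka.
  have -> : ka = de^-1 by apply: (mulfI dn); rewrite dk mulfV.
  by rewrite ReVc divr_gt0// exprn_gt0// normc_gt0.
apply: (@constant_of_const (mk de0)) => w; apply: val_inj => /=.
apply: (mulIf _ (relE w)); apply: Re_neq0; rewrite ReDc addr_gt0//; exact: p1.
Qed.

End Necessity.

Section Main.
Context {R : realType}.

(** For [f = 0] the operator is selfadjoint for the conjugation with any [g], so boundedness cannot
    be read off from the three cases and is checked directly. *)
Lemma bounded_of_zero l (f : Cplus R -> R[i]) g : (forall w, f w = 0) ->
  bounded_op l (W_max l f g).
Proof.
move=> f0; apply: (@bounded_op_W _ l f g 0) => // h bh.
have -> : Wop f g h = (fun w => 0 * h w) by apply/funext => w; rewrite /Wop f0 !mul0r.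
split; first exact: bergman_scale.
by rewrite (bsq_scale l 0 ((bergmanP l h).1 bh).1) Normc.normc0 expr0n.
Qed.

End Main.

Theorem theorem6p3 (R : realType) (l : nat) (f : Cplus R -> R[i])
    (g : Cplus R -> Cplus R) (f_analytic : analytic f)
    (g_analytic : analytic (fun z => val (g z))) :
  ((exists w, f w <> 0) -> C_selfadjoint l (C_star l) (W_max l f g) ->
     constant_case l f g \/ dilation_case f g \/ moebius_case l f g) /\
  (constant_case l f g \/ dilation_case f g \/ moebius_case l f g ->
     C_selfadjoint l (C_star l) (W_max l f g)) /\
  (C_selfadjoint l (C_star l) (W_max l f g) -> bounded_op l (W_max l f g)).
Proof.
have nec : (exists w, f w <> 0) -> C_selfadjoint l (C_star l) (W_max l f g) ->
    constant_case l f g \/ dilation_case f g \/ moebius_case l f g.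
  move=> fn0 sa; apply: cases_of_kernel_symmetric => //.
  exact: kernel_symmetric_of_selfadjoint.
have suf : constant_case l f g \/ dilation_case f g \/ moebius_case l f g ->
    C_selfadjoint l (C_star l) (W_max l f g) /\ bounded_op l (W_max l f g).
  move=> [c|[d|m]]; first exact: constant_case_selfadjoint.
    exact: dilation_case_selfadjoint.
  exact: moebius_case_selfadjoint.
split => //; split => [c|sa]; first by have [] := suf c.
have [fn0|f0] := pselect (exists w, f w <> 0); first by have [] := suf (nec fn0 sa).
by apply: bounded_of_zero => w; apply: contrapT => fw; apply: f0; exists w.
Qed.
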